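(* Let $\alpha\in(0,1)$, $T>0$, let $\Omega\subset\mathbb{R}^d$ be a bounded domain, and let $V$ be a Banach space such that $V\hookrightarrow L^2(\Omega)\hookrightarrow V'$ forms a Gelfand triple. Let $u\in H^\alpha(0,T;V')\cap L^\infty(0,T;V)$ with initial value $u_0\in L^2(\Omega)$, and let $E\in C^1(\mathbb{R})$ be a $\lambda$-convex function with $\lambda\in\mathbb{R}$. If $E'(u)\in L^2(0,T;V)$, then for all $t\in(0,T)$ $$\int_0^t\langle\partial_t^\alpha u,E'(u)\rangle_V-\lambda\langle\partial_t^\alpha u,u\rangle_V\,ds\ \ge\ \Big(g_{1-\alpha}*\int_\Omega E(u)-E(u_0)\,dx\Big)(t)-\frac\lambda2\Big(g_{1-\alpha}*\big(\|u\|_{L^2(\Omega)}^2-\|u_0\|_{L^2(\Omega)}^2\big)\Big)(t)$$ and $$\big(g_\alpha*\langle\partial_t^\alpha u,E'(u)\rangle_V\big)(t)-\lambda\big(g_\alpha*\langle\partial_t^\alpha u,u\rangle_V\big)(t)\ \ge\ \int_\Omega E(u(t))-E(u_0)\,dx-\frac\lambda2\big(\|u(t)\|_{L^2(\Omega)}^2-\|u_0\|_{L^2(\Omega)}^2\big).$$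
   Context: For $\beta>0$ set $g_\beta(t)=t^{\beta-1}/\Gamma(\beta)$, $t>0$; $(g*\varphi)(t)=\int_0^t g(t-s)\varphi(s)\,ds$ is convolution in time on the positive half-line. For a function $u$ with initial value $u_0$, the (Caputo) fractional derivative is $\partial_t^\alpha u=\partial_t\big(g_{1-\alpha}*(u-u_0)\big)$, where $u_0$ is the initial value in the sense that $(g_{1-\alpha}*(u-u_0))(0)=0$. For a Banach space $X$, $H^\alpha(0,T;X)=\{u\in L^2(0,T;X):\partial_t^\alpha u\in L^2(0,T;X)\}$. $V'$ is the dual of $V$ and $\langle\cdot,\cdot\rangle_V$ is the duality pairing between $V'$ and $V$. A function $E:\mathbb{R}\to\mathbb{R}$ is $\lambda$-convex if $x\mapsto E(x)-\frac\lambda2|x|^2$ is convex.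
   Formalization: The second inequality is stated for almost every t in (0,T) instead of all t, since u is only an equivalence class in time, so u(t) is undefined at single times, and the convolution of g_α with an integrable function may diverge at individual t. *)

(* Defs.v *)
From HB Require Import structures.
From mathcomp Require Import all_boot all_order all_algebra.
From mathcomp Require Import all_classical all_reals all_analysis.
From mathcomp Require Import measurable_realfun.
Set Implicit Arguments.
Unset Strict Implicit.
Unset Printing Implicit Defensive.
Import Order.TTheory GRing.Theory Num.Theory.
Import numFieldNormedType.Exports.
Local Open Scope classical_set_scope.
Local Open Scope ring_scope.

Section borel_rV.
Variables (R : realType) (d : nat).

HB.instance Definition _ := @isMeasurable.Build (sigma_display (@open 'rV[R]_d))
  'rV[R]_d <<s @open 'rV[R]_d >> (@sigma_algebra0 _ setT _)
  (@sigma_algebraC _ _) (@sigma_algebra_bigcup _ setT _).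

Lemma open_measurable_rV (U : set 'rV[R]_d) : open U -> measurable U.
Proof. exact: sub_sigma_algebra. Qed.

End borel_rV.

Section lebesgue_rV.
Variable R : realType.

(* (x, t) in R^n x R seen as a point of R^(n+1), with t as last coordinate. *)
Definition rcons_rV n (p : 'rV[R]_n * measurableTypeR R) : 'rV[R]_n.+1 :=
  \row_j if unlift ord_max j is Some k then p.1 ord0 k else p.2.

Let rat_near (x e : R) : 0 < e -> exists q : rat, `|x - ratr q| < e.
Proof.
move=> e0; have [|q] := @rat_in_itvoo R (x - e) (x + e).
  by rewrite ltrD2l gtrN.
by rewrite in_itv/= => /andP[? ?]; exists q; rewrite ltr_distlC; apply/andP.
Qed.

Lemma measurable_rcons_rV n : measurable_fun [set: _] (@rcons_rV n).
Proof.
apply: (@measurability _ _ _ _ _ _ (@open 'rV[R]_n.+1)) => //.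
move=> _ [U oU <-]; rewrite setTI.
pose B (i : rat * 'rV[rat]_n * nat) : set ('rV[R]_n * measurableTypeR R) :=
  ball (map_mx ratr i.1.2 : 'rV[R]_n) (i.2.+1%:R^-1) `*`
  ball (ratr i.1.1 : R) (i.2.+1%:R^-1).
have mB i : measurable (B i).
  apply: measurableX.
    by apply: open_measurable_rV; apply: ball_open; rewrite invr_gt0.
  by apply: open_measurable; apply: ball_open; rewrite invr_gt0.
have -> : @rcons_rV n @^-1` U =
    \bigcup_(i in [set i | B i `<=` @rcons_rV n @^-1` U]) B i.
  apply/seteqP; split; last by move=> p [i]; exact.
  move=> p Up.
  have /nbhs_ballP[e /= e0 eU] : nbhs (rcons_rV p) U by exact: open_nbhs_nbhs.
  have [k ke] : exists k : nat, k.+1%:R^-1 < e / 2 :> R.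
    have e2 : 0 < e / 2 by rewrite divr_gt0.
    have [k _ Hk] := near_infty_natSinv_lt (PosNum e2).
    by exists k; apply: Hk => /=.
  have k0 : 0 < k.+1%:R^-1 :> R by rewrite invr_gt0.
  have [q1 q1P] := rat_near p.2 k0.
  have /choice[f fP] := fun j : 'I_n => rat_near (p.1 ord0 j) k0.
  exists (q1, \row_j f j, k) => /=; last first.
    split; rewrite /= -ball_normE /ball_/= distrC//.
    rewrite /Num.norm/= mx_normrE.
    by apply/bigmax_ltP; split => //= -[i j] _; rewrite !mxE (ord1 i).
  move=> y [/= y2 y1]; apply: eU.
  rewrite -ball_normE /ball_/= /Num.norm/= mx_normrE.
  apply/bigmax_ltP; split => //= -[i j] _; rewrite !mxE.
  rewrite [e]splitr; case: (unlift ord_max j) => [l|].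
    rewrite -(subrKA (ratr (f l))) (le_lt_trans (ler_normD _ _))// ltrD//.
      exact: lt_trans ke.
    apply: le_lt_trans ke; apply: ltW; move: y2.
    rewrite -ball_normE /ball_/= /Num.norm/= mx_normrE => /bigmax_ltP[_].
    by move=> /(_ (ord0, l) isT); rewrite !mxE.
  rewrite -(subrKA (ratr q1)) (le_lt_trans (ler_normD _ _))// ltrD//.
    exact: lt_trans ke.
  apply: lt_trans ke; move: y1.
  by rewrite -ball_normE.
rewrite bigcup_mkcond; apply: countable_bigcupT_measurable => //.
by move=> i; case: ifPn.
Qed.

Section step.
Variables (n : nat) (m : {measure set 'rV[R]_n -> \bar R}).

Definition lebesgue_rV_step : set 'rV[R]_n.+1 -> \bar R :=
  pushforward (m \x (@lebesgue_measure R))%E (@rcons_rV n).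

Let lebesgue_rV_step0 : lebesgue_rV_step set0 = 0%E.
Proof. by rewrite /lebesgue_rV_step /pushforward preimage_set0 measure0. Qed.

Let lebesgue_rV_step_ge0 A : (0 <= lebesgue_rV_step A)%E.
Proof. by rewrite /lebesgue_rV_step /pushforward measure_ge0. Qed.

Let lebesgue_rV_step_sigma_additive : semi_sigma_additive lebesgue_rV_step.
Proof.
move=> F mF tF mUF; rewrite /lebesgue_rV_step /pushforward preimage_bigcup.
apply: measure_semi_sigma_additive.
- by move=> k; rewrite -[X in measurable X]setTI; exact: measurable_rcons_rV.
- apply/trivIsetP => /= i j _ _ ij; rewrite -preimage_setI.
  by move/trivIsetP : tF => /(_ _ _ _ _ ij) ->//; rewrite preimage_set0.
- rewrite -preimage_bigcup -[X in measurable X]setTI.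
  exact: measurable_rcons_rV.
Qed.

HB.instance Definition _ := isMeasure.Build _ _ _ lebesgue_rV_step
  lebesgue_rV_step0 lebesgue_rV_step_ge0 lebesgue_rV_step_sigma_additive.

End step.

(* Lebesgue measure on the Borel sets of R^d, built one coordinate at a time:
   R^0 carries the unit point mass, R^(n+1) = R^n x R the product measure. *)
Fixpoint lebesgue_rV (d : nat) : {measure set 'rV[R]_d -> \bar R} :=
  if d is n.+1 then lebesgue_rV_step (lebesgue_rV n) else dirac (0 : 'rV[R]_0).

End lebesgue_rV.
Arguments lebesgue_rV R d : clear implicits.

Section dual.
Variables (R : realType) (V : normedModType R).

Definition dual_pred : {pred V -> R^o} :=
  fun f => `[< linear f /\ continuous f >].

Let dual_submod_closed : submod_closed dual_pred.
Proof.
split; first by apply/asboolP; split=> [a x y|x]; [rewrite scaler0 addr0|exact: cvg_cst].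
move=> a f g /asboolP[lf cf] /asboolP[lg cg]; apply/asboolP; split.
  move=> b x y; rewrite !fctE lf lg !scalerDr !scalerA [b * a]mulrC.
  by rewrite addrACA.
by move=> x; apply: cvgD; [apply: cvgZr; exact: cf|exact: cg].
Qed.

HB.instance Definition _ :=
  GRing.isSubmodClosed.Build R (V -> R^o) dual_pred dual_submod_closed.

Record dual := Dual { dual_fun :> V -> R^o; _ : dual_fun \in dual_pred }.

HB.instance Definition _ := [isSub for dual_fun].
HB.instance Definition _ := [Choice of dual by <:].
HB.instance Definition _ := [SubChoice_isSubLmodule of dual by <:].


Definition dual_norm (f : dual) : R := sup [set `|f v| | v in [set v | `|v| <= 1]].

Lemma dual_linear (f : dual) : linear f.
Proof. by case: f => f /= /asboolP[]. Qed.

Lemma dual_continuous (f : dual) : continuous f.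
Proof. by case: f => f /= /asboolP[]. Qed.

Let dual0 (f : dual) : f 0 = 0.
Proof. by have := dual_linear f (-1) 0 0; rewrite scaler0 addr0 scaleN1r addNr. Qed.

Let dualZ (f : dual) a v : f (a *: v) = a * f v.
Proof. by have := dual_linear f a v 0; rewrite !addr0 dual0 addr0. Qed.

Let dual_has_sup (f : dual) :
  has_sup [set `|f v| | v in [set v | `|v| <= 1]].
Proof.
split; first by exists `|f 0|; exists 0 => //=; rewrite normr0.
have /cvgrPdist_lt /(_ 1 ltr01) /nbhs_ballP[e /= e0 He] := @dual_continuous f (0 : V).
exists (2 / e) => _ [v /= v1 <-].
have e2 : 0 < e / 2 by rewrite divr_gt0.
have : `|f 0 - f ((e / 2) *: v)| < 1.
  apply: He; rewrite -ball_normE /ball_/= sub0r normrN normrZ gtr0_norm//.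
  apply: (@le_lt_trans _ _ (e / 2)); first by rewrite ler_piMr// ltW.
  by rewrite ltr_pdivrMr// ltr_pMr// ltr1n.
rewrite dual0 sub0r normrN dualZ normrM gtr0_norm// mulrC.
by rewrite -ltr_pdivlMr// => /ltW; rewrite div1r invf_div.
Qed.

Let dual_norm_ge0 (f : dual) : 0 <= dual_norm f.
Proof.
have [_ ub] := dual_has_sup f.
apply: le_trans (ub_le_sup ub _); last by exists 0 => //=; rewrite normr0.
exact: normr_ge0.
Qed.

Lemma dual_norm_ge (f : dual) v : `|f v| <= dual_norm f * `|v|.
Proof.
have [->|v0] := eqVneq v 0; first by rewrite dual0 !normr0 mulr0.
have nv0 : 0 < `|v| by rewrite normr_gt0.
rewrite -ler_pdivrMr//.
have [_ ub] := dual_has_sup f; apply: ub_le_sup => //.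
exists (`|v|^-1 *: v) => /=.
  by rewrite normrZ ger0_norm ?invr_ge0// mulVf ?gt_eqF.
by rewrite dualZ normrM ger0_norm ?invr_ge0// mulrC.
Qed.

Let dual_norm_le (f : dual) C : 0 <= C -> (forall v, `|f v| <= C * `|v|) ->
  dual_norm f <= C.
Proof.
move=> C0 fC; apply: ge_sup; first by case: (dual_has_sup f).
by move=> _ [v /= v1 <-]; rewrite (le_trans (fC v))// ler_piMr.
Qed.

Let ler_dual_normD (f g : dual) : dual_norm (f + g) <= dual_norm f + dual_norm g.
Proof.
apply: dual_norm_le => [|v]; first exact: addr_ge0.
by rewrite (le_trans (ler_normD _ _))// mulrDl lerD// dual_norm_ge.
Qed.

Let dual_normZ_le a (f : dual) : dual_norm (a *: f) <= `|a| * dual_norm f.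
Proof.
apply: dual_norm_le => [|v]; first exact: mulr_ge0.
by rewrite /= normrM -mulrA ler_wpM2l// dual_norm_ge.
Qed.

Let dual_normZ a (f : dual) : dual_norm (a *: f) = `|a| * dual_norm f.
Proof.
apply/eqP; rewrite eq_le dual_normZ_le /=.
have [->|a0] := eqVneq a 0; first by rewrite normr0 mul0r.
rewrite mulrC -ler_pdivlMr ?normr_gt0// mulrC -normfV.
by rewrite -{1}[f]scale1r -(mulVf a0) -scalerA.
Qed.

Let dual_norm_eq0 (f : dual) : dual_norm f = 0 -> f = 0.
Proof.
move=> f0; apply/val_inj/funext => v /=.
by apply/eqP; rewrite -normr_le0 (le_trans (dual_norm_ge f v))// f0 mul0r.
Qed.

HB.instance Definition _ := @Lmodule_isNormed.Build R dual dual_norm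
  ler_dual_normD dual_normZ dual_norm_eq0.

End dual.

Section bochner.
Context d (T : measurableType d) (R : realType) (X : normedModType R).
Variable mu : {measure set T -> \bar R}.

Definition simple_function (s : T -> X) :=
  finite_set (range s) /\ forall x, measurable (s @^-1` [set x]).

(* [fine] sends an infinite measure to 0: harmless for integrable simple
   functions, whose level sets of nonzero value have finite measure. *)
Definition simple_integral (A : set T) (s : T -> X) : X :=
  \sum_(x \in range s) fine (mu (A `&` s @^-1` [set x])) *: x.

(* Elements of Bochner spaces are handled through representatives; as for
   [LfunType], the representatives are taken measurable everywhere on A. *)
Definition strongly_measurable (A : set T) (f : T -> X) :=
  exists2 s : nat -> T -> X, (forall n, simple_function (s n)) &
    forall t, A t -> s n t @[n --> \oo] --> f t.

Definition is_bochner_integral (A : set T) (f : T -> X) (I : X) :=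
  strongly_measurable A f /\
  exists s : nat -> T -> X,
    [/\ forall n, simple_function (s n),
        forall n, (\int[mu]_(t in A) `|s n t|%:E < +oo)%E,
        (\int[mu]_(t in A) `|f t - s n t|%:E)%E @[n --> \oo] --> 0%E &
        simple_integral A (s n) @[n --> \oo] --> I].

End bochner.

Section fractional_derivative.
Variable R : realType.
Local Notation leb := (@lebesgue_measure R).

Definition time_measure (T : R) : {measure set (measurableTypeR R) -> \bar R} :=
  mrestr leb (measurable_itv `]0, T[).

Definition euler_gamma (b : R) : R :=
  \int[leb]_(x in `]0, +oo[) (x `^ (b - 1) * expR (- x)).

Definition gker (b t : R) : R := t `^ (b - 1) / euler_gamma b.

(* Extended-real valued, since phi or the convolution may be infinite. *)
Definition time_conv (k : R -> R) (phi : R -> \bar R) (t : R) : \bar R :=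
  (\int[leb]_(s in `]0%R, t[) ((k (t - s))%:E * phi s))%E.

Definition test_function (T : R) (phi : R -> R^o) :=
  (forall n t, derivable (derive1n n phi) t 1) /\
  exists a b : R, [/\ 0 < a, b < T & forall t, t \notin `[a, b] -> phi t = 0].

Variable X : normedModType R.

Definition bochner_Lp (p : \bar R) (T : R) (f : measurableTypeR R -> X) :=
  strongly_measurable `]0, T[ f /\
  finite_norm (time_measure T) p (fun t => `|f t|).

Definition weak_derivative (T : R) (k D : measurableTypeR R -> X) :=
  forall phi, test_function T phi -> exists I,
    is_bochner_integral leb `]0, T[ (fun t => derive1 phi t *: k t) I /\
    is_bochner_integral leb `]0, T[ (fun t => phi t *: D t) (- I).

(* D = d/dt (gker (1 - a) * (u - u0)) and (gker (1 - a) * (u - u0))(0) = 0,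
   where k is the continuous representative of the convolution, an element of
   W^(1,1)(0, T; X). *)
Definition caputo_derivative (a T : R) (u : measurableTypeR R -> X) (u0 : X)
    (D : measurableTypeR R -> X) :=
  exists k : R -> X,
    [/\ {ae leb, forall t, t \in `]0, T[ ->
          is_bochner_integral leb `]0, t[
            (fun s => gker (1 - a) (t - s) *: (u s - u0)) (k t)},
        {within `[0, T], continuous k},
        k 0 = 0 &
        weak_derivative T k D].

(* u is in H^a(0, T; X), with initial value u0 and fractional derivative D. *)
Definition H_frac (a T : R) (u : measurableTypeR R -> X) (u0 : X)
    (D : measurableTypeR R -> X) :=
  [/\ bochner_Lp 2%:E T u, bochner_Lp 2%:E T D & caputo_derivative a T u u0 D].

End fractional_derivative.

Section gelfand.
Context d (O : measurableType d) (R : realType).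
Variable m : {measure set O -> \bar R}.

Definition L2norm (h : O -> R) : R := fine ('N[m]_2%:E[EFin \o h]).

Variable V : normedModType R.

(* V -> L^2 is linear, injective, bounded, with dense range; the elements of
   L^2 being classes, the pointwise identities hold almost everywhere. *)
Record gelfand_triple := GelfandTriple {
  embed :> V -> LspaceType2 m;
  embed_linear : forall (a : R) (v w : V),
    embed (a *: v + w) = (fun x => a * embed v x + embed w x) %[ae m];
  embed_inj : forall v w : V, embed v = embed w %[ae m] -> v = w;
  embed_bounded : exists C : R, forall v : V, L2norm (embed v) <= C * `|v|;
  embed_dense : forall (h : LspaceType2 m) (e : R), 0 < e ->
    exists v : V, L2norm (fun x => h x - embed v x) < e
}.

Variable i : gelfand_triple.

Definition L2_pairing (h : LspaceType2 m) (v : V) : R^o :=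
  \int[m]_x (h x * i v x).

Let L2_pairing_dual h : L2_pairing h \in @dual_pred R V.
Proof.
have mE (f : LspaceType2 m) : measurable_fun setT (f : O -> R).
  exact: (@measurable_funPT _ _ _ _ (repr (f : {mfun_ m, O >-> measurableTypeR R}))).
have LE (f : LspaceType2 m) : (f : O -> R) \in Lfun m 2%:E.
  rewrite inE; apply/andP; split; rewrite inE//=.
  exact: Lebesgue_finite.
have iE (f k : LspaceType2 m) : m.-integrable setT (EFin \o (fun x => f x * k x)).
  by apply/Lfun1_integrable; exact: Lfun2_mul_Lfun1.
have normE (f : LspaceType2 m) : (L2norm (f : O -> R))%:E = 'N[m]_2%:E[EFin \o f]%E.
  rewrite /L2norm fineK// ge0_fin_numE ?Lnorm_ge0//.
  exact: (@Lebesgue_finite _ _ _ _ _ _ f).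
have lin : linear (L2_pairing h).
  move=> a v w; rewrite /L2_pairing.
  transitivity (\int[m]_x (a * (h x * i v x) + h x * i w x)).
    congr fine; apply: ae_eq_integral => //.
    - by apply/measurable_EFinP; exact: measurable_funM.
    - apply/measurable_EFinP; apply: measurable_funD.
        by apply: measurable_funM => //; exact: measurable_funM.
      exact: measurable_funM.
    - apply: filterS (embed_linear i a v w) => x /(_ I) -> _.
      by congr EFin; rewrite mulrDr mulrCA.
  have aiE : m.-integrable setT (EFin \o (fun x => a * (h x * i v x))).
    have := integrableZl measurableT a (iE h (i v)).
    by apply: eq_integrable => //= x _; rewrite EFinM.
  by rewrite RintegralD// RintegralZl.
have [C iC] := embed_bounded i.
have bnd v : `|L2_pairing h v| <= (L2norm h * C) * `|v|.
  rewrite -mulrA; apply: (@le_trans _ _ (L2norm h * L2norm (i v))); last first.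
    by rewrite ler_wpM2l// fine_ge0// Lnorm_ge0.
  rewrite -lee_fin EFinM !normE EFin_normr_Rintegral//.
  have step1 : (`|\int[m]_x (h x * i v x)%:E| <=
      'N[m]_1%:E[(EFin \o h) \* (EFin \o i v)])%E.
    rewrite Lnorm1; apply: le_trans (le_abse_integral _ measurableT _) _.
      by apply/measurable_EFinP; exact: measurable_funM.
    by [].
  apply: (le_trans step1); apply: (@hoelder _ _ _ m h (i v) 2 2) => //.
  by rewrite [RHS]splitr !div1r.
apply/asboolP; split => // v; apply/cvgrPdist_lt => e e0.
have K0 : 0 < `|L2norm h * C| + 1 by rewrite ltr_wpDl.
apply/nbhs_normP; exists (e / (`|L2norm h * C| + 1)) => /=; first exact: divr_gt0.
move=> w /= vw.
have -> : L2_pairing h v - L2_pairing h w = L2_pairing h (v - w).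
  by rewrite -[v - w]addrC -[- w]scaleN1r lin addrC scaleN1r.
apply: le_lt_trans (bnd _) _.
apply: (@le_lt_trans _ _ ((`|L2norm h * C| + 1) * `|v - w|)).
  by rewrite ler_wpM2r// (le_trans (ler_norm _))// lerDl.
by rewrite mulrC -ltr_pdivlMr.
Qed.

(* The embedding L^2 = (L^2)' -> V', adjoint of V -> L^2. *)
Definition L2_dual (h : LspaceType2 m) : dual V := Dual (L2_pairing_dual h).

End gelfand.

Definition C1 (R : realType) (E : R -> R^o) :=
  (forall x, derivable E x 1) /\ continuous (derive1 E).

Definition lambda_convex (R : realType) (l : R) (E : R -> R) :=
  convex_function [set: R^o] (fun x : R^o => E x - l / 2 * `|x| ^+ 2).

Definition lebesgue_on (R : realType) (n : nat) (O : set 'rV[R]_n)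
    (oO : open O) : {measure set 'rV[R]_n -> \bar R} :=
  mrestr (lebesgue_rV R n) (open_measurable_rV oO).

(* Main.v *)
(** Put F x = E x - lambda / 2 * x ^ 2, a convex function, and let
    h t be the integral over Omega of F (u t) - F u0.  The chain rule for F
    amounts to h <= g_alpha * <f, F'(u)>, where f is the fractional derivative
    of u; convolving with g_(1 - alpha) gives its integrated form.

    Testing with v in V shows u - u0 = g_alpha * f in V'.  Cutting the kernel
    g_(1 - alpha) off at e > 0, with c its value at e and m minus its derivative
    on (e, T), one gets c (u - u0) - m * (u - u0) = k_e * f, where
    k_e = c g_alpha - m * g_alpha is nonnegative and tends to a unit mass at 0.
    As m >= 0 and its integral is at most c, the subgradient inequality
    h t - h s <= <u t - u s, F'(u t)> yields
    c h t - (m * h) t <= <(k_e * f) t, F'(u t)> for almost every t.  Convolving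
    with g_alpha turns the left-hand side into k_e * h, and e -> 0 gives the
    claim.

    The same inequality shows that F (u t) - F u0 is integrable either for
    almost all t or for almost none; in the second case its integral is -oo and
    both estimates are trivial. *)
Require Import Defs.
From HB Require Import structures.
From mathcomp Require Import all_boot all_order all_algebra finmap ring lra.
From mathcomp Require Import all_classical all_reals all_analysis.
From mathcomp Require Import ess_sup_inf measurable_realfun.
Set Implicit Arguments.
Unset Strict Implicit.
Unset Printing Implicit Defensive.
Import Order.TTheory GRing.Theory Num.Theory.
Import numFieldNormedType.Exports.
Local Open Scope classical_set_scope.
Local Open Scope ring_scope.

(** No density argument is at hand: u has no time regularity in V, its fractional derivative lies in
    V' only, and no growth bound on E makes the energy continuous. In the Marchaud form h enters
    only through differences h t - h s, which the subgradient inequality controls without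
    differentiating anything.

    In k_e * f the vector F'(u t) is frozen at time t while f is averaged over s. The limit e -> 0
    thus concerns a kernel K(s, t) averaged in s and compared with its diagonal. It holds in L^1, by
    continuity of translations of f, and needs k_e to have mass at most 1: its primitive is g_alpha
    convolved with a kernel below g_(1 - alpha), and g_(1 - alpha) * g_alpha = 1.

    Functions on (0, T) are extended by zero, so that identities between convolutions follow from
    Fubini on the line, and causality brings them back to (0, T).

    Two measure-theoretic obstacles remain. Null sets depend on the vector tested with, and V may be
    non-separable, so F'(u t) is reached through the countably many values of simple functions. The
    measurability of h is itself drawn from the subgradient inequality, which exhibits h as a
    countable infimum of measurable functions. *)

Section almost_everywhere.
Context d (T : measurableType d) (R : realType).
Variable m : {measure set T -> \bar R}.
Implicit Types P Q S U : T -> Prop.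

Lemma aeS P Q : (forall t, P t -> Q t) ->
  {ae m, forall t, P t} -> {ae m, forall t, Q t}.
Proof. by move=> PQ; apply: filterS => t; exact: PQ. Qed.

Lemma aeS2 P Q S : (forall t, P t -> Q t -> S t) ->
  {ae m, forall t, P t} -> {ae m, forall t, Q t} -> {ae m, forall t, S t}.
Proof. by move=> PQS; apply: filterS2 => t; exact: PQS. Qed.

Lemma aeS3 P Q S U : (forall t, P t -> Q t -> S t -> U t) ->
  {ae m, forall t, P t} -> {ae m, forall t, Q t} -> {ae m, forall t, S t} ->
  {ae m, forall t, U t}.
Proof. by move=> PQS; apply: filterS3 => t; exact: PQS. Qed.

End almost_everywhere.

(** * Lebesgue measure under reflections and dilations *)

Section change_of_variables.
Context {R : realType}.
Local Notation mu := (@lebesgue_measure R).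
Local Open Scope ereal_scope.

(** By uniqueness of Lebesgue measure it suffices to compare on half-open intervals; a reflection
    moves the closed end to the other side and keeps the length. *)
Lemma lebesgue_measure_refl (t : R) (A : set R) : measurable A ->
  pushforward mu (fun s : measurableTypeR R => (t - s)%R : measurableTypeR R) A = mu A.
Proof.
move=> mA.
have mf : measurable_fun setT (fun s : measurableTypeR R => (t - s)%R : measurableTypeR R).
  by apply: measurable_funB.
pose fm := isMeasurableFun.Build _ _ _ _ _ mf.
pose fp : {mfun _ >-> _} := HB.pack (fun s : measurableTypeR R => (t - s)%R : measurableTypeR R) fm.
apply/esym/(@lebesgue_measure_unique R (pushforward mu fp)) => //= _ [[a b]] _ <-.
rewrite /pushforward/=.
rewrite (_ : _ @^-1` _ = `[t - b, t - a[%classic)%R; last first.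
  apply/seteqP; split => x /=; rewrite !in_itv/= => /andP[? ?]; apply/andP; split; lra.
rewrite !lebesgue_measure_itv/=.
rewrite !lte_fin (_ : (t - b < t - a)%R = (a < b)%R); last by lra.
by case: ifP => // _; rewrite -!EFinB; congr EFin; ring.
Qed.

(** Positive and negative parts are transported separately, so the equality extends to integrals
    that are infinite or undefined. *)
Lemma integral_refl (t : R) (f : R -> \bar R) :
  measurable_fun [set: R] f -> \int[mu]_s f (t - s)%R = \int[mu]_s f s.
Proof.
move=> mf.
have mr : measurable_fun setT (fun s : measurableTypeR R => (t - s)%R : measurableTypeR R).
  by apply: measurable_funB.
have H (k : R -> \bar R) : measurable_fun [set: R] k -> (forall x, 0 <= k x) ->
    \int[mu]_s k (t - s)%R = \int[mu]_s k s.
  move=> mk k0.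
  have := @ge0_integral_pushforward _ _ _ _ R _ mr mu setT k measurableT mk (fun y _ => k0 y).
  rewrite preimage_setT => <-.
  by apply: eq_measure_integral => //= A mA _; exact: lebesgue_measure_refl.
rewrite integralE [RHS]integralE; congr (_ - _).
  rewrite -(H (fun x => f^\+ x) (measurable_funepos mf) (funepos_ge0 f)).
  by apply: eq_integral => x _; rewrite !funeposE.
rewrite -(H (fun x => f^\- x) (measurable_funeneg mf) (funeneg_ge0 f)).
by apply: eq_integral => x _; rewrite !funenegE.
Qed.

Lemma lebesgue_measure_scale (a : R) (A : set R) : (0 < a)%R -> measurable A ->
  pushforward mu (fun s : measurableTypeR R => (a * s)%R : measurableTypeR R) A =
  (a^-1)%:E * mu A.
Proof.
move=> a0 mA.
have mf : measurable_fun setT (fun s : measurableTypeR R => (a * s)%R : measurableTypeR R).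
  by apply: measurable_funM.
pose fm := isMeasurableFun.Build _ _ _ _ _ mf.
pose fp : {mfun _ >-> _} := HB.pack (fun s : measurableTypeR R => (a * s)%R : measurableTypeR R) fm.
have a0' : (0 <= a)%R by exact: ltW.
pose nu : {measure set (measurableTypeR R) -> \bar R} := mscale (NngNum a0') (pushforward mu fp).
suff nuE : mu A = nu mf A.
  by rewrite nuE /nu/= /mscale/= muleA -EFinM mulVf ?gt_eqF// mul1e.
apply: (@lebesgue_measure_unique R (nu mf)) => //= _ [[x y]] _ <-.
rewrite /nu/=.
rewrite /mscale/= /pushforward/=.
rewrite (_ : _ @^-1` _ = `](x / a), (y / a)]%classic)%R; last first.
  apply/seteqP; split => z /=; rewrite !in_itv/=.
    by move=> /andP[? ?]; apply/andP; split; rewrite ?ltr_pdivrMr ?ler_pdivlMr// mulrC.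
  by move=> /andP[]; rewrite ltr_pdivrMr// ler_pdivlMr// mulrC => -> ; rewrite mulrC.
rewrite !lebesgue_measure_itv/=.
rewrite !lte_fin ltr_pM2r ?invr_gt0//.
case: ifP => [_|]; last by rewrite mule0.
rewrite -!EFinB -EFinM; congr EFin; field.
by rewrite gt_eqF.
Qed.

Lemma ge0_integral_scale (a : R) (f : R -> \bar R) : (0 < a)%R ->
  measurable_fun [set: R] f -> (forall x, 0 <= f x) ->
  \int[mu]_s f (a * s)%R = (a^-1)%:E * \int[mu]_s f s.
Proof.
move=> a0 mf f0.
have mr : measurable_fun setT (fun s : measurableTypeR R => (a * s)%R : measurableTypeR R).
  by apply: measurable_funM.
have := @ge0_integral_pushforward _ _ _ _ R _ mr mu setT f measurableT mf (fun y _ => f0 y).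
rewrite preimage_setT => <-.
have a0' : (0 <= a^-1)%R by rewrite invr_ge0 ltW.
rewrite -(@ge0_integral_mscale _ _ _ mu setT measurableT (NngNum a0') f)//.
apply: eq_measure_integral => //= A mA _.
by rewrite lebesgue_measure_scale// /mscale/=.
Qed.

End change_of_variables.

(** * Convolutions on the real line *)

Section parametric_integral.
Context d1 d2 (T1 : measurableType d1) (T2 : measurableType d2) (R : realType).
Variable m2 : {sigma_finite_measure set T2 -> \bar R}.

Lemma measurable_param_integral (K : T1 * T2 -> R) : measurable_fun setT K ->
  measurable_fun setT (fun t => \int[m2]_s (K (t, s))%:E)%E.
Proof.
move=> mK.
have mK' : measurable_fun setT (EFin \o K) by exact/measurable_EFinP.
rewrite (_ : (fun t => _) = (fun t => (\int[m2]_s ((EFin \o K)^\+ (t, s)) -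
    \int[m2]_s ((EFin \o K)^\- (t, s))))%E); last first.
  apply/funext => t; rewrite integralE; congr (_ - _)%E.
    by apply: eq_integral => x _; rewrite !funeposE.
  by apply: eq_integral => x _; rewrite !funenegE.
apply: emeasurable_funB.
  apply: (measurable_fun_fubini_tonelli_F (m2 := m2) (EFin \o K)^\+%E) => //.
  exact: measurable_funepos.
apply: (measurable_fun_fubini_tonelli_F (m2 := m2) (EFin \o K)^\-%E) => //.
exact: measurable_funeneg.
Qed.

Lemma measurable_param_Rintegral (K : T1 * T2 -> R) : measurable_fun setT K ->
  measurable_fun setT (fun t => \int[m2]_s K (t, s)).
Proof.
move=> mK; apply: measurableT_comp => //.
exact: measurable_param_integral.
Qed.

End parametric_integral.

(** Integrability is assumed of the product only, which is what Fubini provides for almost every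
    section; for k = 0 both sides vanish whatever f is. *)
Lemma integral_mulr_Rintegral d (T : measurableType d) (R : realType)
    (m : {measure set T -> \bar R}) (k : R) (f : T -> R) :
  m.-integrable setT (fun s => (k * f s)%:E) ->
  (\int[m]_s (k * f s)%:E = (k * \int[m]_s f s)%:E)%E.
Proof.
have [->|k0] := eqVneq k 0.
  move=> _; rewrite mul0r; under eq_integral do rewrite mul0r.
  by rewrite integral0.
move=> ik.
have if_ : m.-integrable setT (EFin \o f).
  have := integrableZl measurableT k^-1 ik.
  by apply: eq_integrable => // x _ /=; rewrite -EFinM mulKf.
under eq_integral do rewrite EFinM.
by rewrite integralZl// EFinM /Rintegral fineK//; exact: integrable_fin_num.
Qed.

Section convolution.
Context {R : realType}.
Local Notation mu := (@lebesgue_measure R).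
Local Notation L1 a := (mu.-integrable setT (EFin \o a)).
Local Notation mT a := (measurable_fun [set: R] a).
Implicit Types a b c : R -> R.

(** The real-valued integral is [fine] of the extended one, so [cv a b t] is meaningful where the
    convolution converges absolutely; [acv a b t < +oo] is the test for that. *)
Definition cv a b (t : R) : R := \int[mu]_s (a (t - s) * b s).
Definition acv a b (t : R) : \bar R := (\int[mu]_s (`|a (t - s) * b s|)%:E)%E.

Lemma integral_shift (t : R) (f : R -> \bar R) : mT f ->
  (\int[mu]_s f (s - t)%R = \int[mu]_s f s)%E.
Proof.
move=> mf.
have mf' : mT (fun x : R => f (- x)%R).
  by apply: (measurableT_comp mf); exact: measurable_funN.
transitivity (\int[mu]_s f (0 - s)%R)%E; last exact: integral_refl.
under [RHS]eq_integral do rewrite sub0r.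
rewrite -(integral_refl t mf').
by apply: eq_integral => x _; rewrite opprB.
Qed.

Lemma measurable_cvker a b : mT a -> mT b -> measurable_fun setT
  (fun p : measurableTypeR R * measurableTypeR R => a (p.1 - p.2) * b p.2).
Proof.
move=> ma mb; apply: measurable_funM; last exact: measurableT_comp.
by apply: (measurableT_comp ma); exact: measurable_funB.
Qed.

Lemma measurable_refl a (t : R) : mT a -> mT (fun s => a (t - s)).
Proof. by move=> ma; apply: (measurableT_comp ma); exact: measurable_funB. Qed.

Lemma measurable_cv a b : mT a -> mT b -> mT (cv a b).
Proof.
move=> ma mb.
exact: (measurable_param_Rintegral mu (measurable_cvker ma mb)).
Qed.

Lemma measurable_acv a b : mT a -> mT b -> mT (acv a b).
Proof.
move=> ma mb; have mK : measurable_fun setT (fun p : measurableTypeR R * measurableTypeR R =>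
    `|a (p.1 - p.2) * b p.2|) by apply: measurableT_comp => //; exact: measurable_cvker.
exact: (measurable_param_integral mu mK).
Qed.

Lemma acvC a b t : mT a -> mT b -> acv a b t = acv b a t.
Proof.
move=> ma mb; rewrite /acv -[RHS](integral_refl t).
  by apply: eq_integral => s _; rewrite subKr mulrC.
by apply/measurable_EFinP/measurableT_comp => //; apply: measurable_funM => //; exact: measurable_refl.
Qed.

Lemma cvC a b t : mT a -> mT b -> cv a b t = cv b a t.
Proof.
move=> ma mb; rewrite /cv /Rintegral -[in RHS](integral_refl t).
  by congr fine; apply: eq_integral => s _; rewrite subKr mulrC.
by apply/measurable_EFinP; apply: measurable_funM => //; exact: measurable_refl.
Qed.

Lemma integrable_cvker a b t : mT a -> mT b -> (acv a b t < +oo)%E ->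
  mu.-integrable setT (fun s => (a (t - s) * b s)%:E).
Proof.
move=> ma mb h; apply/integrableP; split => //.
by apply/measurable_EFinP; apply: measurable_funM => //; exact: measurable_refl.
Qed.

Lemma abs_cv_le a b t : mT a -> mT b -> (`|cv a b t|%:E <= acv a b t)%E.
Proof.
move=> ma mb.
have [h|] := ltP (acv a b t) +oo%E; last by rewrite leye_eq => /eqP ->; rewrite leey.
rewrite /cv EFin_normr_Rintegral//; last exact: integrable_cvker.
apply: le_abse_integral => //.
by apply/measurable_EFinP; apply: measurable_funM => //; exact: measurable_refl.
Qed.

Lemma integral_acv a b : mT a -> mT b ->
  (\int[mu]_t acv a b t = \int[mu]_t `|a t|%:E * \int[mu]_t `|b t|%:E)%E.
Proof.
move=> ma mb; rewrite /acv.
have mK := measurable_cvker ma mb.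
rewrite (fubini_tonelli (fun p : measurableTypeR R * measurableTypeR R => `|a (p.1 - p.2) * b p.2|%:E))//=; last first.
  by apply/measurable_EFinP; exact: measurableT_comp.
rewrite -ge0_integralZl//; last 2 first.
- by apply/measurable_EFinP; exact: measurableT_comp.
- by apply: integral_ge0 => *; rewrite lee_fin.
apply: eq_integral => s _.
under eq_integral do rewrite normrM EFinM.
rewrite ge0_integralZr//; last first.
  apply/measurable_EFinP; apply: measurableT_comp => //.
  by apply: (measurableT_comp ma); exact: measurable_funB.
congr (_ * _)%E.
rewrite (integral_shift s (f := fun t => `|a t|%:E))//.
by apply/measurable_EFinP; exact: measurableT_comp.
Qed.

Lemma L1_mT a : L1 a -> mT a.
Proof. by case/integrableP => /measurable_EFinP. Qed.

Lemma L1_abs a : L1 a -> (\int[mu]_t `|a t|%:E < +oo)%E.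
Proof. by case/integrableP. Qed.

Lemma acv_L1 a b : L1 a -> L1 b -> (\int[mu]_t acv a b t < +oo)%E.
Proof.
move=> ia ib; rewrite integral_acv; [|exact: L1_mT|exact: L1_mT].
by rewrite lte_mul_pinfty ?L1_abs// ?integral_ge0// ge0_fin_numE ?integral_ge0// L1_abs.
Qed.

Lemma L1_cv a b : L1 a -> L1 b -> L1 (cv a b).
Proof.
move=> ia ib; have ma := L1_mT ia; have mb := L1_mT ib.
apply/integrableP; split; first by apply/measurable_EFinP; exact: measurable_cv.
apply: le_lt_trans (acv_L1 ia ib); apply: ge0_le_integral => //=.
- by apply/measurable_EFinP; apply: measurableT_comp => //; exact: measurable_cv.
- exact: measurable_acv.
- by move=> x _; exact: abs_cv_le.
Qed.

Lemma ae_lty (f : R -> \bar R) : mT f -> (forall x, 0 <= f x)%E ->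
  (\int[mu]_t f t < +oo)%E -> {ae mu, forall t, (f t < +oo)%E}.
Proof.
move=> mf f0 fi.
have : mu.-integrable setT f.
  by apply/integrableP; split => //; under eq_integral do rewrite gee0_abs//.
move/(integrable_ae measurableT); apply: filterS => t /(_ I).
by rewrite fin_numE => /andP[_]; rewrite ltey.
Qed.

Lemma acv_ge0 a b t : (0 <= acv a b t)%E.
Proof. by apply: integral_ge0 => *; rewrite lee_fin. Qed.

Lemma ae_acv a b : L1 a -> L1 b -> {ae mu, forall t, (acv a b t < +oo)%E}.
Proof.
move=> ia ib; apply: ae_lty.
- by apply: measurable_acv; exact: L1_mT.
- exact: acv_ge0.
- exact: acv_L1.
Qed.

(** The absolute integral of the triple convolution: its finiteness at t is the Fubini condition
    under which associativity holds at that very t. *)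
Definition acv3 a b c (t : R) : \bar R :=
  (\int[mu]_s \int[mu]_r `|a (t - s) * (b (s - r) * c r)|%:E)%E.

Lemma acv3E a b c t : mT a -> mT b -> mT c ->
  acv3 a b c t = (\int[mu]_r (acv a b (t - r) * `|c r|%:E))%E.
Proof.
move=> ma mb mc; rewrite /acv3.
have mK : measurable_fun setT (fun p : measurableTypeR R * measurableTypeR R =>
    a (t - p.1) * (b (p.1 - p.2) * c p.2)).
  apply: measurable_funM; last exact: measurable_cvker.
  by apply: (measurableT_comp ma); exact: measurable_funB.
rewrite (fubini_tonelli (fun p : measurableTypeR R * measurableTypeR R =>
    `|a (t - p.1) * (b (p.1 - p.2) * c p.2)|%:E))//=; last first.
  by apply/measurable_EFinP; exact: measurableT_comp.
apply: eq_integral => r _.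
under eq_integral do rewrite mulrA normrM EFinM.
have mab : mT (fun s => a (t - s) * b (s - r)).
  apply: measurable_funM; first exact: measurable_refl.
  by apply: (measurableT_comp mb); exact: measurable_funB.
rewrite ge0_integralZr//; last by apply/measurable_EFinP; exact: measurableT_comp.
congr (_ * _)%E; rewrite /acv -(integral_shift r).
  by apply: eq_integral => s _; congr (`|a _ * _|%:E); ring.
apply/measurable_EFinP; apply: measurableT_comp => //; apply: measurable_funM => //.
exact: measurable_refl.
Qed.

Lemma cvA a b c t : mT a -> mT b -> mT c -> (acv3 a b c t < +oo)%E ->
  cv a (cv b c) t = cv (cv a b) c t.
Proof.
move=> ma mb mc h.
pose F (p : measurableTypeR R * measurableTypeR R) :=
  (a (t - p.1) * (b (p.1 - p.2) * c p.2))%:E.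
have mF : measurable_fun setT F.
  apply/measurable_EFinP/measurable_funM; last exact: measurable_cvker.
  by apply: (measurableT_comp ma); exact: measurable_funB.
have iF : (mu \x mu)%E.-integrable setT F by apply/integrable12ltyP.
have E1 : (\int[mu]_s (a (t - s) * cv b c s)%:E = \int[mu]_s \int[mu]_r F (s, r))%E.
  apply: ae_eq_integral => //.
  - apply/measurable_EFinP/measurable_funM; first exact: measurable_refl.
    exact: measurable_cv.
  - exact: (measurable_fubini_F iF).
  - have := ae_integrable1 iF; apply: filterS => s hs _ /=.
    by rewrite -(@integral_mulr_Rintegral _ _ _ mu (a (t - s)) (fun r => b (s - r) * c r) hs).
have E2 : (\int[mu]_r (cv a b (t - r) * c r)%:E = \int[mu]_r \int[mu]_s F (s, r))%E.
  apply: ae_eq_integral => //.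
  - apply/measurable_EFinP/measurable_funM => //.
    by apply: measurable_refl; exact: measurable_cv.
  - exact: (measurable_fubini_G iF).
  - have := ae_integrable2 iF; apply: filterS => r ir _ /=.
    have FE s : F (s, r) = (c r * (a (t - s) * b (s - r)))%:E.
      by rewrite /F/=; congr EFin; ring.
    under [RHS]eq_integral do rewrite FE.
    rewrite integral_mulr_Rintegral; last first.
      by apply: eq_integrable ir => // s _; rewrite /= FE.
    rewrite mulrC; congr (_ * _)%:E; rewrite /cv /Rintegral; congr fine.
    rewrite -(integral_shift r).
      by apply: eq_integral => s _; congr (a _ * _)%:E; ring.
    by apply/measurable_EFinP; apply: measurable_funM => //; exact: measurable_refl.
by rewrite /cv /Rintegral E1 E2 (Fubini iF).
Qed.

Lemma ae_acv3 a b c : L1 a -> L1 b -> L1 c ->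
  {ae mu, forall t, (acv3 a b c t < +oo)%E}.
Proof.
move=> ia ib ic; have ma := L1_mT ia; have mb := L1_mT ib; have mc := L1_mT ic.
pose ab t := fine (acv a b t).
have mab : mT ab by apply: measurableT_comp => //; exact: measurable_acv.
have iab : L1 ab.
  apply/integrableP; split; first exact/measurable_EFinP.
  apply: le_lt_trans (acv_L1 ia ib); apply: ge0_le_integral => //=.
  - by apply/measurable_EFinP; exact: measurableT_comp.
  - exact: measurable_acv.
  - move=> x _; rewrite ger0_norm ?fine_ge0 ?acv_ge0//.
    have [h|] := ltP (acv a b x) +oo%E; last by rewrite leye_eq => /eqP ->; rewrite leey.
    by rewrite fineK// ge0_fin_numE ?acv_ge0.
have [N [mN N0 Nh]] := ae_acv ia ib.
apply: (aeS _ (ae_acv iab ic)) => t.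
rewrite acv3E// => h; apply: le_lt_trans h.
rewrite le_eqVlt; apply/orP; left; apply/eqP.
apply: ae_eq_integral => //.
- apply: emeasurable_funM; last by apply/measurable_EFinP; exact: measurableT_comp.
  by apply: (measurableT_comp (measurable_acv ma mb)); exact: measurable_funB.
- by apply/measurable_EFinP; apply: measurableT_comp => //; apply: measurable_funM => //; exact: measurable_refl.
(* The null set where [acv a b] is infinite, seen in the variable s, is a reflection of N, hence
   again null. *)
- exists ((fun s : measurableTypeR R => (t - s : measurableTypeR R)) @^-1` N); split.
  + rewrite -[X in measurable X]setTI; apply: measurable_funB => //.
  + by rewrite -[LHS]/(pushforward mu (fun s : measurableTypeR R => (t - s)%R : measurableTypeR R) N) lebesgue_measure_refl.
  + move=> s /= hs; apply: Nh => /= hac; apply: hs => _.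
    rewrite normrM EFinM ger0_norm ?fine_ge0 ?acv_ge0// fineK//.
    by rewrite ge0_fin_numE ?acv_ge0.
Qed.

Lemma ae_cvA a b c : L1 a -> L1 b -> L1 c ->
  {ae mu, forall t, cv a (cv b c) t = cv (cv a b) c t}.
Proof.
move=> ia ib ic; apply: (aeS _ (ae_acv3 ia ib ic)) => t.
by apply: cvA; exact: L1_mT.
Qed.

End convolution.

(** * Null sets and integrals of arbitrary functions *)

Section null_sets.
Context d (T : measurableType d) (R : realType).
Variable m : {measure set T -> \bar R}.
Local Open Scope ereal_scope.
Import HBNNSimple.

(* The integral of an arbitrary function is a difference of suprema over the
   simple functions below it, so null sets are irrelevant even when the
   integrands are not measurable. *)
Lemma integral_null_eq (D N : set T) (f g : T -> \bar R) :
  measurable N -> m N = 0 -> (forall x, D x -> ~ N x -> f x = g x) ->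
  \int[m]_(x in D) f x = \int[m]_(x in D) g x.
Proof.
move=> mN N0 fg.
have le (a b : T -> \bar R) : (forall x, 0 <= a x) -> (forall x, 0 <= b x) ->
    (forall x, ~ N x -> a x <= b x) -> \int[m]_x a x <= \int[m]_x b x.
  move=> a0 b0 ab; rewrite !ge0_integralTE//.
  apply: ge_ereal_sup => _ [k /= kb <-].
  pose k' := proj_nnsfun k (measurableC mN).
  have -> : sintegral m k = sintegral m k'.
    rewrite -!integralT_nnsfun; apply: (@ge0_ae_eq_integral _ _ _ m setT (EFin \o k) (EFin \o k')) => //; [exact/measurable_EFinP|exact/measurable_EFinP|..].
    - by move=> x _; rewrite lee_fin.
    - by move=> x _; rewrite lee_fin.
    - exists N; split => // x /= xk; apply: contrapT => Nx; apply: xk => _.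
      by rewrite /= mindicE mem_set// mulr1.
  apply: ereal_sup_ubound; exists k' => // x.
  rewrite /= mindicE; have [Nx|Nx] := pselect (N x).
    by rewrite in_setC (mem_set Nx) mulr0 b0.
  by rewrite mem_set// mulr1 (le_trans (kb x))// ab.
have eq (a b : T -> \bar R) : (forall x, 0 <= a x) -> (forall x, 0 <= b x) ->
    (forall x, ~ N x -> a x = b x) -> \int[m]_x a x = \int[m]_x b x.
  move=> a0 b0 ab; apply/eqP; rewrite eq_le; apply/andP.
  by split; apply: le => // x Nx; rewrite ab.
rewrite integral_mkcond [RHS]integral_mkcond integralE [RHS]integralE.
have h x : ~ N x -> (f \_ D) x = (g \_ D) x.
  by move=> Nx; rewrite !patchE; case: ifPn => // /set_mem Dx; exact: fg.
congr (_ - _); apply: eq => [x|x|x Nx]; rewrite ?funepos_ge0 ?funeneg_ge0//.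
  by rewrite !funeposE h.
by rewrite !funenegE h.
Qed.

Lemma integral_ae_congr (D : set T) (f g : T -> \bar R) :
  {ae m, forall x, D x -> f x = g x} ->
  \int[m]_(x in D) f x = \int[m]_(x in D) g x.
Proof.
move=> [N [mN N0 Nfg]]; apply: (integral_null_eq mN N0) => x Dx Nx.
by apply: contrapT => fgx; apply: Nx; apply: Nfg => /(_ Dx).
Qed.

End null_sets.

(** * Causal functions *)

Section convolution_causal.
Context {R : realType}.
Local Notation mu := (@lebesgue_measure R).
Local Notation L1 a := (mu.-integrable setT (EFin \o a)).
Local Notation mT a := (measurable_fun [set: R] a).
Implicit Types a b c : R -> R.

(** For two causal factors [cv] is the convolution over (0, t), and its value at t depends on their
    restrictions to (0, t) only. *)
Definition causal a := forall x, x <= 0 -> a x = 0.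

Lemma cv_local a b b' T t : causal a -> causal b -> causal b' ->
  {ae mu, forall s, 0 < s < T -> b s = b' s} -> t <= T ->
  cv a b t = cv a b' t.
Proof.
move=> a0 b0 b'0 bb' tT; congr fine; apply: integral_ae_congr.
apply: (aeS _ bb') => s h _; congr EFin.
have [s0|s0] := leP s 0; first by rewrite b0// b'0.
have [ts|ts] := leP t s; first by rewrite a0 ?mul0r// subr_le0.
by rewrite h// s0 (lt_le_trans ts).
Qed.

Lemma causal_cv a b : causal a -> causal b -> causal (cv a b).
Proof.
move=> a0 b0 t t0; rewrite /cv /Rintegral integral0_eq// => s _.
have [s0|s0] := leP s 0; first by rewrite b0// mulr0.
by rewrite a0 ?mul0r// subr_le0 ltW// (le_lt_trans t0).
Qed.

(** A bounded inner convolution makes associativity available at every t instead of almost every t.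
    This covers the pair g_alpha, g_(1 - alpha) and convolutions with [one]. *)
Lemma acv3_lty a b c t (M : R) : mT a -> mT b -> L1 c ->
  (forall x, acv a b x <= M%:E)%E -> (acv3 a b c t < +oo)%E.
Proof.
move=> ma mb ic abM; have mc := L1_mT ic.
have M0 : 0 <= M by rewrite -lee_fin (le_trans (acv_ge0 a b 0)).
rewrite acv3E//.
apply: (@le_lt_trans _ _ (\int[mu]_r (M%:E * `|c r|%:E))%E).
  apply: ge0_le_integral => //.
  - by move=> *; rewrite mule_ge0 ?acv_ge0.
  - apply: emeasurable_funM; last by apply/measurable_EFinP; exact: measurableT_comp.
    by apply: (measurableT_comp (measurable_acv ma mb)); exact: measurable_funB.
  - by apply: emeasurable_funM => //; apply/measurable_EFinP; exact: measurableT_comp.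
  - by move=> x _; rewrite lee_wpmul2r.
rewrite ge0_integralZl//; last by apply/measurable_EFinP; exact: measurableT_comp.
rewrite lte_mul_pinfty ?lee_fin//; exact: L1_abs.
Qed.

(** Lebesgue differentiation: a is almost everywhere the derivative of its primitive, which vanishes
    near every t in (0, T). *)
Lemma ae0_of_integral_itv a T : L1 a ->
  (forall t, 0 < t < T -> \int[mu]_(s in `]-oo, t]) a s = 0) ->
  {ae mu, forall t, 0 < t < T -> a t = 0}.
Proof.
move=> ia W0.
have iy y : mu.-integrable `]-oo, y] (EFin \o a) by exact: integrableS ia.
have la : locally_integrable [set: R] a.
  by apply: open_integrable_locally => //; exact: openT.
apply: (aeS _ (FTC1Ny iy la)) => t [_ <-] /andP[t0 tT].
rewrite derive1E (@near_eq_derive _ _ _ _ (cst 0) t 1) ?derive_cst//.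
near=> s; apply: W0; apply/andP; split.
  by near: s; exact: lt_nbhsr.
by near: s; exact: lt_nbhsl.
Unshelve. all: by end_near. Qed.

End convolution_causal.

(** * The kernels of fractional calculus *)

Section improper_FTC.
Context {R : realType}.
Local Notation mu := (@lebesgue_measure R).

(** The integrand may blow up at both end points, as the fractional kernels do: monotone convergence
    over compact subintervals reduces to the usual theorem. *)
Lemma ge0_FTC2_oo (f F : R -> R) (a b : R) : a < b ->
  (forall x, a < x < b -> 0 <= f x) ->
  (forall x, a < x < b -> {for x, continuous f}) ->
  (forall x, a < x < b -> is_derive x 1 F (f x)) ->
  F x @[x --> a^'+] --> F a -> F x @[x --> b^'-] --> F b ->
  (\int[mu]_(x in `]a, b[) (f x)%:E = (F b - F a)%:E)%E.
Proof.
move=> ab f0 fc dF Fa Fb.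
(* Denominators start at 3 so that e n < (b - a) / 2 and every subinterval is nondegenerate. *)
pose e n : R := (b - a) / (n.+3)%:R.
have ba : 0 < b - a by rewrite subr_gt0.
have e0 n : 0 < e n by rewrite /e divr_gt0.
have e3 n : e n < (b - a) / 2.
  by rewrite /e ltr_pM2l// ltf_pV2 ?posrE// ltr_nat.
have end_ n m : (n <= m)%N -> e m <= e n.
  by move=> nm; rewrite /e ler_pM2l// lef_pV2 ?posrE// ler_nat !ltnS.
have ecvg : e n @[n --> \oo] --> 0.
  rewrite -(mulr0 (b - a)); apply: cvgMr.
  have := @cvg_harmonic R; rewrite -(cvg_shiftn 2%N).
  by under eq_fun do rewrite /harmonic addn2.
pose A n : set R := `[a + e n, b - e n]%classic.
have AE : \bigcup_n A n = `]a, b[%classic.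
  apply/seteqP; split => x /=.
    move=> [n _]; rewrite /A/= !in_itv/= => /andP[h1 h2]; apply/andP; split.
      by rewrite (lt_le_trans _ h1)// ltrDl.
    by rewrite (le_lt_trans h2)// gtrBl.
  rewrite in_itv/= => /andP[ax xb].
  have m0 : 0 < Num.min (x - a) (b - x) by rewrite lt_min !subr_gt0 ax xb.
  have /cvgrPdist_lt/(_ _ m0)[n _ /(_ n (leqnn n))] := ecvg.
  rewrite sub0r normrN gtr0_norm// lt_min => /andP[h1 h2].
  exists n => //=; rewrite /A/= in_itv/=; apply/andP; split; lra.
have Aoo n x : A n x -> a < x < b.
  move=> Anx; have : (\bigcup_n A n) x by exists n.
  by rewrite AE /= in_itv.
have mf : measurable_fun (`]a, b[%classic : set R) f.
  apply: open_continuous_measurable_fun => // x; rewrite inE/= in_itv/=; exact: fc.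
have := @ge0_nondecreasing_set_cvg_integral _ (measurableTypeR R) R A (EFin \o f) mu _ _ _ _.
rewrite AE => H.
have {H}H1 : (\int[mu]_(x in A n) (f x)%:E)%E @[n --> \oo] -->
    (\int[mu]_(x in `]a, b[) (f x)%:E)%E.
  apply: H => //.
  - move=> n m nm; apply/subsetPset => x; rewrite /A/= !in_itv/= => /andP[h1 h2].
    have := end_ _ _ nm => h3; apply/andP; split; lra.
  - by move=> n; exact: measurable_itv.
  - move=> n; apply/measurable_EFinP; apply: measurable_funS mf => // x /Aoo.
    by rewrite /= in_itv.
  - by move=> n x /Aoo /f0; rewrite lee_fin.
have dFc x : a < x < b -> {for x, continuous F}.
  move=> /dF d; apply: differentiable_continuous; apply/derivable1_diffP.
  exact: ex_derive.
have FE n : (\int[mu]_(x in A n) (f x)%:E = (F (b - e n) - F (a + e n))%:E)%E.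
  have en3 := e3 n; have en0 := e0 n.
  have sub x : a + e n <= x <= b - e n -> a < x < b.
    by move=> /andP[h1 h2]; apply/andP; split; lra.
  rewrite (@continuous_FTC2 _ f F)//.
  - lra.
  - apply/continuous_in_subspaceT => x; rewrite inE /A/= in_itv/= => xA.
    by apply: fc; exact: sub.
  - split.
    + move=> x; rewrite in_itv/= => /andP[h1 h2]; apply: ex_derive.
      by apply: dF; apply: sub; rewrite !ltW.
    + apply: cvg_at_right_filter; apply: dFc; apply/andP; split; lra.
    + apply: cvg_at_left_filter; apply: dFc; apply/andP; split; lra.
  - move=> x; rewrite in_itv/= => /andP[h1 h2]; rewrite derive1E.
    by apply: derive_val; apply: dF; apply: sub; rewrite !ltW.
apply: (cvg_unique _ H1) => //=.
under eq_fun do rewrite FE.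
apply: cvg_EFin; first exact: nearW.
rewrite /=; apply: cvgB.
  apply: ((cvg_at_leftP F b (F b)).1 Fb (fun n => b - e n)); split.
    by move=> n; rewrite gtrBl.
  by rewrite -[X in _ --> X]subr0; apply: cvgB => //; exact: cvg_cst.
apply: ((cvg_at_rightP F a (F a)).1 Fa (fun n => a + e n)); split.
  by move=> n; rewrite ltrDl.
by rewrite -[X in _ --> X]addr0; apply: cvgD => //; exact: cvg_cst.
Qed.

Lemma integral_powR (b x : R) : 0 < b -> 0 < x ->
  (\int[mu]_(t in `]0%R, x[) (t `^ (b - 1))%:E = (x `^ b / b)%:E)%E.
Proof.
move=> b0 x0.
have <- : x `^ b / b - 0 `^ b / b = x `^ b / b.
  by rewrite powR0 ?gt_eqF// mul0r subr0.
apply: (@ge0_FTC2_oo (fun t => t `^ (b - 1)) (fun t => t `^ b / b)) => //.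
- by move=> t _; exact: powR_ge0.
- move=> t /andP[t0 _]; apply: differentiable_continuous; apply/derivable1_diffP.
  by apply: derivable_powR; rewrite in_itv/= t0.
- move=> t /andP[t0 _].
  have dt : is_derive t 1 (fun t => t `^ b) (b * t `^ (b - 1)).
    apply: DeriveDef; first by apply: derivable_powR; rewrite in_itv/= t0.
    by rewrite -derive1E powR_derive1// in_itv/= t0.
  have dc : is_derive t (1 : R) (cst b^-1 : R -> R) 0 by exact: is_derive_cst.
  have := @is_deriveM _ _ _ _ _ _ _ _ dt dc.
  rewrite scaler0 add0r /GRing.scale/= mulrA mulVf ?gt_eqF// mul1r.
  exact.
- rewrite powR0 ?gt_eqF//.
  by apply: cvgMl; exact: powR_cvg0.
- apply: cvg_at_left_filter; apply: cvgMl.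
  have : {for x, continuous (fun t : R => t `^ b)}.
    apply: differentiable_continuous; apply/derivable1_diffP.
    by apply: derivable_powR; rewrite in_itv/= x0.
  exact.
Qed.

End improper_FTC.

(** * The Gamma function and the beta integral *)

Section gamma_beta.
Context {R : realType}.
Local Notation mu := (@lebesgue_measure R).
Local Notation mT a := (measurable_fun [set: R] a).

(** The cut makes the power causal: [powR] does not vanish on negative arguments. *)
Definition ppow (b t : R) : R := if 0 < t then t `^ (b - 1) else 0.
Definition pexp (t : R) : R := if 0 < t then expR (- t) else 0.

Lemma measurable_pos_patch (f : R -> R) : mT f ->
  mT (fun t => if 0 < t then f t else 0).
Proof.
move=> mf; apply: measurable_fun_ifT => //.
exact: measurable_fun_ltr.
Qed.

Lemma measurable_ppow b : mT (ppow b).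
Proof. by apply: measurable_pos_patch; exact: measurable_powR. Qed.

Lemma measurable_pexp : mT pexp.
Proof.
apply: measurable_pos_patch.
by apply: measurableT_comp => //; exact: measurable_expR.
Qed.

Lemma ppow_ge0 b t : 0 <= ppow b t.
Proof. by rewrite /ppow; case: ifP => // _; exact: powR_ge0. Qed.

Lemma pexp_ge0 t : 0 <= pexp t.
Proof. by rewrite /pexp; case: ifP => // _; exact: expR_ge0. Qed.

Lemma integral_pexp : (\int[mu]_t (pexp t)%:E = 1%:E)%E.
Proof.
have <- : (\int[mu]_(t in `[0%R, +oo[) (expR (- t))%:E = 1%:E)%E.
  rewrite (@ge0_continuous_FTC2y _ (fun t => expR (- t)) (fun t => - expR (- t)) 0 0)//.
  - by rewrite oppr0 expR0 -EFinB sub0r opprK.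
  - apply: continuous_subspaceT => x; apply: continuous_comp.
      exact: opp_continuous.
    exact: continuous_expR.
  - rewrite -oppr0; apply: cvgN.
    exact: cvgr_expR.
  - apply: cvg_at_right_filter; apply: cvgN; apply: continuous_comp.
      exact: opp_continuous.
    exact: continuous_expR.
  - move=> x _; rewrite derive1E; apply: derive_val.
  have d3 : is_derive x 1 (fun t : R => expR (- t)) (expR (- x) * - 1).
    exact: is_derive1_comp.
  by apply: (is_derive_eq (is_deriveN d3)); rewrite mulrN1 opprK.
rewrite -integral_itv_obnd_cbnd; last first.
  apply/measurable_EFinP; apply: measurable_funTS.
  by apply: measurableT_comp => //; exact: measurable_expR.
rewrite [RHS]integral_mkcond; apply: eq_integral => t _.
rewrite patchE /pexp; case: ifPn => t0.
  by rewrite mem_set//= in_itv/= t0.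
by rewrite memNset//= in_itv/= andbT; exact/negP.
Qed.

Definition egamma (b : R) : \bar R := (\int[mu]_t (ppow b t * pexp t)%:E)%E.

Lemma euler_gammaE b : euler_gamma b = fine (egamma b).
Proof.
rewrite /euler_gamma /Rintegral; congr fine.
rewrite [LHS]integral_mkcond; apply: eq_integral => t _.
rewrite patchE /ppow /pexp; case: ifPn => [/set_mem|/negP t0].
  by rewrite /= in_itv/= andbT => ->.
rewrite ifN ?mul0r//; apply/negP => t1; apply: t0; apply/mem_set.
by rewrite /= in_itv/= t1.
Qed.

Lemma integral_ppow_itv b x : 0 < b -> 0 < x ->
  (\int[mu]_(t in `]0%R, x[) (ppow b t)%:E = (x `^ b / b)%:E)%E.
Proof.
move=> b0 x0; rewrite -integral_powR//; apply: eq_integral => t.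
by rewrite inE/= in_itv/= /ppow => /andP[-> _].
Qed.

(** The integrand is dominated by t^(b - 1) on (0, 1) and by exp(-t) beyond, the latter because b -
    1 < 0. *)
Lemma egamma_lty (b : R) : 0 < b < 1 -> (egamma b < +oo)%E.
Proof.
move=> /andP[b0 b1].
apply: (@le_lt_trans _ _ (\int[mu]_t ((ppow b t * \1_`]0%R, 1[ t)%:E + (pexp t)%:E))%E).
  apply: ge0_le_integral => //.
  - by move=> t _; rewrite lee_fin mulr_ge0 ?ppow_ge0 ?pexp_ge0.
  - by apply/measurable_EFinP/measurable_funM; [exact: measurable_ppow|exact: measurable_pexp].
  - apply: emeasurable_funD; apply/measurable_EFinP; last exact: measurable_pexp.
    by apply: measurable_funM; [exact: measurable_ppow|exact: measurable_indic].
  - move=> t _; rewrite -EFinD lee_fin /ppow /pexp.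
    case: ifPn => t0; last by rewrite !mul0r addr0.
    rewrite indicE; have [t1|t1] := ltP t 1.
      rewrite mem_set/= ?in_itv/= ?t0// mulr1.
      apply: (@le_trans _ _ (t `^ (b - 1))); last by rewrite lerDl expR_ge0.
      by rewrite ler_piMr ?powR_ge0// -expR0 ler_expR oppr_le0 ltW.
    rewrite memNset ?mulr0 ?add0r; last by rewrite /= in_itv/= t0/=; apply/negP; rewrite -leNgt.
    rewrite ler_piMl ?expR_ge0// -[X in _ <= X](powRr0 t); apply: ler_powR => //.
    by rewrite subr_le0 ltW.
rewrite ge0_integralD//; last 4 first.
- by move=> t _; rewrite lee_fin mulr_ge0 ?ppow_ge0.
- by apply/measurable_EFinP/measurable_funM; [exact: measurable_ppow|exact: measurable_indic].
- by move=> t _; rewrite lee_fin pexp_ge0.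
- by apply/measurable_EFinP; exact: measurable_pexp.
rewrite integral_pexp lte_add_pinfty ?ltry//.
under eq_integral do rewrite EFinM.
rewrite (_ : (\int[mu]_t _ = \int[mu]_(t in `]0%R, 1%R[) (ppow b t)%:E)%E).
  by rewrite integral_ppow_itv// ltry.
rewrite [RHS]integral_mkcond; apply: eq_integral => t _.
by rewrite patchE indicE; case: (t \in _); rewrite ?mule1 ?mule0.
Qed.

Lemma egamma_gt0 (b : R) : 0 < b < 1 -> (0 < egamma b)%E.
Proof.
move=> /andP[b0 b1].
(* The contribution of (0, 1), where exp(-t) >= exp(-1). *)
apply: (@lt_le_trans _ _ (expR (- 1) * (1 / b))%:E).
  by rewrite lte_fin mulr_gt0 ?expR_gt0// divr_gt0.
rewrite EFinM (_ : 1 / b = 1 `^ b / b); last by rewrite powR1.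
rewrite -integral_ppow_itv// -ge0_integralZl//.
- rewrite integral_mkcond; apply: ge0_le_integral => //.
  + by move=> t _; rewrite patchE; case: ifPn => // _; rewrite mule_ge0 ?lee_fin ?expR_ge0 ?ppow_ge0.
  + apply/(measurable_restrictT _ _).1 => //; apply: measurable_funTS.
    by apply: emeasurable_funM => //; apply/measurable_EFinP; exact: measurable_ppow.
  + by apply/measurable_EFinP/measurable_funM; [exact: measurable_ppow|exact: measurable_pexp].
  + move=> t _; rewrite patchE; case: ifPn => [|_].
      rewrite inE/= in_itv/= -EFinM lee_fin /ppow /pexp => /andP[-> t1].
      by rewrite mulrC ler_wpM2l ?powR_ge0// ler_expR lerN2 ltW.
    by rewrite lee_fin mulr_ge0 ?ppow_ge0 ?pexp_ge0.
- by apply: measurable_funTS; apply/measurable_EFinP; exact: measurable_ppow.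
- by move=> t _; rewrite lee_fin ppow_ge0.
Qed.

Lemma egamma_fin (b : R) : 0 < b < 1 -> egamma b \is a fin_num.
Proof.
by move=> b01; rewrite ge0_fin_numE ?egamma_lty// ltW// egamma_gt0.
Qed.

Lemma euler_gamma_gt0 (b : R) : 0 < b < 1 -> 0 < @euler_gamma R b.
Proof.
by move=> b01; rewrite euler_gammaE fine_gt0// egamma_gt0//= egamma_lty.
Qed.

Lemma ppowM b t x : 0 < t -> ppow b (t * x) = t `^ (b - 1) * ppow b x.
Proof.
move=> t0; rewrite /ppow pmulr_rgt0//; case: ifPn => x0; last by rewrite mulr0.
by rewrite powRM// ltW.
Qed.

(** The exponents a - 1 and - a add up to - 1, which the Jacobian t of the dilation s -> t s
    cancels. *)
Lemma acv_ppow_scale a t : 0 < t ->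
  acv (ppow a) (ppow (1 - a)) t = acv (ppow a) (ppow (1 - a)) 1.
Proof.
move=> t0; have tn0 : t != 0 by rewrite gt_eqF.
have mI (x : R) : mT (fun s => (`|ppow a (x - s) * ppow (1 - a) s|)%:E).
  apply/measurable_EFinP; apply: measurableT_comp => //; apply: measurable_funM.
    by apply: measurable_refl; exact: measurable_ppow.
  exact: measurable_ppow.
have H : (\int[mu]_s (`|ppow a (t - t * s) * ppow (1 - a) (t * s)|)%:E =
   t^-1%:E * acv (ppow a) (ppow (1 - a)) t)%E.
  by apply: (ge0_integral_scale t0 (mI t)) => x; rewrite lee_fin.
have HE : (\int[mu]_s (`|ppow a (t - t * s) * ppow (1 - a) (t * s)|)%:E =
    t^-1%:E * acv (ppow a) (ppow (1 - a)) 1)%E.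
  rewrite /acv -ge0_integralZl//; [|exact: mI|by rewrite lee_fin invr_ge0 ltW].
  apply: eq_integral => s _; rewrite -EFinM; congr EFin.
  rewrite -[X in X - _]mulr1 -mulrBr !ppowM// mulrACA -powRD; last first.
    by rewrite tn0 implybT.
  rewrite (_ : a - 1 + (1 - a - 1) = -1); last by ring.
  by rewrite powR_inv1 ?ltW// normrM gtr0_norm// invr_gt0.
have tK (X : \bar R) : (t%:E * (t^-1%:E * X) = X)%E.
  by rewrite muleA -EFinM divff// mul1e.
by rewrite -[LHS]tK -H HE tK.
Qed.

(** As exp(-(s - x)) exp(-x) = exp(-s), the convolution of the two Gamma integrands is exp(-s) times
    the constant I of [acv_ppow_scale]. Integrating over s > 0 gives I on one side and the product
    of the two Gamma values on the other. *)
Lemma acv_ppow a t : 0 < t ->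
  acv (ppow a) (ppow (1 - a)) t = (egamma a * egamma (1 - a))%E.
Proof.
move=> t0; rewrite acv_ppow_scale//.
set I := acv _ _ 1.
pose ka s := ppow a s * pexp s; pose kb s := ppow (1 - a) s * pexp s.
have mka b : mT (fun s => ppow b s * pexp s).
  by apply: measurable_funM; [exact: measurable_ppow|exact: measurable_pexp].
have := integral_acv (mka a) (mka (1 - a)).
have kE b : (\int[mu]_s `|ppow b s * pexp s|%:E)%E = egamma b.
  apply: eq_integral => s _.
  by rewrite ger0_norm// mulr_ge0 ?ppow_ge0 ?pexp_ge0.
rewrite !kE => <-.
transitivity (\int[mu]_s ((pexp s)%:E * I))%E.
  rewrite ge0_integralZr//.
  - by rewrite integral_pexp mul1e.
  - by apply/measurable_EFinP; exact: measurable_pexp.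
  - by move=> s _; rewrite lee_fin pexp_ge0.
  - exact: acv_ge0.
apply: eq_integral => s _.
have [s0|s0] := leP s 0.
  rewrite {1}/pexp ltNge s0/= mul0e /acv integral0_eq// => x _.
  have [x0|x0] := leP x 0.
    by rewrite {2}/pexp ltNge x0/= !mulr0 normr0.
  by rewrite {1}/pexp subr_gt0 ltNge (le_trans s0 (ltW x0))/= mulr0 mul0r normr0.
rewrite /I -(acv_ppow_scale a s0) /acv -ge0_integralZl//.
- apply: eq_integral => x _; rewrite -EFinM; congr EFin.
  have [x0|x0] := leP x 0.
    by rewrite /ppow [in X in _ * X]ltNge [0 < x]ltNge x0/= !mulr0 mul0r !mulr0 normr0 ?mulr0.
  have [sx|sx] := leP s x.
    by rewrite /ppow !subr_gt0 [x < s]ltNge sx/= !mul0r normr0 mulr0.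
  rewrite mulrACA [RHS]normrM mulrC; congr (_ * _).
  rewrite /pexp s0 subr_gt0 sx x0 -expRD ger0_norm ?expR_ge0//.
  by congr expR; ring.
- apply/measurable_EFinP; apply: measurableT_comp => //; apply: measurable_funM.
    by apply: measurable_refl; exact: measurable_ppow.
  exact: measurable_ppow.
- by rewrite lee_fin pexp_ge0.
Qed.

End gamma_beta.

(** * Linear combinations, cut-offs and primitives *)

Section convolution_linear.
Context {R : realType}.
Local Notation mu := (@lebesgue_measure R).
Local Notation L1 a := (mu.-integrable setT (EFin \o a)).
Local Notation mT a := (measurable_fun [set: R] a).
Implicit Types a b c : R -> R.

Lemma acv_le a a' b b' t : mT a -> mT b -> mT a' -> mT b' ->
  (forall s, `|a s| <= `|a' s|) -> (forall s, `|b s| <= `|b' s|) ->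
  (acv a b t <= acv a' b' t)%E.
Proof.
move=> ma mb ma' mb' aa' bb'; apply: ge0_le_integral => //.
- apply/measurable_EFinP; apply: measurableT_comp => //; apply: measurable_funM => //.
  exact: measurable_refl.
- apply/measurable_EFinP; apply: measurableT_comp => //; apply: measurable_funM => //.
  exact: measurable_refl.
- by move=> s _; rewrite lee_fin !normrM ler_pM.
Qed.

Lemma acv_lty_bounded a b t (M : R) : mT a -> L1 b ->
  (forall x, `|a x| <= M) -> (acv a b t <= M%:E * \int[mu]_s `|b s|%:E)%E.
Proof.
move=> ma ib aM; have mb := L1_mT ib.
have M0 : 0 <= M by exact: le_trans (aM 0).
rewrite -ge0_integralZl//; last by apply/measurable_EFinP; exact: measurableT_comp.
apply: ge0_le_integral => //.
- apply/measurable_EFinP; apply: measurableT_comp => //; apply: measurable_funM => //.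
  exact: measurable_refl.
- by apply/measurable_EFinP; apply: measurable_funM => //; exact: measurableT_comp.
- by move=> s _; rewrite -EFinM lee_fin normrM ler_wpM2r.
Qed.

Lemma acv_bounded_lty a b t (M : R) : mT a -> L1 b ->
  (forall x, `|a x| <= M) -> (acv a b t < +oo)%E.
Proof.
move=> ma ib aM; apply: le_lt_trans (acv_lty_bounded t ma ib aM) _.
rewrite lte_mul_pinfty ?lee_fin ?L1_abs//.
exact: le_trans (aM 0).
Qed.

(** The shape k * b - b' is that of a Marchaud difference; with k = 1 or k = 0 it also yields
    differences and negation. *)
Lemma cvBZr a b b' t (k : R) : mT a -> mT b -> mT b' ->
  (acv a b t < +oo)%E -> (acv a b' t < +oo)%E ->
  cv a (fun s => k * b s - b' s) t = k * cv a b t - cv a b' t.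
Proof.
move=> ma mb mb' h h'; rewrite /cv.
have i1 := integrable_cvker ma mb h.
have i2 := integrable_cvker ma mb' h'.
rewrite -RintegralZl// -RintegralB//; last first.
  by have := integrableZl measurableT k i1; apply: eq_integrable.
by apply: eq_Rintegral => s _; ring.
Qed.

Lemma eq_cv_lt a a' b b' T t : causal a -> causal a' -> causal b -> causal b' ->
  (forall s, 0 < s < T -> a s = a' s) -> (forall s, 0 < s < T -> b s = b' s) ->
  t <= T -> cv a b t = cv a' b' t.
Proof.
move=> a0 a'0 b0 b'0 aa' bb' tT; apply: eq_Rintegral => s _.
have [s0|s0] := leP s 0; first by rewrite b0// b'0// !mulr0.
have [ts|ts] := leP t s; first by rewrite a0 ?a'0 ?mul0r// subr_le0.
rewrite aa' ?bb'//; apply/andP; split; lra.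
Qed.

Lemma eq_acv_lt a a' b b' T t : causal a -> causal a' -> causal b -> causal b' ->
  (forall s, 0 < s < T -> a s = a' s) -> (forall s, 0 < s < T -> b s = b' s) ->
  t <= T -> acv a b t = acv a' b' t.
Proof.
move=> a0 a'0 b0 b'0 aa' bb' tT; apply: eq_integral => s _.
have [s0|s0] := leP s 0; first by rewrite b0// b'0// !mulr0.
have [ts|ts] := leP t s; first by rewrite a0 ?a'0 ?mul0r// subr_le0.
rewrite aa' ?bb'//; apply/andP; split; lra.
Qed.

Lemma acv_cv a b t : (forall s, 0 <= a s) -> (forall s, 0 <= b s) ->
  cv a b t = fine (acv a b t).
Proof.
move=> a0 b0; congr fine; apply: eq_integral => s _.
by rewrite ger0_norm// mulr_ge0.
Qed.

Definition tcut (T : R) a (t : R) : R := if 0 < t < T then a t else 0.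

Lemma causal_cut T a : causal (tcut T a).
Proof. by move=> t t0; rewrite /tcut ltNge t0. Qed.

Lemma cutE T a t : 0 < t < T -> tcut T a t = a t.
Proof. by rewrite /tcut => ->. Qed.

Lemma measurable_cut (T : R) a : measurable_fun (`]0, T[%classic : set R) a -> mT (tcut T a).
Proof.
move=> ma; have -> : tcut T a = a \_ `]0, T[.
  apply/funext => t; rewrite /tcut patchE; case: ifPn => h.
    by rewrite mem_set//= in_itv.
  by rewrite memNset//= in_itv/=; exact/negP.
exact/(measurable_restrictT _ _).1.
Qed.

Lemma cut_restrict (T : R) a : tcut T a = a \_ `]0, T[.
Proof.
apply/funext => t; rewrite /tcut patchE; case: ifPn => h.
  by rewrite mem_set//= in_itv.
by rewrite memNset//= in_itv/=; exact/negP.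
Qed.

Lemma L1_cut (T : R) a : mu.-integrable `]0, T[ (EFin \o a) -> L1 (tcut T a).
Proof.
move=> ia; rewrite cut_restrict -restrict_EFin; apply/integrable_restrict => //.
by rewrite setTI.
Qed.

Lemma Rintegral_cut (T : R) a : \int[mu]_s tcut T a s = \int[mu]_(s in `]0, T[) a s.
Proof. by rewrite [RHS]Rintegral_mkcond cut_restrict. Qed.

Lemma integral_cut (T : R) a :
  (\int[mu]_s (tcut T a s)%:E = \int[mu]_(s in `]0%R, T[) (a s)%:E)%E.
Proof.
rewrite [RHS]integral_mkcond; apply: eq_integral => s _.
by rewrite cut_restrict restrict_EFin.
Qed.

(** The Heaviside function cut at T: up to time T, convolving a causal function with it is
    integrating from 0. *)
Definition one T : R -> R := tcut T (cst 1).

Lemma measurable_one T : mT (one T).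
Proof. exact: measurable_cut. Qed.

Lemma L1_one T : L1 (one T).
Proof.
apply: L1_cut; apply: measurable_bounded_integrable => //=.
  by rewrite lebesgue_measure_itv/=; case: ifP => // _; rewrite -EFinB ltry.
exists 1; split => // M M1 x _ /=; rewrite normr1; exact: ltW.
Qed.

Lemma one_le1 T x : `|one T x| <= 1.
Proof. by rewrite /one /tcut; case: ifP => _; rewrite ?normr1 ?normr0. Qed.

Lemma cv_one T a t : causal a -> 0 < t <= T ->
  cv (one T) a t = \int[mu]_s tcut t a s.
Proof.
move=> a0 /andP[t0 tT]; apply: eq_Rintegral => s _; rewrite /one /tcut.
have [s0|s0] := leP s 0; first by rewrite a0// mulr0.
rewrite subr_gt0; have [ts|st] := leP t s; first by rewrite /= mul0r.
by rewrite (_ : t - s < T) ?mul1r//; lra.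
Qed.

End convolution_linear.

(** * The kernels g_alpha and g_(1 - alpha) *)

Section marchaud_kernel.
Context {R : realType}.
Local Notation mu := (@lebesgue_measure R).
Local Notation L1 a := (mu.-integrable setT (EFin \o a)).
Local Notation mT a := (measurable_fun [set: R] a).
Variables (alpha T : R).
Hypothesis alpha01 : 0 < alpha < 1.
Hypothesis T0 : 0 < T.

Let alpha'01 : 0 < 1 - alpha < 1.
Proof. by move/andP: alpha01 => [? ?]; apply/andP; split; lra. Qed.

Let G0 : 0 < @euler_gamma R alpha. Proof. exact: euler_gamma_gt0. Qed.
Let G0' : 0 < @euler_gamma R (1 - alpha). Proof. exact: euler_gamma_gt0. Qed.

(** Cutting at T makes the kernel integrable on the line and, against causal functions, leaves
    convolutions unchanged up to time T. *)
Definition gk b : R -> R := tcut T (gker b).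

Lemma gkerE (b t : R) : 0 < t -> gker b t = ppow b t / euler_gamma b.
Proof. by move=> t0; rewrite /gker /ppow t0. Qed.

Lemma gker_gt0 (b t : R) : 0 < b < 1 -> 0 < t -> 0 < @gker R b t.
Proof. by move=> b01 t0; apply: divr_gt0; [exact: powR_gt0|exact: euler_gamma_gt0]. Qed.

Lemma gk_ge0 (b t : R) : 0 < b < 1 -> 0 <= gk b t.
Proof.
by move=> b0; rewrite /gk /tcut; case: ifPn => // /andP[t0 _]; rewrite ltW// gker_gt0.
Qed.

Lemma measurable_gker (b : R) : mT (gker b).
Proof. by apply: measurable_funM => //; exact: measurable_powR. Qed.

Lemma measurable_gk (b : R) : mT (gk b).
Proof. by apply: measurable_cut; apply: measurable_funTS; exact: measurable_gker. Qed.

Lemma L1_gk (b : R) : 0 < b < 1 -> L1 (gk b).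
Proof.
move=> b01; have /andP[b0 b1] := b01; apply: L1_cut; apply/integrableP; split.
  by apply/measurable_EFinP; apply: measurable_funTS; exact: measurable_gker.
have -> : (\int[mu]_(x in `]0%R, T[) `|(gker b x)%:E| =
    \int[mu]_(x in `]0%R, T[) ((x `^ (b - 1))%:E * (euler_gamma b)^-1%:E))%E.
  apply: eq_integral => x; rewrite inE/= in_itv/= => /andP[x0 _].
  by rewrite -EFinM ger0_norm// ltW// gker_gt0.
rewrite ge0_integralZr//.
- by rewrite integral_powR// -EFinM ltry.
- by apply/measurable_EFinP; apply: measurable_funTS; exact: measurable_powR.
- by move=> x _; rewrite lee_fin powR_ge0.
- by rewrite lee_fin invr_ge0; exact: (ltW (euler_gamma_gt0 b01)).
Qed.

Let pk (b t : R) := ppow b t / euler_gamma b.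

Let measurable_pk b : mT (pk b).
Proof. by apply: measurable_funM => //; exact: measurable_ppow. Qed.

Let pk_ge0 b t : 0 < b < 1 -> 0 <= pk b t.
Proof.
by move=> b01; apply: divr_ge0; [exact: ppow_ge0|exact: (ltW (euler_gamma_gt0 b01))].
Qed.

Let causal_pk b : causal (pk b).
Proof. by move=> t t0; rewrite /pk /ppow ltNge t0/= mul0r. Qed.

Let gk_pk b t : gk b t = tcut T (pk b) t.
Proof. by rewrite /gk /tcut; case: ifPn => // /andP[t0 _]; rewrite gkerE. Qed.

Let acv_pk t : 0 < t -> (acv (pk (1 - alpha)) (pk alpha) t = 1%:E)%E.
Proof.
move=> t0.
have := acv_ppow (1 - alpha) t0; rewrite (_ : 1 - (1 - alpha) = alpha); last by ring.
move=> H.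
transitivity (((euler_gamma (1 - alpha))^-1 * (euler_gamma alpha)^-1)%:E *
    acv (ppow (1 - alpha)) (ppow alpha) t)%E.
  rewrite /acv -ge0_integralZl//.
  - apply: eq_integral => s _; rewrite -EFinM; congr EFin.
    have p1 := mulr_ge0 (ppow_ge0 (1 - alpha) (t - s)) (ppow_ge0 alpha s).
    rewrite (ger0_norm p1) ger0_norm; last first.
      by apply: mulr_ge0; exact: pk_ge0.
    by rewrite /pk mulrACA mulrC.
  - apply/measurable_EFinP; apply: measurableT_comp => //; apply: measurable_funM.
      by apply: measurable_refl; exact: measurable_ppow.
    exact: measurable_ppow.
  - by rewrite lee_fin; apply: mulr_ge0; rewrite invr_ge0; [exact: (ltW G0')|exact: (ltW G0)].
rewrite H !euler_gammaE -[egamma (1 - alpha)]fineK ?egamma_fin//.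
rewrite -[egamma alpha in X in (_ * X)%E]fineK ?egamma_fin// -!EFinM; congr EFin.
rewrite /= mulrACA !mulVf ?mulr1// gt_eqF// fine_gt0// egamma_gt0//= egamma_lty//.
Qed.

(** For the uncut kernels the convolution is 1 at every t > 0 by the beta integral, and cutting
    nonnegative kernels can only decrease it. *)
Lemma acv_gk_le1 t : (acv (gk (1 - alpha)) (gk alpha) t <= 1%:E)%E.
Proof.
have [t0|t0] := leP t 0.
  rewrite /acv integral0_eq ?lee_fin ?ler01// => s _.
  have [s0|s0] := leP s 0; first by rewrite [gk alpha s]causal_cut// mulr0 normr0.
  by rewrite [gk _ (t - s)]causal_cut ?mul0r ?normr0// subr_le0 ltW// (le_lt_trans t0).
rewrite -(acv_pk t0); apply: acv_le; [exact: measurable_gk|exact: measurable_gk| | | |] => //.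
- move=> s; rewrite gk_pk /tcut; case: ifPn => // _; rewrite normr0 normr_ge0//.
- move=> s; rewrite gk_pk /tcut; case: ifPn => // _; rewrite normr0 normr_ge0//.
Qed.

Lemma acv_gk t : 0 < t <= T -> (acv (gk (1 - alpha)) (gk alpha) t = 1%:E)%E.
Proof.
move=> /andP[t0 tT]; rewrite -(acv_pk t0).
apply: (@eq_acv_lt _ _ _ _ _ T) => //; try exact: causal_cut; try exact: causal_pk.
- by move=> s sT; rewrite gk_pk cutE.
- by move=> s sT; rewrite gk_pk cutE.
Qed.

Lemma cv_gk t : 0 < t <= T -> cv (gk (1 - alpha)) (gk alpha) t = 1.
Proof.
by move=> t0; rewrite acv_cv ?acv_gk//; move=> s; exact: gk_ge0.
Qed.

End marchaud_kernel.

(** * The kernel truncated near 0 *)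

Section truncated_kernel.
Context {R : realType}.
Local Notation mu := (@lebesgue_measure R).
Local Notation L1 a := (mu.-integrable setT (EFin \o a)).
Local Notation mT a := (measurable_fun [set: R] a).
Variables (alpha T : R).
Hypothesis alpha01 : 0 < alpha < 1.
Hypothesis T0 : 0 < T.

Let a0 : 0 < alpha. Proof. by case/andP: alpha01. Qed.
Let alpha'01 : 0 < 1 - alpha < 1.
Proof. by move/andP: alpha01 => [? ?]; apply/andP; split; lra. Qed.
Let G0 : 0 < @euler_gamma R alpha. Proof. exact: euler_gamma_gt0. Qed.
Let G0' : 0 < @euler_gamma R (1 - alpha). Proof. exact: euler_gamma_gt0. Qed.

Local Notation g := (gk T alpha).
Local Notation gg := (gk T (1 - alpha)).
Local Notation one := (one T).
Local Notation c e := (gker (1 - alpha) e).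

(* [mk e] is minus the derivative of the kernel [gker (1 - alpha)] on (e, T). *)
Definition mk (e r : R) : R :=
  if e < r < T then alpha * r `^ (- alpha - 1) / euler_gamma (1 - alpha) else 0.

Section fixed_e.
Variable e : R.
Hypothesis e0 : 0 < e.

Lemma mk_ge0 r : 0 <= mk e r.
Proof.
rewrite /mk; case: ifPn => // _.
by rewrite divr_ge0 ?mulr_ge0 ?powR_ge0 ?ltW.
Qed.

Lemma mk_le r : `|mk e r| <= alpha * e `^ (- alpha - 1) / euler_gamma (1 - alpha).
Proof.
have M0 : 0 <= alpha * e `^ (- alpha - 1) / euler_gamma (1 - alpha).
  by rewrite divr_ge0 ?mulr_ge0 ?powR_ge0 ?ltW.
rewrite ger0_norm ?mk_ge0// /mk; case: ifPn => // /andP[er _].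
rewrite ler_wpM2r ?invr_ge0 ?(ltW G0')// ler_wpM2l ?(ltW a0)//.
rewrite (_ : - alpha - 1 = - (alpha + 1)); last by ring.
rewrite !powRN lef_pV2 ?posrE ?powR_gt0//; last exact: lt_trans er.
apply: ge0_ler_powR; rewrite ?nnegrE//; try exact: ltW.
- by rewrite addr_ge0// ltW.
- by rewrite ltW// (lt_trans e0).
Qed.

Lemma measurable_mk : mT (mk e).
Proof.
apply: measurable_fun_ifT => //.
  by apply: measurable_and; apply: measurable_fun_ltr.
apply: measurable_funM => //; apply: measurable_funM => //.
Qed.

Lemma causal_mk : causal (mk e).
Proof. by move=> r r0; rewrite /mk ltNge (le_trans r0 (ltW e0)). Qed.

Lemma L1_mk : L1 (mk e).
Proof.
have -> : mk e = tcut T (mk e).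
  apply/funext => r; rewrite /tcut; case: ifPn => // /negP h.
  rewrite /mk; case: ifPn => // /andP[er rT]; exfalso; apply: h.
  by rewrite rT (lt_trans e0).
apply: L1_cut; apply: measurable_bounded_integrable => //=.
- by rewrite lebesgue_measure_itv/=; case: ifP => // _; rewrite -EFinB ltry.
- by apply: measurable_funTS; exact: measurable_mk.
- exists (alpha * e `^ (- alpha - 1) / euler_gamma (1 - alpha)); split; first exact: num_real.
  move=> M M1 x _ /=.
  by rewrite (le_trans (mk_le x))// ltW.
Qed.

Lemma integral_mk_itv t : e < t -> t <= T ->
  (\int[mu]_(r in `]e, t[) (mk e r)%:E = (c e - c t)%:E)%E.
Proof.
move=> et tT; have t0 : 0 < t by exact: lt_trans et.
pose f r := alpha * r `^ (- alpha - 1) / euler_gamma (1 - alpha).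
pose F r := - (r `^ (- alpha) / euler_gamma (1 - alpha)).
transitivity (\int[mu]_(r in `]e, t[) (f r)%:E)%E.
  apply: eq_integral => r; rewrite inE/= in_itv/= /mk => /andP[-> rt].
  by rewrite (lt_le_trans rt).
have cp (p r : R) : 0 < r -> {for r, continuous (fun x : R => x `^ p)}.
  move=> r0; apply: differentiable_continuous; apply/derivable1_diffP.
  by apply: derivable_powR; rewrite in_itv/= r0.
rewrite (_ : c e - c t = F t - F e); last first.
  by rewrite /F /gker (_ : 1 - alpha - 1 = - alpha); [ring|ring].
apply: ge0_FTC2_oo => //.
- move=> r /andP[er _]; rewrite /f divr_ge0 ?mulr_ge0 ?powR_ge0 ?ltW//.
- move=> r /andP[er _]; apply: cvgMl; apply: cvgMr; apply: cp; exact: lt_trans er.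
- move=> r /andP[er _]; have r0 : 0 < r by exact: lt_trans er.
  have d1 : is_derive r 1 (fun x : R => x `^ (- alpha)) (- alpha * r `^ (- alpha - 1)).
    exact: is_derive1_powR.
  have dc : is_derive r (1 : R) (cst (euler_gamma (1 - alpha))^-1 : R -> R) 0 by exact: is_derive_cst.
  apply: (is_derive_eq (is_deriveN (is_deriveM d1 dc))).
  rewrite scaler0 add0r /GRing.scale/= /f; ring.
- apply: cvg_at_right_filter; apply: cvgN; apply: cvgMl; exact: cp.
- apply: cvg_at_left_filter; apply: cvgN; apply: cvgMl; exact: cp.
Qed.

(** This is the nonnegativity of k_e. For e < t the left-hand side is (t - e)^alpha e^(-alpha) / (t
    Gamma(alpha) Gamma(1 - alpha)), and the right-hand side is the same with t^alpha in place of (t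
    - e)^alpha. *)
Lemma acv_mk_le t : 0 < t < T -> (acv (mk e) g t <= (c e * g t)%:E)%E.
Proof.
move=> /[dup] tT' /andP[t0 tT].
have rhs0 : 0 <= c e * g t.
  by rewrite mulr_ge0 ?gk_ge0// ltW// gker_gt0.
rewrite acvC; [|exact: measurable_mk|exact: measurable_gk].
have [te|et] := leP t e.
  rewrite /acv integral0_eq ?lee_fin// => r _.
  have [r0|r0] := leP r t; first by rewrite /mk ltNge (le_trans r0 te)/= mulr0 normr0.
  by rewrite [g _]causal_cut ?mul0r ?normr0// subr_le0 ltW.
pose K := (euler_gamma (1 - alpha))^-1 / euler_gamma alpha.
have K0 : 0 < K by rewrite divr_gt0 ?invr_gt0.
pose f r := alpha * ((t - r) `^ (alpha - 1) * r `^ (- alpha - 1)).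
(* A primitive of f: the two terms of the product rule combine into the factor r + (t - r) = t,
   which t^-1 cancels. *)
pose F r := - t^-1 * ((t - r) `^ alpha * r `^ (- alpha)).
have f0 r : 0 <= f r by rewrite mulr_ge0 ?mulr_ge0 ?powR_ge0 ?ltW.
have mf : mT f.
  apply: measurable_funM => //; apply: measurable_funM; last exact: measurable_powR.
  by apply: (measurableT_comp (measurable_powR (alpha - 1))); exact: measurable_funB.
have -> : (acv g (mk e) t = K%:E * \int[mu]_(r in `]e, t[) (f r)%:E)%E.
  rewrite -ge0_integralZl//; [|by apply: measurable_funTS; exact/measurable_EFinP|by move=> *; rewrite lee_fin|by rewrite lee_fin ltW].
  rewrite [RHS]integral_mkcond; apply: eq_integral => r _.
  rewrite patchE; case: ifPn => [|/negP h].
    rewrite inE/= in_itv/= => /andP[er rt].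
    have r0 : 0 < r by exact: lt_trans er.
    rewrite -EFinM; congr EFin; rewrite ger0_norm ?mulr_ge0 ?gk_ge0 ?mk_ge0//.
    rewrite /mk er (lt_trans rt tT)/= /gk cutE ?subr_gt0 ?rt/=; last lra.
    rewrite /gker /f /K; ring.
  have [er|re] := ltP e r; last first.
    by rewrite /mk ltNge re/= mulr0 normr0.
  rewrite [g _]causal_cut ?mul0r ?normr0// subr_le0 leNgt; apply/negP => rt.
  by apply: h; rewrite inE/= in_itv/= er.
have cp (p r : R) : 0 < r -> {for r, continuous (fun x : R => x `^ p)}.
  move=> r0; apply: differentiable_continuous; apply/derivable1_diffP.
  by apply: derivable_powR; rewrite in_itv/= r0.
have cpt (p r : R) : r < t -> {for r, continuous (fun x : R => (t - x) `^ p)}.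
  move=> rt; apply: (@continuous_comp _ _ _ (fun x => t - x) (fun y => y `^ p)).
    by apply: cvgB; [exact: cvg_cst|exact: cvg_id].
  by apply: cp; rewrite subr_gt0.
have Ft : F t = 0 by rewrite /F subrr powR0 ?gt_eqF// mul0r mulr0.
have -> : (\int[mu]_(r in `]e, t[) (f r)%:E = (F t - F e)%:E)%E.
  apply: ge0_FTC2_oo => //.
  - move=> r /andP[er rt]; have r0 : 0 < r by exact: lt_trans er.
    apply: cvgMr; apply: cvgM; [exact: cpt|exact: cp].
  - move=> r /andP[er rt]; have r0 : 0 < r by exact: lt_trans er.
    have tr0 : 0 < t - r by rewrite subr_gt0.
    have d1 : is_derive r 1 (fun x : R => x `^ (- alpha)) (- alpha * r `^ (- alpha - 1)).
      exact: is_derive1_powR.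
    have d2 : is_derive (t - r) 1 (fun x : R => x `^ alpha) (alpha * (t - r) `^ (alpha - 1)).
      exact: is_derive1_powR.
    have d3 : is_derive r 1 (fun x : R => t - x) (- 1).
      have := @is_deriveB _ _ _ (cst t) id r 1 0 1 _ _.
      by rewrite sub0r; apply.
    have d4 : is_derive r 1 (fun x : R => (t - x) `^ alpha) (alpha * (t - r) `^ (alpha - 1) * - 1).
      exact: (@is_derive1_comp _ (fun x : R => x `^ alpha) (fun x => t - x)).
    have dc : is_derive r (1 : R) (cst (- t^-1) : R -> R) 0 by exact: is_derive_cst.
    apply: (is_derive_eq (is_deriveM dc (is_deriveM d4 d1))).
    rewrite scaler0 addr0 /GRing.scale/= /f.
    have -> : (t - r) `^ alpha = (t - r) * (t - r) `^ (alpha - 1).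
      by rewrite mulr_powRB1// ltW.
    have -> : r `^ (- alpha) = r * r `^ (- alpha - 1).
      rewrite -{2}(powRr1 (ltW r0)) -powRD; last by apply/implyP => _; rewrite gt_eqF.
      by congr (_ `^ _); ring.
    by field; rewrite gt_eqF.
  - apply: cvg_at_right_filter; apply: cvgMr; apply: cvgM; [exact: cpt|exact: cp].
  - rewrite Ft -(mulr0 (- t^-1)); apply: cvgMr; rewrite -(mul0r (t `^ (- alpha))).
    apply: cvgM; last by apply: cvg_at_left_filter; exact: cp.
    apply/cvg_at_leftP => u [ut ucvg].
    have /cvg_at_rightP := powR_cvg0 a0; apply; split.
      by move=> n; rewrite subr_gt0.
    by rewrite -(subrr t); apply: cvgB => //; exact: cvg_cst.
rewrite Ft -EFinM lee_fin /F sub0r mulNr opprK /gk cutE// /gker /K.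
rewrite (_ : 1 - alpha - 1 = - alpha); last by ring.
rewrite [X in _ <= X](_ : _ = (euler_gamma (1 - alpha))^-1 / euler_gamma alpha * (e `^ (- alpha) * t `^ (alpha - 1))); last by ring.
rewrite ler_pM2l// mulrA mulrC ler_wpM2l ?powR_ge0//.
rewrite mulrC ler_pdivrMr// mulrC mulr_powRB1 ?(ltW t0)//.
apply: ge0_ler_powR; rewrite ?nnegrE ?subr_ge0 ?(ltW a0) ?(ltW et) ?(ltW t0)//.
by rewrite gerBl ltW.
Qed.

End fixed_e.

End truncated_kernel.

(** * The approximate identity k_e *)

Section approximate_identity_kernel.
Context {R : realType}.
Local Notation mu := (@lebesgue_measure R).
Local Notation L1 a := (mu.-integrable setT (EFin \o a)).
Local Notation mT a := (measurable_fun [set: R] a).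
Variables (alpha T : R).
Hypothesis alpha01 : 0 < alpha < 1.
Hypothesis T0 : 0 < T.

Let alpha'01 : 0 < 1 - alpha < 1.
Proof. by move/andP: alpha01 => [? ?]; apply/andP; split; lra. Qed.

Local Notation g := (gk T alpha).
Local Notation gg := (gk T (1 - alpha)).
Local Notation one := (one T).
Local Notation c e := (gker (1 - alpha) e).
Local Notation mk := (mk alpha T).

(* [hk e] convolved with f is the Marchaud difference [c e * v - mk e * v] of
   [v = g * f]. *)
Definition hk (e : R) : R -> R := tcut T (fun t => c e * g t - cv (mk e) g t).
(* The primitive of [hk e] is [gke e * g], where [gke e] is
   [gker (1 - alpha)] frozen at its value in e on (0, e). *)
Definition gke (e : R) : R -> R := tcut T (fun t => c e - cv one (mk e) t).

Lemma hkE e t : 0 < t < T -> hk e t = c e * g t - cv (mk e) g t.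
Proof. exact: cutE. Qed.

Section fixed_e.
Variable e : R.
Hypothesis e0 : 0 < e.

Let mmk : mT (mk e). Proof. exact: measurable_mk. Qed.
Let imk : L1 (mk e). Proof. exact: L1_mk. Qed.
Let mg : mT g. Proof. exact: measurable_gk. Qed.
Let ig : L1 g. Proof. exact: L1_gk. Qed.
Let iT : L1 one. Proof. exact: L1_one. Qed.
Let mo : mT one. Proof. exact: measurable_one. Qed.
Let g0 x : 0 <= g x. Proof. exact: gk_ge0. Qed.
Let mk0 x : 0 <= mk e x. Proof. exact: mk_ge0. Qed.
Let cg : causal g. Proof. exact: causal_cut. Qed.
Let co : causal one. Proof. exact: causal_cut. Qed.
Let cmk : causal (mk e). Proof. exact: causal_mk. Qed.

Lemma causal_hk : causal (hk e). Proof. exact: causal_cut. Qed.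

Let L1_lin : L1 (fun t => c e * g t - cv (mk e) g t).
Proof.
have := integrableB measurableT (integrableZl measurableT (c e) ig) (L1_cv imk ig).
by apply: eq_integrable.
Qed.

Lemma L1_hk : L1 (hk e).
Proof. by apply: L1_cut; exact: integrableS L1_lin. Qed.

Lemma measurable_hk : mT (hk e).
Proof. exact: L1_mT L1_hk. Qed.

Lemma hk_ge0 t : 0 <= hk e t.
Proof.
rewrite /hk /tcut; case: ifPn => // tT; rewrite subr_ge0.
rewrite acv_cv//; have := acv_mk_le alpha01 e0 tT => h.
by rewrite -lee_fin fineK// ge0_fin_numE ?acv_ge0// (le_lt_trans h)// ltry.
Qed.

Let cv_one_mk t : 0 < t <= T -> cv one (mk e) t = c e - c (Num.max e t).
Proof.
move=> /andP[t0 tT]; rewrite cv_one//; last by rewrite t0.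
rewrite Rintegral_cut; have [te|et] := leP t e.
  rewrite subrr /Rintegral integral0_eq// => s /=; rewrite in_itv/= => /andP[_ st].
  by rewrite /mk ltNge (le_trans (ltW st) te).
rewrite /Rintegral (_ : (\int[mu]_(x in `]0%R, t[) (mk e x)%:E =
    \int[mu]_(x in `]e, t[) (mk e x)%:E)%E); first by rewrite integral_mk_itv.
rewrite integral_mkcond [RHS]integral_mkcond; apply: eq_integral => s _.
rewrite !patchE; have [es|se] := ltP e s; last first.
  by rewrite /mk ltNge se/=; case: ifP; case: ifP.
congr (if _ then _ else _); apply/idP/idP; rewrite !inE/= !in_itv/= => /andP[h1 h2].
  by rewrite es.
by rewrite h2 (lt_trans e0).
Qed.

Lemma gkeE t : 0 < t < T -> gke e t = c (Num.max e t).
Proof.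
move=> tT; have /andP[t0 t1] := tT.
by rewrite /gke cutE// cv_one_mk ?t0 ?ltW//; ring.
Qed.

Lemma gke_ge0 t : 0 <= gke e t.
Proof.
have [tT|tT] := boolP (0 < t < T); last by rewrite /gke /tcut (negbTE tT).
by rewrite gkeE// ltW// gker_gt0// lt_max e0.
Qed.

Lemma gke_le t : gke e t <= gg t.
Proof.
have [tT|tT] := boolP (0 < t < T); last by rewrite /gke /gk /tcut (negbTE tT).
have /andP[t0 t1] := tT.
rewrite gkeE// /gk cutE// /gker ler_wpM2r ?invr_ge0 ?(ltW (euler_gamma_gt0 _))//.
rewrite (_ : 1 - alpha - 1 = - alpha); last by ring.
have m0 : 0 < Num.max e t by rewrite lt_max e0.
rewrite !powRN lef_pV2 ?posrE ?powR_gt0//.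
case/andP: alpha01 => al0 al1.
apply: ge0_ler_powR; rewrite ?nnegrE ?(ltW al0) ?(ltW t0) ?(ltW m0)//.
by rewrite le_max lexx orbT.
Qed.

Lemma gke_eq t : e < t -> gke e t = gg t.
Proof.
move=> et; have [tT|tT] := boolP (0 < t < T); last by rewrite /gke /gk /tcut (negbTE tT).
by rewrite gkeE// /gk cutE// max_r// ltW.
Qed.

Lemma measurable_gke : mT (gke e).
Proof.
apply: measurable_cut; apply: measurable_funTS; apply: measurable_funB => //.
exact: measurable_cv.
Qed.

(** Associativity turns one * (c g - m * g) into (c one - one * m) * g, and the bracket is [gke e]
    on (0, T). *)
Lemma cv_one_hk t : 0 < t <= T -> cv one (hk e) t = cv (gke e) g t.
Proof.
move=> /andP[t0 tT].
have cmg : causal (cv (mk e) g) by exact: causal_cv.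
have com : causal (cv one (mk e)) by exact: causal_cv.
have mmg : mT (cv (mk e) g) by exact: measurable_cv.
have mom : mT (cv one (mk e)) by exact: measurable_cv.
have M1 x : `|one x| <= 1 := one_le1 T x.
have iom : (acv g (cv one (mk e)) t < +oo)%E.
  rewrite acvC//; apply: (@acv_bounded_lty _ _ _ _ (fine (\int[mu]_s `|mk e s|%:E)%E)) => // x.
  rewrite -lee_fin; apply: le_trans (abs_cv_le x mo mmk) _.
  apply: le_trans (acv_lty_bounded x mo imk M1) _.
  by rewrite mul1e fineK// ge0_fin_numE ?integral_ge0// L1_abs.
rewrite (@eq_cv_lt _ one one (hk e) (fun t => c e * g t - cv (mk e) g t) T)//; last 3 first.
- exact: causal_cut.
- by move=> x x0; rewrite cg// cmg// mulr0 subrr.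
- by move=> s sT; rewrite /hk cutE.
rewrite (cvBZr (c e) mo mg mmg (acv_bounded_lty t mo ig M1) (acv_bounded_lty t mo (L1_cv imk ig) M1)).
rewrite (cvA mo mmk mg); last first.
  apply: (@acv3_lty _ _ _ _ _ (fine (\int[mu]_s `|mk e s|%:E)%E)) => // x.
  apply: le_trans (acv_lty_bounded x mo imk M1) _.
  by rewrite mul1e fineK// ge0_fin_numE ?integral_ge0// L1_abs.
rewrite (@eq_cv_lt _ (gke e) (fun t => c e * one t - cv one (mk e) t) g g T)//; last 3 first.
- exact: causal_cut.
- by move=> x x0; rewrite co// com// mulr0 subrr.
- by move=> s sT; rewrite /gke /one !cutE// mulr1.
have mco : mT (fun s => c e * one s - cv one (mk e) s).
  by apply: measurable_funB => //; exact: measurable_funM.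
have igo : (acv g one t < +oo)%E by rewrite (acvC _ mg mo); exact: acv_bounded_lty M1.
rewrite [RHS](cvC _ mco mg) (cvBZr (c e) mg mo mom igo iom).
by rewrite (cvC _ mo mg) (cvC _ mom mg).
Qed.

Lemma cv_gke_le1 t : cv (gke e) g t <= 1.
Proof.
have gg0 x : 0 <= gg x by exact: gk_ge0.
have mgg : mT gg by exact: measurable_gk.
have h : (acv (gke e) g t <= 1)%E.
  apply: le_trans (acv_gk_le1 T alpha01 t); apply: acv_le => //; first exact: measurable_gke.
  by move=> s; rewrite !ger0_norm ?gke_le ?gke_ge0.
rewrite acv_cv//; last exact: gke_ge0.
by rewrite -lee_fin fineK// ge0_fin_numE ?acv_ge0// (le_lt_trans h)// ltry.
Qed.

Lemma hkT : tcut T (hk e) = hk e.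
Proof. by apply/funext => t; rewrite /hk /tcut; case: (0 < t < T). Qed.

Lemma integral_hk_le1 : \int[mu]_s hk e s <= 1.
Proof.
rewrite -hkT -(@cv_one _ T); [|exact: causal_cut|by rewrite T0 lexx].
by rewrite cv_one_hk ?T0 ?lexx//; exact: cv_gke_le1.
Qed.

End fixed_e.

(** Together with [integral_hk_le1], the mass of k_e concentrates at 0. The mass of (0, t) is the
    convolution of [gke (e n)] with g_alpha at t, and [gke (e n)] tends to g_(1 - alpha) from below,
    so dominated convergence applies. *)
Lemma integral_hk_cvg (e : R^nat) (t : R) : (forall n, 0 < e n) ->
  e n @[n --> \oo] --> 0 -> 0 < t <= T ->
  \int[mu]_s tcut t (hk (e n)) s @[n --> \oo] --> (1 : R).
Proof.
move=> e0 ecvg tT.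
have mgg : mT gg by exact: measurable_gk.
have mg : mT g by exact: measurable_gk.
have gg0 x : 0 <= gg x by exact: gk_ge0.
have g0 x : 0 <= g x by exact: gk_ge0.
rewrite -(cv_gk alpha01 tT).
have -> : (fun n => \int[mu]_s tcut t (hk (e n)) s) = (fun n => cv (gke (e n)) g t).
  apply/funext => n; rewrite -cv_one_hk// (@cv_one _ T)//; exact: causal_cut.
have igg : mu.-integrable setT (fun s => (gg (t - s) * g s)%:E).
  by apply: integrable_cvker => //; rewrite acv_gk// ltry.
have mgke n : measurable_fun setT (fun s : measurableTypeR R => (gke (e n) (t - s) * g s)%:E).
  apply/measurable_EFinP/measurable_funM => //; apply: measurable_refl.
  exact: measurable_gke.
have [] := @dominated_convergence _ (measurableTypeR R) R mu setT measurableT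
  (fun n s => (gke (e n) (t - s) * g s)%:E) (fun s => (gg (t - s) * g s)%:E)
  (fun s => (gg (t - s) * g s)%:E) mgke (measurable_int _ igg) _ igg _.
- apply: aeW => s _; apply: cvg_EFin; first exact: nearW.
  apply: cvgMl; rewrite /=; have [ts|ts] := leP (t - s) 0.
    rewrite [gg _]causal_cut//; under eq_fun do rewrite /gke causal_cut//.
    exact: cvg_cst.
  apply: cvg_near_cst.
  have /cvgrPdist_lt/(_ _ ts) := ecvg.
  apply: filterS => n; rewrite sub0r normrN gtr0_norm// => h.
  by rewrite gke_eq.
- apply: aeW => s n _ /=; rewrite lee_fin ger0_norm ?mulr_ge0 ?gke_ge0//.
  by rewrite ler_wpM2r// gke_le.
move=> _ _ H; rewrite /cv /Rintegral; apply: fine_cvg.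
by rewrite fineK// integrable_fin_num.
Qed.

End approximate_identity_kernel.

(** * Mollification of two-variable kernels *)

Section mollification.
Context {R : realType}.
Local Notation mu := (@lebesgue_measure R).
Local Notation L1 a := (mu.-integrable setT (EFin \o a)).
Local Notation mT a := (measurable_fun [set: R] a).
Local Notation RR := (measurableTypeR R * measurableTypeR R)%type.

(** Only the first variable is shifted: in the application K (s, t) = f s (z t) is averaged in s
    while z stays at time t. *)
Definition shift_modulus (K : RR -> R) (r : R) : \bar R :=
  (\int[mu]_t `|K ((t - r)%R, t) - K (t, t)|%:E)%E.

Lemma measurable_skew (K : RR -> R) : measurable_fun setT K ->
  measurable_fun setT (fun p : RR => K ((p.1 - p.2), p.1)).
Proof.
move=> mK.
have m1 : measurable_fun setT (fun p : RR => p.1 - p.2 : measurableTypeR R).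
  exact: measurable_funB.
have m2 : measurable_fun setT (fun p : RR => p.1 : measurableTypeR R) by exact: measurable_fst.
exact: (measurableT_comp mK (measurable_fun_pair m1 m2)).
Qed.

Lemma measurable_diag (K : RR -> R) : measurable_fun setT K ->
  mT (fun t => K (t, t)).
Proof.
move=> mK.
have m2 : measurable_fun setT (fun t : measurableTypeR R => t : measurableTypeR R) by exact: measurable_id.
exact: (measurableT_comp mK (measurable_fun_pair m2 m2)).
Qed.

(** Three sources of error: shifts r < d cost at most e, since k has mass at most 1; longer shifts
    cost B times the mass of k beyond d; the mass that k lacks to reach 1 costs A. Both of these
    masses are at most 1 minus the mass on (0, d). *)
Lemma mollification_error (k : R -> R) (K : RR -> R) (A B d e : R) :
  measurable_fun setT K -> L1 k -> causal k -> (forall r, 0 <= k r) ->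
  \int[mu]_r k r <= 1 ->
  0 <= A -> 0 <= B -> 0 <= e ->
  (\int[mu]_t `|K (t, t)|%:E <= A%:E)%E ->
  (forall r : R, shift_modulus K r <= B%:E)%E ->
  (forall r : R, 0 < r < d -> (shift_modulus K r <= e%:E)%E) ->
  (\int[mu]_t `|(\int[mu]_s (k (t - s) * K (s, t))) - K (t, t)|%:E <=
    (e + (A + B) * (1 - \int[mu]_r tcut d k r))%:E)%E.
Proof.
move=> mK ik ck k0 M1 A0 B0 e0 KA KB Ke.
have mk := L1_mT ik.
have mD := measurable_diag mK.
have mS := measurable_skew mK.
set M := \int[mu]_r k r in M1 *; set Md := \int[mu]_r tcut d k r.
have idk : L1 (tcut d k) by apply: L1_cut; exact: integrableS ik.
have ME : (\int[mu]_r (k r)%:E = M%:E)%E.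
  by rewrite /M /Rintegral fineK// integrable_fin_num.
have MdE : (\int[mu]_r (tcut d k r)%:E = Md%:E)%E.
  by rewrite /Md /Rintegral fineK// integrable_fin_num.
have MdM : Md <= M.
  apply: le_Rintegral => // r _; rewrite /tcut; case: ifP => // _; exact: k0.
pose q (p : RR) := `|k p.2 * (K (p.1 - p.2, p.1) - K (p.1, p.1))|.
have mq : measurable_fun setT q.
  apply: measurableT_comp => //; apply: measurable_funM; first exact: measurableT_comp.
  by apply: measurable_funB => //; exact: (measurableT_comp mD).
pose Q t : \bar R := (\int[mu]_r (q (t, r))%:E)%E.
have Q0 t : (0 <= Q t)%E by apply: integral_ge0 => r _; rewrite lee_fin /q normr_ge0.
have mQ : mT Q by exact: (measurable_param_integral mu mq).
have mSM : mT (shift_modulus K).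
  have mq' : measurable_fun setT (fun p : RR => `|K (p.2 - p.1, p.2) - K (p.2, p.2)|).
    apply: measurableT_comp => //; apply: measurable_funB.
      by apply: (measurableT_comp mS (measurable_fun_pair _ _)).
    exact: (measurableT_comp mD).
  exact: (measurable_param_integral mu mq').
have intQ : (\int[mu]_t Q t <= (e + B * (1 - Md))%:E)%E.
  have mqE : measurable_fun setT (fun p : RR => (q p)%:E) by exact/measurable_EFinP.
  have q0E (p : RR) : (0 <= (q p)%:E)%E by rewrite lee_fin /q normr_ge0.
  rewrite /Q (fubini_tonelli (fun p => (q p)%:E) mqE q0E).
  have -> : (\int[mu]_r \int[mu]_t (q (t, r))%:E = \int[mu]_r ((k r)%:E * shift_modulus K r))%E.
    apply: eq_integral => r _; rewrite /shift_modulus -ge0_integralZl//.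
    - by apply: eq_integral => t _; rewrite /q/= normrM (ger0_norm (k0 r)) EFinM.
    - apply/measurable_EFinP; apply: measurableT_comp => //; apply: measurable_funB => //.
      apply: (measurableT_comp mS (measurable_fun_pair _ _)) => //.
    - by rewrite lee_fin.
  have SM0 r : (0 <= shift_modulus K r)%E by apply: integral_ge0 => ? _; rewrite lee_fin.
  apply: (@le_trans _ _ (\int[mu]_r (k r * e + B * (k r - tcut d k r))%:E)%E).
    apply: ge0_le_integral => //.
    - by move=> r _; rewrite mule_ge0// lee_fin.
    - by apply: emeasurable_funM => //; exact/measurable_EFinP.
    - apply/measurable_EFinP; apply: measurable_funD; first exact: measurable_funM.
      by apply: measurable_funM => //; apply: measurable_funB => //; exact: L1_mT idk.
    - move=> r _; rewrite /tcut; have [r0|r0] := leP r 0.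
        by rewrite ck// mul0e !mul0r subrr mulr0 addr0.
      case: ifPn => rd.
        by rewrite subrr mulr0 addr0 EFinM; apply: lee_wpmul2l; rewrite ?lee_fin ?k0 ?Ke ?rd ?r0.
      apply: (@le_trans _ _ (k r * B)%:E); first by rewrite EFinM lee_wpmul2l ?lee_fin.
      by rewrite lee_fin subr0 mulrC lerDr mulr_ge0.
  have i1 : mu.-integrable setT (fun r => (k r * e)%:E).
    by have := integrableZr measurableT e ik; apply: eq_integrable.
  have i2 : mu.-integrable setT (fun r => (B * (k r - tcut d k r))%:E).
    have := integrableZl measurableT B (integrableB measurableT ik idk).
    by apply: eq_integrable.
  have -> : (\int[mu]_r (k r * e + B * (k r - tcut d k r))%:E =
     (M * e + B * (M - Md))%:E)%E.
    rewrite (@integralD _ _ _ mu setT measurableT (fun r => (k r * e)%:E)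
      (fun r => (B * (k r - tcut d k r))%:E))// EFinD; congr (_ + _)%E.
      under eq_integral do rewrite EFinM.
      by rewrite integralZr// ME.
    under eq_integral do rewrite EFinM.
    rewrite integralZl//; last exact: (integrableB measurableT ik idk).
    rewrite EFinM; congr (_ * _)%E.
    by rewrite (integralB_EFin measurableT ik idk) /= ME MdE.
  rewrite lee_fin; apply: lerD; first by rewrite ler_piMl.
  by rewrite ler_wpM2l// lerD2r.
have Qae : {ae mu, forall t, (Q t < +oo)%E}.
  by apply: ae_lty => //; exact: le_lt_trans intQ (ltry _).
pose P t := \int[mu]_s (k (t - s) * K (s, t)).
have mP : mT P.
  apply: (measurable_param_Rintegral mu (K := fun p : RR => k (p.1 - p.2) * K (p.2, p.1))).
  apply: measurable_funM; first by apply: (measurableT_comp mk); exact: measurable_funB.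
  exact: (measurableT_comp mK (measurable_fun_pair _ _)).
have PQ t : (Q t < +oo)%E -> (`|P t - K (t, t)|%:E <= Q t + ((1 - M) * `|K (t, t)|)%:E)%E.
  move=> Qt.
  have iq : mu.-integrable setT (fun r => (k r * (K (t - r, t) - K (t, t)))%:E).
    apply/integrableP; split => //; apply/measurable_EFinP; apply: measurable_funM => //.
    by apply: measurable_funB => //; apply: (measurableT_comp mS (measurable_fun_pair _ _)).
  have iD : mu.-integrable setT (fun r => (K (t, t) * k r)%:E).
    by have := integrableZl measurableT (K (t, t)) ik; apply: eq_integrable.
  have PE : P t = \int[mu]_r (k r * (K (t - r, t) - K (t, t))) + K (t, t) * M.
    transitivity (\int[mu]_r (k r * K (t - r, t))).
      rewrite /P /Rintegral -[in RHS](integral_refl t); last first.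
        apply/measurable_EFinP; apply: measurable_funM => //.
        by apply: (measurableT_comp mS (measurable_fun_pair _ _)).
      by congr fine; apply: eq_integral => s _; rewrite subKr.
    rewrite /M -RintegralZl// -RintegralD//.
    by apply: eq_Rintegral => r _; ring.
  rewrite PE; set J := \int[mu]_r _.
  have -> : J + K (t, t) * M - K (t, t) = J + (M - 1) * K (t, t) by ring.
  apply: (@le_trans _ _ (`|J| + `|(M - 1) * K (t, t)|)%:E).
    by rewrite lee_fin ler_normD.
  rewrite EFinD normrM distrC (ger0_norm (_ : 0 <= 1 - M)) ?subr_ge0// leeD2r//.
  rewrite /J EFin_normr_Rintegral//; apply: le_abse_integral => //.
  exact: (measurable_int _ iq).
apply: (@le_trans _ _ (\int[mu]_t (Q t + (1 - M)%:E * `|K (t, t)|%:E))%E).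
  apply: ae_ge0_le_integral => //.
  - apply/measurable_EFinP; apply: measurableT_comp => //; exact: measurable_funB.
  - by move=> t _; rewrite adde_ge0// mule_ge0// lee_fin ?subr_ge0.
  - apply: emeasurable_funD => //; apply: emeasurable_funM => //.
    by apply/measurable_EFinP; exact: measurableT_comp.
  - by apply: (aeS _ Qae) => t /PQ.
have mDa : measurable_fun setT (fun t : measurableTypeR R => `|K (t, t)|%:E).
  by apply/measurable_EFinP; exact: measurableT_comp.
rewrite ge0_integralD//; last 2 first.
- by move=> t _; rewrite mule_ge0// lee_fin subr_ge0.
- exact: emeasurable_funM.
rewrite ge0_integralZl//; last by rewrite lee_fin subr_ge0.
rewrite mulrDl [A * _ + _]addrC addrA [X in (_ <= X)%E]EFinD; apply: leeD => //.
apply: (@le_trans _ _ ((1 - M)%:E * A%:E)%E).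
  by rewrite lee_wpmul2l// lee_fin subr_ge0.
by rewrite -EFinM lee_fin mulrC ler_wpM2l// lerB.
Qed.

End mollification.

(** * Continuity of translations in L^1 *)

Section translation_continuity.
Context {R : realType}.
Local Notation mu := (@lebesgue_measure R).
Local Notation L1 a := (mu.-integrable setT (EFin \o a)).
Local Notation mT a := (measurable_fun [set: R] a).

Let itv_lty (x y : R) : (mu `[x, y]%classic < +oo)%E.
Proof. by rewrite lebesgue_measure_itv/=; case: ifP => // _; rewrite -EFinB ltry. Qed.

(** By contradiction: shifts r n -> 0 violating the bound contradict dominated convergence, as r n <
    1 keeps all arguments in [-1, T + 1], where f is bounded. *)
Lemma translation_continuous (T : R) (f : R -> R) (e : R) : 0 < T -> continuous f -> 0 < e ->
  exists2 d : R, 0 < d & forall r, 0 < r < d ->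
    (\int[mu]_(t in `[0%R, (T + 1)%R]) `|f (t - r) - f t|%:E <= e%:E)%E.
Proof.
move=> T0 cf e0; have mf : mT f by exact: continuous_measurable_fun.
apply: contrapT => H.
have {}H (n : nat) : exists r : R, 0 < r < n.+1%:R^-1 /\
    ~ (\int[mu]_(t in `[0%R, (T + 1)%R]) `|f (t - r) - f t|%:E <= e%:E)%E.
  apply: contrapT => h; apply: H; exists n.+1%:R^-1 => // r rn.
  by apply: contrapT => h'; apply: h; exists r.
have [r rP] := choice H.
have r0 n : 0 < r n by have [/andP[]] := rP n.
have r1 n : r n < 1.
  have [/andP[_ h] _] := rP n; apply: lt_le_trans h _.
  by rewrite invf_le1// ler1n.
have rcvg : r n @[n --> \oo] --> 0.
  apply: (@squeeze_cvgr _ _ _ _ (cst 0) (fun n => n.+1%:R^-1)).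
  - apply: nearW => n; have [/andP[h1 h2] _] := rP n.
    by rewrite (ltW h1) (ltW h2).
  - exact: cvg_cst.
  - exact: cvg_harmonic.
have cpt : compact ((f : R^o -> R^o) @` `[-1, T + 1]).
  apply: continuous_compact; last exact: segment_compact.
  exact: continuous_subspaceT.
have /pinfty_ex_gt0[M0 M00 fM0] := compact_bounded cpt.
set M := M0 in M00 fM0.
have fM x : -1 <= x <= T + 1 -> `|f x| <= M.
  by move=> xT; apply: fM0; exists x => //=; rewrite in_itv.
pose D : set R := `[0, T + 1]%classic.
have ig : mu.-integrable D (fun=> (M + M)%:E).
  apply: measurable_bounded_integrable => //=; [exact: measurable_itv|exact: itv_lty|]. 
  exists (M + M); split; first exact: num_real.
  move=> x xM y _ /=; rewrite ger0_norm; first exact: ltW.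
  by rewrite addr_ge0 ?(ltW M00).
have mfr n : measurable_fun D (fun t => `|f (t - r n) - f t|%:E).
  apply/measurable_EFinP; apply: measurable_funTS; apply: measurableT_comp => //.
  apply: measurable_funB => //; apply: (measurableT_comp mf); exact: measurable_funB.
have [] := @dominated_convergence _ (measurableTypeR R) R mu D (measurable_itv _)
  (fun n t => `|f (t - r n) - f t|%:E) (cst 0%E) (fun=> (M + M)%:E) mfr _ _ ig _ => //.
- apply: aeW => t Dt; apply: cvg_EFin; first exact: nearW.
  rewrite /=; apply/norm_cvg0P.
  rewrite -[X in _ --> X](subrr (f t)); apply: cvgB; last exact: cvg_cst.
  have trc : t - r n @[n --> \oo] --> t.
    by rewrite -[X in _ --> X]subr0; apply: cvgB => //; exact: cvg_cst.
  by apply: (@cvg_comp _ _ _ (fun n => t - r n) f _ (nbhs t)); [exact: trc|exact: cf].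
- apply: aeW => t n; rewrite /D/= in_itv/= => /andP[t0 tT].
  rewrite lee_fin normr_id; apply: le_trans (ler_normB _ _) _.
  have := r0 n => rn0; have := r1 n => rn1.
  by apply: lerD; apply: fM; apply/andP; split; lra.
rewrite integral0 => _ _ Hc.
have : \forall z \near (0 : \bar R), (z < e%:E)%E by apply: open_ereal_lt'; rewrite lte_fin.
move=> /Hc[n _ /(_ n (leqnn n))] /= h.
by have [_] := rP n; apply; exact: ltW.
Qed.

Lemma translation_L1 (T : R) (a : R -> R) (e : R) : 0 < T -> L1 a ->
  (forall x, ~~ (0 < x < T) -> a x = 0) -> 0 < e ->
  exists2 d : R, 0 < d & forall r, 0 < r < d ->
    (\int[mu]_t `|a (t - r) - a t|%:E <= e%:E)%E.
Proof.
move=> T0 ia aT e0; have ma := L1_mT ia.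
pose E : set R := `[-1, T + 1]%classic.
have mE : measurable E by exact: measurable_itv.
have iaE : mu.-integrable E (EFin \o a) by exact: integrableS ia.
have [f_ [cf_ if_ fcvg]] := approximation_continuous_integrable mE (itv_lty _ _) iaE.
have e4 : 0 < e / 4 by rewrite divr_gt0.
have e2 : 0 < e / 2 by rewrite divr_gt0.
have [n fn] : exists n, (\int[mu]_(z in E) `|(a z - f_ n z)%:E| < (e / 4)%:E)%E.
  have : \forall z \near (0 : \bar R), (z < (e / 4)%:E)%E.
    by apply: open_ereal_lt'; rewrite lte_fin.
  by move=> h; have [n _ /(_ n (leqnn n)) hn] := fcvg _ h; exists n.
set f := f_ n in fn; have cf : continuous f by exact: cf_.
have mf : mT f by exact: continuous_measurable_fun.
have [d d0 dP] := translation_continuous T0 cf e2.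
(* For r < 1 both a (t - r) and a t vanish when t is outside [0, T + 1], so the approximation of a
   by f on E = [-1, T + 1] is enough. *)
exists (Num.min d 1) => [|r]; first by rewrite lt_min d0/=.
rewrite lt_min => /andP[r0 /andP[rd r1]].
pose u : R -> \bar R := (fun z => `|(a z - f z)%:E|%E) \_ E.
pose D : set R := `[0, T + 1]%classic.
pose w : R -> \bar R := (fun t => `|f (t - r) - f t|%:E) \_ D.
have mu_ : mT u.
  have m1 : measurable_fun setT (fun z : measurableTypeR R => `|(a z - f z)%:E|%E).
    by apply: measurableT_comp => //; apply/measurable_EFinP; exact: measurable_funB.
  by apply/(measurable_restrictT _ _).1 => //; exact: measurable_funS m1.
have mw : mT w.
  have m1 : measurable_fun setT (fun t : measurableTypeR R => `|f (t - r) - f t|%:E).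
    apply/measurable_EFinP; apply: measurableT_comp => //; apply: measurable_funB => //.
    by apply: (measurableT_comp mf); exact: measurable_funB.
  apply/(measurable_restrictT _ _).1; first exact: measurable_itv.
  exact: measurable_funS m1.
have u0 z : (0 <= u z)%E by rewrite /u patchE; case: ifP.
have w0 z : (0 <= w z)%E by rewrite /w patchE; case: ifP => // _; rewrite lee_fin.
have iu : (\int[mu]_z u z <= (e / 4)%:E)%E by rewrite -integral_mkcond ltW.
have iw : (\int[mu]_z w z <= (e / 2)%:E)%E by rewrite -integral_mkcond dP// r0.
have mur : measurable_fun setT (fun t : measurableTypeR R => u (t - r)).
  by apply: (measurableT_comp mu_); exact: measurable_funB.
apply: (@le_trans _ _ (\int[mu]_t (u (t - r)%R + (w t + u t)))%E).
  apply: ge0_le_integral => //.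
  - apply/measurable_EFinP; apply: measurableT_comp => //; apply: measurable_funB => //.
    by apply: (measurableT_comp ma); exact: measurable_funB.
  - by apply: emeasurable_funD => //; exact: emeasurable_funD.
  - move=> t _; have [tD|tD] := boolP (0 <= t <= T + 1); last first.
      rewrite !aT ?subrr ?normr0; first by rewrite !adde_ge0.
        by apply: contra tD => /andP[h1 h2]; apply/andP; split; lra.
      by apply: contra tD => /andP[h1 h2]; apply/andP; split; lra.
    have /andP[t0 tT] := tD.
    have hE x : -1 <= x <= T + 1 -> x \in E by move=> h; rewrite inE /E/= in_itv.
    have hD : t \in D by rewrite inE /D/= in_itv.
    rewrite /u /w !patchE hD !hE; last 2 first.
    - by apply/andP; split; lra.
    - by apply/andP; split; lra.
    rewrite -!EFinD lee_fin (_ : a (t - r) - a t = (a (t - r) - f (t - r)) + ((f (t - r) - f t) - (a t - f t))); last by ring.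
    apply: le_trans (ler_normD _ _) _; rewrite lerD2l.
    exact: ler_normB.
rewrite ge0_integralD//; last 2 first.
- by move=> t _; rewrite adde_ge0.
- exact: emeasurable_funD.
rewrite ge0_integralD// (integral_shift r mu_).
rewrite (_ : e%:E = (e / 4)%:E + ((e / 2)%:E + (e / 4)%:E))%E; last first.
  by rewrite -!EFinD; congr EFin; field.
by rewrite !leeD.
Qed.

End translation_continuity.

(** * Strongly measurable functions *)

Section simple_functions.
Context d1 d2 (T1 : measurableType d1) (T2 : measurableType d2) (R : realType).
Variables (X Y : normedModType R).

(** Phi is arbitrary: with finitely many values of s and z, a preimage is a finite union of
    measurable rectangles. *)
Lemma measurable_simple2 (s : T1 -> X) (z : T2 -> Y) (Phi : X -> Y -> R) :
  simple_function s -> simple_function z ->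
  measurable_fun setT (fun p : T1 * T2 => Phi (s p.1) (z p.2)).
Proof.
move=> [fs ms] [fz mz] _ B mB; rewrite setTI.
have -> : (fun p : T1 * T2 => Phi (s p.1) (z p.2)) @^-1` B =
    \bigcup_(x in range s) \bigcup_(y in range z)
      (if pselect (B (Phi x y)) then (s @^-1` [set x]) `*` (z @^-1` [set y]) else set0).
  apply/seteqP; split => [[a b] /= Bab|[a b] /=].
    exists (s a); first by exists a.
    by exists (z b); [exists b|case: pselect].
  move=> [x hx [y hy]]; case: pselect => // Bxy [/= e1 e2].
  by rewrite e1 e2.
apply: fin_bigcup_measurable => // x _; apply: fin_bigcup_measurable => // y _.
by case: pselect => ? //=; exact: measurableX.
Qed.

End simple_functions.

Section strong_measurability.
Context d (T : measurableType d) (R : realType).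
Implicit Types X Y : normedModType R.

(** Sequential continuity of Phi passes measurability from simple functions to their limits, without
    a sigma-algebra on X or Y. *)
Lemma measurable_strong2 d2 (T2 : measurableType d2) X Y (f : T -> X) (z : T2 -> Y)
    (Phi : X -> Y -> R) :
  strongly_measurable setT f -> strongly_measurable setT z ->
  (forall (x_ : nat -> X) (y_ : nat -> Y) x y, x_ n @[n --> \oo] --> x ->
    y_ n @[n --> \oo] --> y -> Phi (x_ n) (y_ n) @[n --> \oo] --> Phi x y) ->
  measurable_fun setT (fun p : T * T2 => Phi (f p.1) (z p.2)).
Proof.
move=> [s ss sf] [r rr rz] PhiC.
apply: (@measurable_fun_cvg _ _ _ setT (fun n (p : T * T2) => Phi (s n p.1) (r n p.2))).
  by move=> n; exact: (measurable_simple2 Phi (ss n) (rr n)).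
by move=> [a b] _ /=; apply: PhiC; [exact: sf|exact: rz].
Qed.

Lemma measurable_strong X Y (f : T -> X) (z : T -> Y) (Phi : X -> Y -> R) :
  strongly_measurable setT f -> strongly_measurable setT z ->
  (forall (x_ : nat -> X) (y_ : nat -> Y) x y, x_ n @[n --> \oo] --> x ->
    y_ n @[n --> \oo] --> y -> Phi (x_ n) (y_ n) @[n --> \oo] --> Phi x y) ->
  measurable_fun setT (fun t => Phi (f t) (z t)).
Proof.
move=> sf sz PhiC; have h := measurable_strong2 sf sz PhiC.
have mi : measurable_fun setT (fun t : T => t) by exact: measurable_id.
exact: (measurableT_comp h (measurable_fun_pair mi mi)).
Qed.

Lemma strong_simple X (s : T -> X) : simple_function s -> strongly_measurable setT s.
Proof. by move=> ss; exists (fun=> s) => // t _; exact: cvg_cst. Qed.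

Lemma simple_cst X (x : X) : simple_function (cst x : T -> X).
Proof.
split; first by apply: (@sub_finite_set _ _ [set x]) => // _ [t _ <-].
move=> y; have [->|xy] := eqVneq y x.
  by rewrite (_ : _ @^-1` _ = setT)//; apply/seteqP; split.
rewrite (_ : _ @^-1` _ = set0)//; apply/seteqP; split => // t /=.
by move=> xy'; move/eqP: xy; rewrite xy'.
Qed.

Lemma measurable_norm_strong X (f : T -> X) : strongly_measurable setT f ->
  measurable_fun setT (fun t => `|f t|).
Proof.
move=> sf; apply: (@measurable_strong _ _ f f (fun x _ => `|x|)) => //.
by move=> x_ y_ x y xc _; exact: cvg_norm.
Qed.

Lemma measurable_dist_strong X (f z : T -> X) : strongly_measurable setT f ->
  strongly_measurable setT z -> measurable_fun setT (fun t => `|f t - z t|).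
Proof.
move=> sf sz; apply: (@measurable_strong _ _ f z (fun x y => `|x - y|)) => //.
by move=> x_ y_ x y xc yc; apply: cvg_norm; exact: cvgB.
Qed.

Definition zext (A : set T) X (f : T -> X) (t : T) : X :=
  if pselect (A t) then f t else 0.

Lemma zextE (A : set T) X (f : T -> X) t : A t -> zext A f t = f t.
Proof. by rewrite /zext; case: pselect. Qed.

Lemma zextN (A : set T) X (f : T -> X) t : ~ A t -> zext A f t = 0.
Proof. by rewrite /zext; case: pselect. Qed.

Lemma simple_zext (A : set T) X (s : T -> X) : measurable A ->
  simple_function s -> simple_function (zext A s).
Proof.
move=> mA [fs ms]; split.
  apply: (@sub_finite_set _ _ (range s `|` [set 0])); last by rewrite finite_setU.
  move=> _ [t _ <-]; rewrite /zext; case: pselect => ? /=; last by right.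
  by left; exists t.
move=> x; have -> : zext A s @^-1` [set x] =
    (A `&` s @^-1` [set x]) `|` (if x == 0 then ~` A else set0).
  apply/seteqP; split => t /=; rewrite /zext; case: pselect => At.
  - by move=> <-; left.
  - by move=> <-; right; rewrite eqxx.
  - by move=> [[]//|]; case: ifP.
  - by move=> [[]//|]; case: ifPn => // /eqP ->.
apply: measurableU; first exact: measurableI.
by case: ifP => // _; exact: measurableC.
Qed.

Lemma strong_zext (A : set T) X (f : T -> X) : measurable A ->
  strongly_measurable A f -> strongly_measurable setT (zext A f).
Proof.
move=> mA [s ss sf]; exists (fun n => zext A (s n)).
  by move=> n; exact: simple_zext.
move=> t _; have [At|At] := pselect (A t).
  by rewrite zextE//; under eq_fun do rewrite zextE//; exact: sf.
by rewrite zextN//; under eq_fun do rewrite zextN//; exact: cvg_cst.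
Qed.

Lemma strong_lin X (a : R) (f z : T -> X) : strongly_measurable setT f ->
  strongly_measurable setT z -> strongly_measurable setT (fun t => f t - a *: z t).
Proof.
move=> [s ss sf] [r rr rz]; exists (fun n t => s n t - a *: r n t); last first.
  move=> t _; apply: cvgB; first exact: sf.
  by apply: cvgZr; exact: rz.
move=> n; have [fs ms] := ss n; have [fr mr] := rr n; split.
  apply: (@sub_finite_set _ _ ((fun p => p.1 - a *: p.2) @` (range (s n) `*` range (r n)))).
    by move=> _ [t _ <-]; exists (s n t, r n t) => //; split; exists t.
  by apply: finite_image; exact: finite_setX.
move=> x; have -> : (fun t => s n t - a *: r n t) @^-1` [set x] =
   \bigcup_(y in range (r n)) (s n @^-1` [set x + a *: y] `&` r n @^-1` [set y]).
  apply/seteqP; split => t /=.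
    by move=> <-; exists (r n t); [exists t|split => //=; rewrite subrK].
  by move=> [y _ [/= -> ->]]; rewrite addrK.
apply: fin_bigcup_measurable => // y _; exact: measurableI.
Qed.

(** The simple function s n is replaced by 0 where it exceeds 2 |f|. Where f t is nonzero the
    replacement eventually stops, because |s n t| tends to |f t| < 2 |f t|; where f t = 0 the new
    sequence is identically 0. *)
Lemma strong_approx X (f : T -> X) : strongly_measurable setT f ->
  exists s : nat -> T -> X, [/\ forall n, simple_function (s n),
    forall n t, `|s n t| <= 2 * `|f t| & forall t, s n t @[n --> \oo] --> f t].
Proof.
move=> sf; have [s ss sc] := sf.
pose A n : set T := [set t | `|s n t| <= 2 * `|f t|].
have mA n : measurable (A n).
  have m1 : measurable_fun setT (fun t => `|s n t| - 2 * `|f t|).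
    apply: measurable_funB.
      by apply: measurable_norm_strong; exact: strong_simple.
    by apply: measurable_funM => //; exact: measurable_norm_strong.
  have := m1 measurableT _ (measurable_itv `]-oo, 0]); rewrite setTI.
  congr (measurable _); apply/seteqP.
  by split => t; rewrite /A/= in_itv/= subr_le0.
exists (fun n => zext (A n) (s n)); split.
- by move=> n; exact: simple_zext.
- move=> n t; have [At|At] := pselect (A n t); first by rewrite zextE.
  by rewrite zextN// normr0 mulr_ge0.
- move=> t; have [ft0|ft0] := eqVneq (f t) 0.
    rewrite (_ : (fun n => _) = cst 0) ?ft0; first exact: cvg_cst.
    apply/funext => n; rewrite /zext; case: pselect => // .
    by rewrite /A/= ft0 normr0 mulr0 normr_le0 => /eqP.
  have fc : `|s n t| @[n --> \oo] --> `|f t| by apply: cvg_norm; exact: sc.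
  have f2 : `|f t| < 2 * `|f t| by rewrite ltr_pMl ?ltr1n// normr_gt0.
  have := cvgr_lt _ fc _ f2 => nf.
  apply: cvg_trans (sc t I); apply: near_eq_cvg.
  have [N _ hN] := nf; exists N => // n Nn.
  by rewrite zextE// /A/= ltW// hN.
Qed.

(* The exceptional null set of [P x] may depend on x, but the approximating
   simple functions only take countably many values. *)
Lemma strong_dense_ae (mu : {measure set T -> \bar R}) X (f : T -> X) (P : X -> T -> Prop) :
  strongly_measurable setT f -> (forall x, {ae mu, forall t, P x t}) ->
  {ae mu, forall t, exists2 s : nat -> X, (forall n, P (s n) t) & s n @[n --> \oo] --> f t}.
Proof.
move=> [s ss sf] aeP.
have /choice[q qE] : forall n, exists q : seq X, range (s n) = [set` q].
  by move=> n; have [/finite_seqP] := ss n.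
have : {ae mu, forall t, forall n k, P (nth 0 (q n) k) t}.
  by apply: ae_foralln => n; apply: ae_foralln => k; exact: aeP.
apply: aeS => t h; exists (fun n => s n t); last exact: sf.
move=> n; have : range (s n) (s n t) by exists t.
by rewrite qE/= => /(nthP 0)[k _ <-].
Qed.

End strong_measurability.

(** * Bounded functionals and the Bochner integral *)

Section bochner_functional.
Context d (T : measurableType d) (R : realType) (X : normedModType R).
Variable mu : {measure set T -> \bar R}.
Variables (l : X -> R) (C : R).
Hypothesis llin : forall (a : R) x y, l (a *: x + y) = a * l x + l y.
Hypothesis C0 : 0 <= C.
Hypothesis lC : forall x, `|l x| <= C * `|x|.

Let l0 : l 0 = 0.
Proof. by have := llin (-1) 0 0; rewrite scaler0 addr0 mulN1r addNr. Qed.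

Let lB x y : l x - l y = l (x - y).
Proof. by rewrite [x - y]addrC -[- y]scaleN1r llin mulN1r addrC. Qed.

Let lcvg (x_ : nat -> X) x : x_ n @[n --> \oo] --> x -> l (x_ n) @[n --> \oo] --> l x.
Proof.
move=> xc; apply/cvgrPdist_le => e e0.
(* Here and below C + 1 replaces C in denominators, as C may be 0. *)
have e1 : 0 < e / (C + 1) by rewrite divr_gt0// ltr_wpDl.
have /cvgrPdist_le/(_ _ e1)[N _ hN] := xc; exists N => // n Nn.
rewrite lB (le_trans (lC _))//; have := hN _ Nn; rewrite /= => h.
apply: (@le_trans _ _ ((C + 1) * `|x - x_ n|)); first by rewrite ler_wpM2r// lerDl.
by rewrite mulrC -ler_pdivlMr// ltr_wpDl.
Qed.

Lemma measurable_functional (F : T -> X) : strongly_measurable setT F ->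
  measurable_fun setT (fun t => l (F t)).
Proof.
move=> sF; apply: (@measurable_strong _ _ _ X X F F (fun x _ => l x)) => //.
by move=> x_ y_ x y xc _; exact: lcvg.
Qed.

(** Finiteness of [mu A] makes every [fine] in [simple_integral] exact. *)
Lemma simple_integral_functional (A : set T) (s : T -> X) : measurable A ->
  (mu A < +oo)%E -> simple_function s ->
  l (simple_integral mu A s) = \int[mu]_(t in A) l (s t).
Proof.
move=> mA muA [fs ms]; rewrite /simple_integral fsbig_finite//=.
pose r : seq X := finmap.enum_fset (fset_set (range s)).
rewrite -[finmap.enum_fset _]/r.
have ur : uniq r by exact: finmap.fset_uniq.
have rs t : s t \in r.
  have : s t \in fset_set (range s) by rewrite in_fset_set//; apply/mem_set; exists t.
  exact.
have lsum (q : seq X) (c : X -> R) :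
    l (\sum_(x <- q) c x *: x) = \sum_(x <- q) c x * l x.
  elim: q => [|x q IH]; first by rewrite !big_nil l0.
  by rewrite !big_cons llin IH.
rewrite lsum.
have lE t : l (s t) = \sum_(x <- r) l x * \1_(s @^-1` [set x]) t.
  rewrite (bigD1_seq (s t))//=.
  rewrite indicE mem_set// mulr1 big1 ?addr0// => x xs.
  by rewrite indicE memNset ?mulr0// => /= sx; move/eqP: xs; rewrite sx.
have ii x : mu.-integrable A (EFin \o \1_(s @^-1` [set x])).
  apply/integrableP; split.
    by apply/measurable_EFinP; exact: measurable_indic.
  under eq_integral do rewrite /= ger0_norm//.
  rewrite integral_indic//; apply: le_lt_trans muA.
  by apply: le_measure; [apply/mem_set; exact: measurableI|exact/mem_set|exact: subIsetr].
rewrite /Rintegral.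
have -> : (\int[mu]_(t in A) (l (s t))%:E =
    \int[mu]_(t in A) \sum_(x <- r) (l x)%:E * (\1_(s @^-1` [set x]) t)%:E)%E.
  apply: eq_integral => t _; rewrite lE -sumEFin.
  by apply: eq_bigr => x _; rewrite EFinM.
rewrite integral_sum//; last by move=> x; exact: (integrableZl mA (l x) (ii x)).
have mfin x : mu (A `&` s @^-1` [set x]) \is a fin_num.
  rewrite ge0_fin_numE//; apply: le_lt_trans muA.
  by apply: le_measure; [apply/mem_set; exact: measurableI|exact/mem_set|exact: subIsetl].
rewrite (eq_bigr (fun x => (fine (mu (A `&` s @^-1` [set x])) * l x)%:E)).
  by rewrite sumEFin.
move=> x _; rewrite (integralZl mA (ii x)).
rewrite [X in (_ * X)%E](_ : _ = mu (s @^-1` [set x] `&` A)); last exact: integral_indic.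
by rewrite EFinM fineK// muleC setIC.
Qed.

(** It reduces Bochner integrals in the dual space to scalar integrals, with l the evaluation at a
    vector of V. The integrals of l (s n) converge to both sides. *)
Lemma bochner_functional (A : set T) (F : T -> X) (I : X) : measurable A ->
  (mu A < +oo)%E -> is_bochner_integral mu A F I ->
  mu.-integrable A (fun t => (l (F t))%:E) /\ \int[mu]_(t in A) l (F t) = l I.
Proof.
move=> mA muA [sF [s [ss si sF0 sI]]].
pose F0 := zext A F; have sF0' : strongly_measurable setT F0 by exact: strong_zext.
have F0E t : A t -> F0 t = F t by move=> At; rewrite /F0 zextE.
have mdist n : measurable_fun A (fun t => `|F t - s n t|%:E).
  have := measurable_dist_strong sF0' (strong_simple (ss n)) => m1.
  apply/measurable_EFinP; apply: (eq_measurable_fun (fun t => `|F0 t - s n t|)).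
    by move=> t /set_mem At; rewrite F0E.
  exact: measurable_funTS.
have mlF : measurable_fun A (fun t => (l (F t))%:E).
  have := measurable_functional sF0' => m1.
  apply/measurable_EFinP; apply: (eq_measurable_fun (fun t => l (F0 t))).
    by move=> t /set_mem At; rewrite F0E.
  exact: measurable_funTS.
have mls n : measurable_fun A (fun t => (l (s n t))%:E).
  apply/measurable_EFinP/measurable_funTS/measurable_functional.
  exact: strong_simple.
have mns n : measurable_fun A (fun t => `|s n t|%:E).
  apply/measurable_EFinP/measurable_funTS/measurable_norm_strong.
  exact: strong_simple.
have ils n : mu.-integrable A (fun t => (l (s n t))%:E).
  apply/integrableP; split => //.
  apply: (@le_lt_trans _ _ (\int[mu]_(t in A) (C%:E * `|s n t|%:E))%E).
    apply: ge0_le_integral => //.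
    - exact: measurableT_comp.
    - exact: emeasurable_funM.
    - by move=> t _; rewrite -EFinM lee_fin.
  rewrite ge0_integralZl//.
  by apply: lte_mul_pinfty; [rewrite lee_fin|by []|exact: si].
have diff_le n : (\int[mu]_(t in A) `|(l (F t))%:E - (l (s n t))%:E| <=
    C%:E * \int[mu]_(t in A) `|F t - s n t|%:E)%E.
  rewrite -ge0_integralZl//.
  apply: ge0_le_integral => //.
  - by apply: measurableT_comp => //; exact: emeasurable_funB.
  - exact: emeasurable_funM.
  - by move=> t _; rewrite -EFinB -EFinM lee_fin lB.
have small e : 0 < e -> \forall n \near \oo,
    (\int[mu]_(t in A) `|F t - s n t|%:E < e%:E)%E.
  move=> e0; have h : \forall z \near (0 : \bar R), (z < e%:E)%E.
    by apply: open_ereal_lt'; rewrite lte_fin.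
  exact: (sF0 _ h).
have ilF : mu.-integrable A (fun t => (l (F t))%:E).
  have [N _ /(_ N (leqnn N)) hN] := small 1 ltr01.
  have iB : mu.-integrable A (fun t => (l (F t))%:E - (l (s N t))%:E)%E.
    apply/integrableP; split; first exact: emeasurable_funB.
    apply: le_lt_trans (diff_le N) _; apply: lte_mul_pinfty; [by rewrite lee_fin|by []|].
    exact: lt_trans hN (ltry _).
  have := integrableD mA iB (ils N); apply: eq_integrable => // t _ /=.
  by rewrite -?EFinB -?EFinD subrK.
split => //.
apply: (@cvg_unique _ (@norm_hausdorff _ R^o) (l (simple_integral mu A (s n)) @[n --> \oo])); last exact: lcvg.
apply/cvgrPdist_le => e e0.
have e1 : 0 < e / (C + 1) by rewrite divr_gt0// ltr_wpDl.
have [N _ hN] := small _ e1; exists N => // n /hN {}hN /=.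
rewrite simple_integral_functional// -RintegralB//; last exact: ils.
rewrite -lee_fin EFin_normr_Rintegral//; last first.
  by have := integrableB mA ilF (ils n); apply: eq_integrable.
apply: le_trans (le_abse_integral _ _ _) _ => //.
  by under eq_fun do rewrite EFinB; exact: emeasurable_funB.
under eq_integral do rewrite EFinB.
apply: le_trans (diff_le n) _.
apply: (@le_trans _ _ ((C + 1)%:E * \int[mu]_(t in A) `|F t - s n t|%:E)%E).
  by rewrite lee_wpmul2r ?integral_ge0// lee_fin lerDl.
apply: (@le_trans _ _ ((C + 1)%:E * (e / (C + 1))%:E)%E).
  by rewrite lee_wpmul2l// ?lee_fin ?addr_ge0// ltW.
by rewrite -EFinM lee_fin mulrC divfK// gt_eqF// ltr_wpDl.
Qed.

End bochner_functional.

(** * L^2 and L^oo functions with values in a normed space *)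

Section bochner_spaces.
Context {R : realType}.
Local Notation mu := (@lebesgue_measure R).

Lemma integral_mrestr d (S : measurableType d) (m : {measure set S -> \bar R})
    (D : set S) (mD : measurable D) (F : S -> \bar R) :
  (\int[mrestr m mD]_x F x = \int[m]_(x in D) F x)%E.
Proof.
transitivity (\int[mrestr m mD]_(x in D) F x)%E.
  rewrite [RHS]integral_mkcond.
  apply: (integral_null_eq (N := ~` D)); first exact: measurableC.
    by rewrite [LHS](_ : _ = m (~` D `&` D))// setICl measure0.
  by move=> x _ /contrapT Dx; rewrite patchE mem_set.
apply: eq_measure_integral => A mA AD.
by rewrite [LHS](_ : _ = m (A `&` D))// setIidl.
Qed.

Lemma ae_mrestr d (S : measurableType d) (m : {measure set S -> \bar R})
    (D : set S) (mD : measurable D) (P : S -> Prop) :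
  {ae mrestr m mD, forall x, P x} -> {ae m, forall x, D x -> P x}.
Proof.
move=> [N [mN N0 NP]]; exists (N `&` D); split => //; first exact: measurableI.
move=> x /= /not_implyP[Dx Px]; split => //; exact: NP.
Qed.

Variable X : normedModType R.

Lemma bochner_L2 (T : R) (f : measurableTypeR R -> X) : bochner_Lp 2%:E T f ->
  strongly_measurable `]0, T[ f /\
  (\int[mu]_(t in `]0%R, T[) (`|f t| ^+ 2)%:E < +oo)%E.
Proof.
move=> [sf]; rewrite /finite_norm unlock /Lnorm /time_measure integral_mrestr => h.
split => //.
have -> : (\int[mu]_(t in `]0%R, T[) (`|f t| ^+ 2)%:E =
    \int[mu]_(t in `]0%R, T[) (`|(EFin \o (fun t => `|f t|%R)) t| `^ 2%:R)%E)%E.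
  apply: eq_integral => t _; rewrite /= ger0_norm//.
  by rewrite powR_mulrn.
by apply: lty_poweRy h; rewrite invr_neq0.
Qed.

Lemma bochner_Loo (T : R) (f : measurableTypeR R -> X) : 0 < T -> bochner_Lp +oo%E T f ->
  strongly_measurable `]0, T[ f /\
  exists2 M : R, 0 <= M & {ae mu, forall t, 0 < t < T -> `|f t| <= M}.
Proof.
move=> T0 [sf]; rewrite /finite_norm unlock /Lnorm ifT; last first.
  rewrite [X in (_ < X)%E](_ : _ = mu (setT `&` `]0%R, T[%classic))//.
  by rewrite setTI lebesgue_measure_itv/= lte_fin T0 oppr0 adde0 lte_fin.
move=> h; split => //.
have := ess_sup_ge (time_measure T) (abse \o (EFin \o (fun t => `|f t|))).
set M := ess_sup _ _ in h * => /ae_mrestr ae.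
exists (Num.max 0 (fine M)); first by rewrite le_max lexx.
apply: (aeS _ ae) => t /= H tT.
have := H; rewrite in_itv/= => /(_ tT); rewrite normr_id.
rewrite le_max; case: M h {H ae} => [r _|//|_] /=; last by rewrite leeNy_eq.
by rewrite lee_fin => ->; rewrite orbT.
Qed.

Lemma strong_L2_approx (f : measurableTypeR R -> X) (e : R) : strongly_measurable setT f ->
  (\int[mu]_t (`|f t| ^+ 2)%:E < +oo)%E -> 0 < e ->
  exists2 s, simple_function s & (\int[mu]_t (`|f t - s t| ^+ 2)%:E <= e%:E)%E.
Proof.
move=> sf f2 e0; have [s [ss sle sc]] := strong_approx sf.
have mf : measurable_fun setT (fun t => `|f t|) := measurable_norm_strong sf.
have mfs n : measurable_fun setT (fun t => (`|f t - s n t| ^+ 2)%:E).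
  apply/measurable_EFinP; apply: measurable_funX.
  by apply: measurable_dist_strong => //; exact: strong_simple.
(* 9 = (1 + 2)^2, from |f - s n| <= |f| + 2 |f|. *)
have ig : mu.-integrable setT (fun t => (9 * `|f t| ^+ 2)%:E).
  have : mu.-integrable setT (fun t => (`|f t| ^+ 2)%:E).
    apply/integrableP; split; first by apply/measurable_EFinP; exact: measurable_funX.
    by under eq_integral do rewrite /= ger0_norm ?sqr_ge0//.
  by move/(integrableZl measurableT 9); apply: eq_integrable.
have [] := @dominated_convergence _ (measurableTypeR R) R mu setT measurableT
  (fun n t => (`|f t - s n t| ^+ 2)%:E) (cst 0%E) (fun t => (9 * `|f t| ^+ 2)%:E) mfs _ _ ig _ => //.
- apply: aeW => t _; apply: cvg_EFin; first exact: nearW.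
  rewrite /= -[X in _ --> X](expr0n _ 2); rewrite -(normr0 X) -(subrr (f t)).
  have h : `|f t - s n t| @[n --> \oo] --> `|f t - f t|.
    by apply: cvg_norm; apply: cvgB; [exact: cvg_cst|exact: sc].
  exact: (cvgM h h).
- apply: aeW => t n _; rewrite lee_fin ger0_norm ?sqr_ge0//.
  have h : `|f t - s n t| <= 3 * `|f t|.
    apply: le_trans (ler_normB _ _) _.
    rewrite (_ : 3 * `|f t| = `|f t| + 2 * `|f t|); last by ring.
    by rewrite lerD2l.
  rewrite (_ : 9 * `|f t| ^+ 2 = (3 * `|f t|) ^+ 2); last by ring.
  by rewrite ler_sqr ?nnegrE ?mulr_ge0.
rewrite integral0 => _ _ Hc.
have : \forall z \near (0 : \bar R), (z < e%:E)%E by apply: open_ereal_lt'; rewrite lte_fin.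
by move=> /Hc[n _ /(_ n (leqnn n))] /= h; exists (s n); rewrite ?ltW.
Qed.

End bochner_spaces.

(** * Weak derivatives of continuous functions *)

Section smooth_functions.
Context {R : realType}.
Implicit Types f g : R -> R.

(** Recursion through [derive1 f] turns closure under sums, products and affine substitutions into
    plain inductions. *)
Fixpoint Ck n f : Prop := if n is m.+1 then
  (forall x, derivable f x 1) /\ Ck m (derive1 f) else True.

Definition smooth f := forall n, Ck n f.

Lemma smooth_derivable_derive1n f : smooth f ->
  forall n t, derivable (derive1n n (f : R -> R^o)) t 1.
Proof.
have H n : forall f, Ck n.+1 f -> forall t, derivable (derive1n n (f : R -> R^o)) t 1.
  elim: n => [|n IH] g; first by case.
  move=> [_ /IH h] t; rewrite /derive1n iterSr; exact: h.
by move=> sf n t; apply: H; exact: sf.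
Qed.

Lemma Ck_le n f : Ck n.+1 f -> Ck n f.
Proof. by elim: n f => // n IH f [df /IH h]; split. Qed.

Lemma derive1_eq f g : (forall x : R, is_derive x (1 : R) f (g x)) -> derive1 f = g.
Proof. by move=> h; apply/funext => x; rewrite derive1E; apply: derive_val; exact: h. Qed.

Lemma Ck_is_derive n f g : (forall x : R, is_derive x (1 : R) f (g x)) -> Ck n g -> Ck n.+1 f.
Proof.
move=> h Cg; split; first by move=> x; apply: ex_derive; exact: h.
by rewrite (derive1_eq h).
Qed.

Lemma is_derive_derive1 f (x : R) : derivable f x 1 -> is_derive x (1 : R) f (derive1 f x).
Proof. by move=> df; apply: DeriveDef => //; rewrite derive1E. Qed.

Lemma CkD n f g : Ck n f -> Ck n g -> Ck n (fun x => f x + g x).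
Proof.
elim: n f g => // n IH f g [df Cf] [dg Cg].
apply: (@Ck_is_derive _ _ (fun x => derive1 f x + derive1 g x)); last exact: IH.
by move=> x; apply: is_deriveD; exact: is_derive_derive1.
Qed.

Lemma CkM n f g : Ck n f -> Ck n g -> Ck n (fun x => f x * g x).
Proof.
elim: n f g => // n IH f g Cf Cg; have [df Cf'] := Cf; have [dg Cg'] := Cg.
apply: (@Ck_is_derive _ _ (fun x => f x * derive1 g x + g x * derive1 f x)).
  by move=> x; apply: is_deriveM; exact: is_derive_derive1.
by apply: CkD; apply: IH => //; exact: Ck_le.
Qed.

Lemma Ck_cst n (c : R) : Ck n (fun=> c).
Proof.
elim: n c => // n IH c; exact: (@Ck_is_derive _ _ (fun=> 0)).
Qed.

Lemma is_derive_affine (a b x : R) : is_derive x (1 : R) (fun y : R => a * y + b) a.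
Proof.
have d1 : is_derive x (1 : R) (fun y : R => a *: y) (a *: 1) by apply: is_deriveZ.
have := is_deriveD d1 (is_derive_cst b x 1).
by rewrite addr0 /GRing.scale/= mulr1.
Qed.

Lemma Ck_affine n f (a b : R) : Ck n f -> Ck n (fun x => f (a * x + b)).
Proof.
elim: n f => // n IH f [df Cf].
apply: (@Ck_is_derive _ _ (fun x => derive1 f (a * x + b) * a)); last first.
  by apply: CkM; [exact: IH|exact: Ck_cst].
move=> x; apply: (@is_derive1_comp _ f (fun y => a * y + b)).
  exact: is_derive_derive1.
exact: is_derive_affine.
Qed.

(** The functions p(1/x) exp(-1/x), extended by 0, form a family closed under differentiation, so
    that smoothness is one induction over all p. *)
Definition flat (p : {poly R}) (x : R) : R :=
  if 0 < x then p.[x^-1] * expR (- x^-1) else 0.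

Lemma poly_exp_bounded (p : {poly R}) :
  exists2 C : R, 0 <= C & forall y, 0 <= y -> `|p.[y] * expR (- y)| <= C.
Proof.
(* A single term y^m / m! of the exponential series is below exp(y). *)
have mon m y : 0 <= y -> y ^+ m * expR (- y) <= m`!%:R.
  move=> y0; rewrite expRN ler_pdivrMr ?expR_gt0//.
  case: m => [|m]; first by rewrite expr0 fact0 mul1r -expR0 ler_expR.
  have := expR_ge1Dxn m y0; set z := y ^+ _ => h.
  rewrite mulrC -ler_pdivrMr ?ltr0n ?fact_gt0//; apply: le_trans h.
  by rewrite lerDr.
exists (\sum_(i < size p) `|p`_i| * i`!%:R); first by apply: sumr_ge0 => i _; rewrite mulr_ge0.
move=> y y0; rewrite horner_coef mulr_suml.
apply: le_trans (ler_norm_sum _ _ _) _; apply: ler_sum => i _.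
rewrite -mulrA normrM ler_wpM2l// ger0_norm; first exact: mon.
by rewrite mulr_ge0 ?exprn_ge0// expR_ge0.
Qed.

Lemma flat_le0 p x : x <= 0 -> flat p x = 0.
Proof. by move=> x0; rewrite /flat ltNge x0. Qed.

(** Quadratic decay at 0 makes the derivative there 0. It expresses that y^2 p(y) exp(-y) is
    bounded, with y = 1/x. *)
Lemma flat_sqr p : exists2 C : R, 0 <= C & forall x, `|flat p x| <= C * x ^+ 2.
Proof.
have [C C0 hC] := poly_exp_bounded ('X^2 * p); exists C => // x.
rewrite /flat; case: ifPn => x0; last by rewrite normr0 mulr_ge0 ?sqr_ge0.
have := hC x^-1; rewrite invr_ge0 (ltW x0) => /(_ isT).
rewrite hornerM hornerXn -mulrA normrM ger0_norm ?exprn_ge0 ?invr_ge0 ?(ltW x0)//.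
by rewrite exprVn mulrC ler_pdivrMr// exprn_gt0.
Qed.

Lemma is_derive_flat p (x : R) : is_derive x (1 : R) (flat p) (flat ('X^2 * (p - p^`())) x).
Proof.
have [x0|x0|->] := ltgtP x 0.
- rewrite [X in is_derive _ _ _ X]flat_le0 ?(ltW x0)//.
  have dc : is_derive x (1 : R) (cst 0 : R -> R) 0 by exact: is_derive_cst.
  apply: (near_eq_is_derive _ dc).
  near=> y; rewrite flat_le0//; apply: ltW; near: y; exact: lt_nbhsl.
- have xn0 : x != 0 by rewrite gt_eqF.
  have di : is_derive x (1 : R) (fun y : R => y^-1) (- x ^- 2).
    have := @is_deriveV _ id x 1 1 xn0 (is_derive_id _ _).
    by rewrite /GRing.scale/= mulr1.
  have dp := @is_derive1_comp _ (horner p) (fun y : R => y^-1) x _ _ (is_derive_poly p x^-1) di.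
  have de := @is_derive1_comp _ (@expR R) (fun y : R => - y^-1) x _ _ (is_derive_expR _) (is_deriveN di).
  have dpe := is_deriveM dp de.
  have nf : \near x, (horner p \o (fun y : R => y^-1)) x * (expR \o (fun y : R => - y^-1)) x = flat p x.
    near=> y; rewrite /flat ifT//; near: y; exact: lt_nbhsr.
  apply: (is_derive_eq (near_eq_is_derive nf dpe)); rewrite /flat x0.
  rewrite hornerM hornerXn hornerD hornerN exprVn /GRing.scale/=; ring.
- rewrite flat_le0//.
  have [C C0 hC] := flat_sqr p.
  have c0 : h^-1 *: (flat p (h *: 1 + 0) - flat p 0) @[h --> 0^'] --> (0 : R^o).
    apply/cvgrPdist_le => e e0.
    have eC : 0 < e / (C + 1) by rewrite divr_gt0// ltr_wpDl.
    near=> h.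
    have h0 : h != 0 by near: h; exact: nbhs_dnbhs_neq.
    rewrite sub0r normrN [flat p 0]flat_le0// subr0 addr0 /GRing.scale/= mulr1.
    rewrite normrM normfV mulrC ler_pdivrMr ?normr_gt0//.
    apply: le_trans (hC h) _; rewrite -real_normK ?num_real// expr2 mulrA ler_wpM2r//.
    apply: (@le_trans _ _ ((C + 1) * `|h|)); first by rewrite ler_wpM2r// lerDl.
    rewrite mulrC -ler_pdivlMr ?ltr_wpDl//.
    near: h; apply: dnbhs0_le; exact: eC.
  apply: DeriveDef; first by apply/cvg_ex; exists 0.
  exact: (cvg_lim (@Rhausdorff R) c0).
Unshelve. all: by end_near. Qed.

Lemma Ck_flat n p : Ck n (flat p).
Proof.
elim: n p => // n IH p; apply: Ck_is_derive (IH _); exact: is_derive_flat.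
Qed.

Definition bump (x : R) : R := flat 1 x * flat 1 ((-1) * x + 1).

Lemma Ck_bump n : Ck n bump.
Proof. by apply: CkM; [exact: Ck_flat|apply: Ck_affine; exact: Ck_flat]. Qed.

Lemma flat1_ge0 x : 0 <= flat 1 x.
Proof. by rewrite /flat; case: ifP => // _; rewrite hornerC mul1r expR_ge0. Qed.

Lemma bump_ge0 x : 0 <= bump x.
Proof. by rewrite mulr_ge0 ?flat1_ge0. Qed.

Lemma bump_gt0 x : 0 < x < 1 -> 0 < bump x.
Proof.
move=> /andP[x0 x1]; rewrite /bump /flat x0 ifT; last lra.
by rewrite !hornerC !mul1r mulr_gt0 ?expR_gt0.
Qed.

Lemma bump_out x : ~~ (0 < x < 1) -> bump x = 0.
Proof.
rewrite negb_and -!leNgt => /orP[x0|x1]; first by rewrite /bump flat_le0 ?mul0r.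
by rewrite /bump [X in _ * X]flat_le0 ?mulr0//; lra.
Qed.

Lemma continuous_bump : continuous bump.
Proof.
move=> x; apply: differentiable_continuous; apply/derivable1_diffP.
by have [] := Ck_bump 1.
Qed.

End smooth_functions.

(** * Smooth steps and approximate Dirac masses *)

Section smooth_step.
Context {R : realType}.
Local Notation mu := (@lebesgue_measure R).
Local Notation L1 a := (mu.-integrable setT (EFin \o a)).
Local Notation mT a := (measurable_fun [set: R] a).
Local Notation bump := (@bump R).

Let bumpE : bump = tcut 1 bump.
Proof.
by apply/funext => x; rewrite /tcut; case: ifPn => // /bump_out.
Qed.

Lemma measurable_bump : mT bump.
Proof. exact: continuous_measurable_fun continuous_bump. Qed.

Lemma L1_bump : L1 bump.
Proof.
rewrite bumpE; apply: L1_cut; apply: (@integrableS _ _ _ mu `[0, 1]%classic); [exact: measurable_itv|exact: measurable_itv|exact: subset_itv_oo_cc|].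
apply: continuous_compact_integrable; first exact: segment_compact.
by apply: continuous_subspaceT; exact: continuous_bump.
Qed.

Definition bump_mass : R := \int[mu]_x bump x.

Lemma bump_massE : (\int[mu]_x (bump x)%:E = bump_mass%:E)%E.
Proof. by rewrite /bump_mass /Rintegral fineK// integrable_fin_num// L1_bump. Qed.

Lemma bump_mass_gt0 : 0 < bump_mass.
Proof.
rewrite lt_neqAle Rintegral_ge0 ?andbT; last by move=> x _; exact: bump_ge0.
apply/eqP => h.
have h0 : (\int[mu]_x `|(bump x)%:E| = 0)%E.
  by under eq_integral do rewrite /= ger0_norm ?bump_ge0//; rewrite bump_massE -h.
have mb : measurable_fun setT (EFin \o bump) by apply/measurable_EFinP; exact: measurable_bump.
have /(ae_eq_integral_abs mu measurableT mb).1[N [mN N0 Nb]] := h0.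
have : (mu (`]0%R, 1%R[%classic : set R) <= mu N)%E.
  apply: le_measure; [apply: mem_set; exact: measurable_itv|exact: mem_set|].
  move=> x; rewrite /= in_itv/= => x01; apply: Nb => /= /(_ I) [].
  by apply/eqP; rewrite gt_eqF// bump_gt0.
by rewrite N0 lebesgue_measure_itv/= lte_fin ltr01 oppr0 adde0 lee_fin ler10.
Qed.

Definition step (x : R) : R := bump_mass^-1 * \int[mu]_(y in `]-oo, x]) bump y.

Lemma is_derive_step (x : R) : is_derive x (1 : R) step (bump_mass^-1 * bump x).
Proof.
have ib : mu.-integrable [set` Interval (BInfty R true) (BRight (x + 1))] (EFin \o bump).
  by apply: integrableS L1_bump => //; exact: measurable_itv.
have [] := @continuous_FTC1 R bump (BInfty R true) x (x + 1) _ ib _ (@continuous_bump R x).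
- by rewrite ltrDl.
- by rewrite ltNyr.
move=> dF F'; have := is_derive_derive1 dF; rewrite F' => d.
exact: (is_deriveZ bump_mass^-1 d).
Qed.

Lemma Ck_step n : Ck n step.
Proof.
case: n => // n; apply: Ck_is_derive; first exact: is_derive_step.
by apply: CkM; [exact: Ck_cst|exact: Ck_bump].
Qed.

Lemma step_le0 x : x <= 0 -> step x = 0.
Proof.
move=> x0; rewrite /step /Rintegral integral0_eq ?mulr0// => y.
rewrite /= in_itv/= => yx; rewrite bump_out// negb_and -leNgt (le_trans yx)//.
Qed.

Lemma step_ge1 x : 1 <= x -> step x = 1.
Proof.
move=> x1; rewrite /step (_ : \int[mu]_(y in `]-oo, x]) bump y = bump_mass).
  by rewrite mulVf// gt_eqF// bump_mass_gt0.
rewrite Rintegral_mkcond; apply: eq_Rintegral => y _; rewrite patchE.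
case: ifPn => // /negP h; rewrite bump_out//; apply/negP => /andP[y0 y1].
by apply: h; rewrite inE/= in_itv/= (le_trans (ltW y1)).
Qed.

Lemma step_ge0 x : 0 <= step x.
Proof.
rewrite mulr_ge0 ?invr_ge0 ?(ltW bump_mass_gt0)//.
by apply: Rintegral_ge0 => y _; exact: bump_ge0.
Qed.

Lemma step_le1 x : step x <= 1.
Proof.
rewrite /step mulrC ler_pdivrMr ?bump_mass_gt0// mul1r.
rewrite Rintegral_mkcond; apply: le_Rintegral => //.
- by rewrite -restrict_EFin; apply/integrable_restrict => //; rewrite setTI; apply: integrableS L1_bump => //; exact: measurable_itv.
- exact: L1_bump.
- by move=> y _; rewrite patchE; case: ifP => // _; exact: bump_ge0.
Qed.

(* A bump of unit mass supported in [a, a + 1 / (n + 1)]. *)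
Definition kap (n : nat) (a x : R) : R := n.+1%:R * (bump_mass^-1 * bump (n.+1%:R * (x - a))).

Lemma kap_ge0 n a x : 0 <= kap n a x.
Proof. by rewrite /kap mulr_ge0 ?ler0n// mulr_ge0 ?invr_ge0 ?bump_ge0 ?(ltW bump_mass_gt0). Qed.

Lemma measurable_kap n a : mT (kap n a).
Proof.
apply: measurable_funM => //; apply: measurable_funM => //.
apply: (measurableT_comp measurable_bump); apply: measurable_funM => //.
exact: measurable_funB.
Qed.

Lemma integral_kap n a : (\int[mu]_x (kap n a x)%:E = 1%:E)%E.
Proof.
have n0 : 0 < n.+1%:R :> R by [].
pose F (x : R) := (bump (n.+1%:R * x))%:E.
have mF : mT F.
  apply/measurable_EFinP; apply: (measurableT_comp measurable_bump).
  exact: measurable_funM.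
transitivity ((n.+1%:R / bump_mass)%:E * \int[mu]_x F (x - a)%R)%E.
  rewrite -ge0_integralZl//.
  - by apply: eq_integral => x _; rewrite /F -EFinM /kap mulrA.
  - by apply: (measurableT_comp mF); exact: measurable_funB.
  - by move=> x _; rewrite lee_fin bump_ge0.
  - by rewrite lee_fin divr_ge0 ?(ltW bump_mass_gt0).
rewrite integral_shift// (ge0_integral_scale (f := EFin \o bump))//.
- rewrite bump_massE -!EFinM; congr EFin.
  by rewrite mulrACA divff ?mulVf ?mulr1 ?gt_eqF// bump_mass_gt0.
- by apply/measurable_EFinP; exact: measurable_bump.
- by move=> x; rewrite lee_fin bump_ge0.
Qed.

Lemma L1_kap n a : L1 (kap n a).
Proof.
apply/integrableP; split; first by apply/measurable_EFinP; exact: measurable_kap.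
under eq_integral do rewrite /= ger0_norm ?kap_ge0//.
by rewrite integral_kap ltry.
Qed.

Lemma kap_out n a x : ~~ (a < x < a + n.+1%:R^-1) -> kap n a x = 0.
Proof.
move=> h; rewrite /kap bump_out ?mulr0//; apply: contra h => /andP[h1 h2].
have n0 : 0 < n.+1%:R :> R by [].
move: h1; rewrite pmulr_rgt0// subr_gt0 => ->/=.
by move: h2; rewrite mulrC -ltr_pdivlMr// div1r ltrBlDl.
Qed.

Lemma kap_cvg (a T : R) (k : R -> R) : 0 < a < T -> L1 (tcut T k) ->
  {for a, continuous k} ->
  \int[mu]_(x in `]0, T[) (kap n a x * k x) @[n --> \oo] --> k a.
Proof.
move=> /andP[a0 aT] ik ck; apply/cvgrPdist_le => e e0.
have /cvgrPdist_le/(_ _ e0) := ck => /nbhs_ballP[d /= d0 hd].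
have m0 : 0 < Num.min d (T - a) by rewrite lt_min d0 subr_gt0.
have [N _ hN] := near_infty_natSinv_lt (PosNum m0).
exists N => // n /hN; rewrite /= lt_min => /andP[nd nT].
have mk := L1_mT ik.
have -> : \int[mu]_(x in `]0, T[) (kap n a x * k x) = \int[mu]_x (kap n a x * tcut T k x).
  rewrite Rintegral_mkcond; apply: eq_Rintegral => x _.
  by rewrite cut_restrict !patchE; case: ifP; rewrite ?mulr0.
have kd x : `|kap n a x * (tcut T k x - k a)| <= kap n a x * e.
  have [h|h] := boolP (a < x < a + n.+1%:R^-1); last first.
    by rewrite kap_out// !mul0r normr0.
  rewrite normrM ger0_norm ?kap_ge0// ler_wpM2l ?kap_ge0//.
  case/andP: h => h1 h2; rewrite cutE; last first.
    by rewrite (lt_trans a0 h1)/= (lt_trans h2)// -ltrBrDl.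
  rewrite distrC; apply: hd; rewrite -ball_normE/= distrC gtr0_norm ?subr_gt0//.
  by rewrite (lt_trans _ nd)// ltrBlDl.
have m1 : mT (fun x => kap n a x * (tcut T k x - k a)).
  by apply: measurable_funM; [exact: measurable_kap|exact: measurable_funB].
have ike : mu.-integrable setT (fun x => (kap n a x * e)%:E).
  by have := integrableZr measurableT e (L1_kap n a); apply: eq_integrable.
have ikk : L1 (fun x => kap n a x * (tcut T k x - k a)).
  apply: le_integrable ike => //; first exact/measurable_EFinP.
  move=> x _; rewrite lee_fin [X in _ <= X]ger0_norm//.
  by rewrite mulr_ge0 ?kap_ge0// ltW.
have ika : L1 (fun x => k a * kap n a x).
  by have := integrableZl measurableT (k a) (L1_kap n a); apply: eq_integrable.
have -> : \int[mu]_x (kap n a x * tcut T k x) =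
    \int[mu]_x (kap n a x * (tcut T k x - k a)) + k a * \int[mu]_x kap n a x.
  rewrite -RintegralZl//; last exact: L1_kap.
  rewrite -(RintegralD measurableT ikk ika).
  by apply: eq_Rintegral => x _; ring.
have K1 : \int[mu]_x kap n a x = 1 by rewrite /Rintegral integral_kap.
rewrite K1 mulr1 opprD addrCA subrr addr0 normrN.
apply: le_trans (le_normr_Rintegral measurableT ikk) _.
apply: (@le_trans _ _ (\int[mu]_x (kap n a x * e))).
  apply: le_Rintegral => //.
  exact: integrable_norm.
by rewrite RintegralZr ?K1 ?mul1r//; exact: L1_kap.
Qed.

End smooth_step.

(** * The lemma of du Bois-Reymond *)

Section du_bois_reymond.
Context {R : realType}.
Local Notation mu := (@lebesgue_measure R).
Local Notation L1 a := (mu.-integrable setT (EFin \o a)).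
Local Notation mT a := (measurable_fun [set: R] a).

Definition plateau (n : nat) (a b x : R) : R :=
  step (n.+1%:R * (x - a)) - step (n.+1%:R * (x - b)).

Lemma Ck_plateau n a b m : Ck m (plateau n a b).
Proof.
have -> : plateau n a b = (fun x => step (n.+1%:R * x + - (n.+1%:R * a)) +
    (-1) * step (n.+1%:R * x + - (n.+1%:R * b))).
  by apply/funext => x; rewrite /plateau mulN1r; congr (step _ - step _); ring.
apply: CkD; first exact: Ck_affine (Ck_step m).
apply: CkM; first exact: Ck_cst.
exact: Ck_affine (Ck_step m).
Qed.

Lemma derive1_plateau n a b : derive1 (plateau n a b) = (fun x => kap n a x - kap n b x).
Proof.
apply: derive1_eq => x.
have d c : is_derive x (1 : R) (fun y => step (n.+1%:R * (y - c))) (kap n c x).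
  have -> : (fun y => step (n.+1%:R * (y - c))) =
      step \o (fun y => n.+1%:R * y + - (n.+1%:R * c)).
    by apply/funext => y /=; congr step; ring.
  have := @is_derive1_comp _ step (fun y => n.+1%:R * y + - (n.+1%:R * c)) x _ _
    (is_derive_step _) (is_derive_affine _ _ _).
  move=> dd; apply: (is_derive_eq dd); rewrite /kap.
  rewrite (_ : n.+1%:R * x + - (n.+1%:R * c) = n.+1%:R * (x - c)); last by ring.
  by rewrite mulrC.
exact: (is_deriveB (d a) (d b)).
Qed.

Lemma plateau_le1 n a b x : `|plateau n a b x| <= 1.
Proof.
rewrite ler_norml; have := step_ge0 (n.+1%:R * (x - a)); have := step_le1 (n.+1%:R * (x - a)).
have := step_ge0 (n.+1%:R * (x - b)); have := step_le1 (n.+1%:R * (x - b)).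
by rewrite /plateau => h1 h2 h3 h4; apply/andP; split; lra.
Qed.

Lemma plateau_out n a b x : a < b -> ~~ (a <= x <= b + n.+1%:R^-1) -> plateau n a b x = 0.
Proof.
move=> ab; have n0 : 0 < n.+1%:R :> R by [].
rewrite negb_and -!ltNge => /orP[xa|bx].
  by rewrite /plateau !step_le0 ?subrr// pmulr_rle0// subr_le0 ltW// (lt_trans xa).
have h c : c <= b -> 1 <= n.+1%:R * (x - c).
  move=> cb; rewrite mulrC -ler_pdivrMr// div1r lerBrDl.
  by rewrite ltW// (le_lt_trans _ bx)// lerD2r.
by rewrite /plateau !step_ge1 ?subrr// h// ltW.
Qed.

Lemma test_plateau n a b T : 0 < a -> a < b -> b + n.+1%:R^-1 < T ->
  test_function T (plateau n a b).
Proof.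
move=> a0 ab bT; split.
  by apply: smooth_derivable_derive1n => m; exact: Ck_plateau.
exists a, (b + n.+1%:R^-1); split => // t.
by rewrite in_itv/=; exact: plateau_out.
Qed.

(** The interval is open at a and closed at b because [step] is evaluated at 0, where it vanishes,
    when x is either end point. *)
Lemma plateau_cvg a b x : a < b ->
  plateau n a b x @[n --> \oo] --> (if a < x <= b then 1 else 0 : R).
Proof.
move=> ab.
have sc c : step (n.+1%:R * (x - c)) @[n --> \oo] --> (if c < x then 1 else 0 : R).
  case: ifPn => h; last first.
    under eq_fun do rewrite step_le0 ?pmulr_rle0 ?subr_le0 ?leNgt ?h//.
    exact: cvg_cst.
  apply: cvg_near_cst.
  have m0 : 0 < x - c by rewrite subr_gt0.
  have [N _ hN] := near_infty_natSinv_lt (PosNum m0).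
  exists N => // n /hN /= nx; rewrite step_ge1//.
  have n0 : 0 < n.+1%:R :> R by [].
  by rewrite mulrC -ler_pdivrMr// div1r ltW.
rewrite (_ : (if a < x <= b then 1 else 0) =
  (if a < x then 1 else 0) - (if b < x then 1 else 0) :> R).
  by apply: cvgB; exact: sc.
have [ax|xa] := ltP a x; have [bx|xb] := ltP b x => //=; rewrite ?subrr ?subr0//.
by move: (lt_le_trans bx xa); rewrite ltNge (ltW ab).
Qed.

(* Test with smooth plateaus approximating the indicator of (a, b), whose
   derivative is an approximate Dirac mass at a minus one at b. *)
Lemma weak_primitive (T : R) (k f : R -> R) : 0 < T ->
  {within `[0, T], continuous k} -> k 0 = 0 -> L1 (tcut T f) ->
  (forall phi, test_function T phi ->
    \int[mu]_(t in `]0, T[) (derive1 phi t * k t) =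
    - \int[mu]_(t in `]0, T[) (phi t * f t)) ->
  forall b, 0 < b < T -> k b = \int[mu]_s tcut b f s.
Proof.
move=> T0 ck k0 itf weak.
have ckin x : 0 < x < T -> {for x, continuous k}.
  move=> xT; move/(continuous_within_itvP _ T0) : ck => [h _ _].
  by apply: h; rewrite in_itv.
have ik : L1 (tcut T k).
  apply: L1_cut; apply: (@integrableS _ _ _ mu `[0, T]%classic); [exact: measurable_itv|exact: measurable_itv|exact: subset_itv_oo_cc|].
  by apply: continuous_compact_integrable => //; exact: segment_compact.
have mf := L1_mT itf.
have mk := L1_mT ik.
have main a b : 0 < a -> a < b -> b < T ->
    k b - k a = \int[mu]_s (if a < s <= b then tcut T f s else 0).
  move=> a0 ab bT.
  have aT : 0 < a < T by rewrite a0 (lt_trans ab).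
  have bT' : 0 < b < T by rewrite (lt_trans a0).
  have c1 := kap_cvg aT ik (ckin _ aT).
  have c2 := kap_cvg bT' ik (ckin _ bT').
  have c3 : \int[mu]_(t in `]0, T[) (plateau n a b t * f t) @[n --> \oo] -->
      \int[mu]_s (if a < s <= b then tcut T f s else 0).
    have mpl n : mT (plateau n a b).
      apply: continuous_measurable_fun => x; apply: differentiable_continuous.
      by apply/derivable1_diffP; have [] := Ck_plateau n a b 1.
    have mpf n : measurable_fun setT (fun t : measurableTypeR R => (plateau n a b t * tcut T f t)%:E).
      by apply/measurable_EFinP; exact: (measurable_funM (mpl n) mf).
    have mlim : measurable_fun setT (fun s : measurableTypeR R => (if a < s <= b then tcut T f s else 0)%:E).
      apply/measurable_EFinP; apply: measurable_fun_ifT => //.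
      apply: measurable_and; first exact: measurable_fun_ltr.
      exact: measurable_fun_ler.
    have iab : mu.-integrable setT (fun t => (`|tcut T f t|)%:E).
      by have := integrable_norm itf; apply: eq_integrable.
    have [] := @dominated_convergence _ (measurableTypeR R) R mu setT measurableT
      (fun n t => (plateau n a b t * tcut T f t)%:E)
      (fun s => (if a < s <= b then tcut T f s else 0)%:E)
      (fun t => (`|tcut T f t|)%:E) mpf mlim _ iab _.
    - apply: aeW => t _; apply: cvg_EFin; first exact: nearW.
      rewrite /= (_ : (if _ then _ else _) = (if a < t <= b then 1 else 0) * tcut T f t).
        by apply: cvgMl; exact: plateau_cvg.
      by case: ifP; rewrite ?mul1r ?mul0r.
    - apply: aeW => t n _ /=; rewrite lee_fin normrM ler_piMl//.
      exact: plateau_le1.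
    move=> ilim _ H.
    have -> : (fun n => \int[mu]_(t in `]0, T[) (plateau n a b t * f t)) =
        (fun n => \int[mu]_t (plateau n a b t * tcut T f t)).
      apply/funext => n; rewrite Rintegral_mkcond; apply: eq_Rintegral => t _.
      by rewrite cut_restrict !patchE; case: ifP; rewrite ?mulr0.
    rewrite /Rintegral; apply: fine_cvg.
    by rewrite fineK// integrable_fin_num.
  have m0 : 0 < T - b by rewrite subr_gt0.
  have [N _ hN] := near_infty_natSinv_lt (PosNum m0).
  have e n : (N <= n)%N -> \int[mu]_(x in `]0, T[) (kap n a x * k x) -
      \int[mu]_(x in `]0, T[) (kap n b x * k x) =
      - \int[mu]_(t in `]0, T[) (plateau n a b t * f t).
    move=> /hN /= nT; rewrite -weak; last first.
      by apply: test_plateau => //; rewrite -ltrBrDl.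
    have ikk c : mu.-integrable `]0, T[ (EFin \o (fun x => kap n c x * k x)).
      have m1 : mT (fun x => kap n c x * tcut T k x).
        by apply: measurable_funM => //; exact: measurable_kap.
      have [M M0 hM] : exists2 M, 0 <= M & forall x, `|kap n c x| <= M.
        have cpt : compact ((@bump R : R^o -> R^o) @` `[0, 1]).
          apply: continuous_compact; last exact: segment_compact.
          by apply: continuous_subspaceT; exact: continuous_bump.
        have /pinfty_ex_gt0[M0 M00 fM0] := compact_bounded cpt.
        exists (n.+1%:R * ((@bump_mass R)^-1 * M0)).
          by rewrite mulr_ge0// mulr_ge0 ?invr_ge0 ?(ltW bump_mass_gt0)// ltW.
        move=> x; rewrite ger0_norm ?kap_ge0// /kap.
        rewrite ler_wpM2l// ler_wpM2l ?invr_ge0 ?(ltW bump_mass_gt0)//.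
        set y := _ * (x - c); have [y01|y01] := boolP (0 < y < 1); last first.
          by rewrite bump_out// ltW.
        apply: le_trans (ler_norm _) _; apply: fM0; exists y => //=.
        by rewrite in_itv/=; case/andP: y01 => h1 h2; rewrite !ltW.
      have : L1 (fun x => kap n c x * tcut T k x).
        have ikM : mu.-integrable setT (fun x => (M * `|tcut T k x|)%:E).
          have := integrableZl measurableT M (integrable_norm ik).
          by apply: eq_integrable.
        apply: le_integrable ikM => //; first exact/measurable_EFinP.
        move=> x _; rewrite lee_fin normrM [X in _ <= X]ger0_norm ?mulr_ge0//.
        by rewrite ler_wpM2r.
      move/(@integrableS _ _ _ mu setT `]0, T[%classic _ measurableT (measurable_itv _) (@subsetT _ _)).
      apply: eq_integrable; first exact: measurable_itv.
      by move=> x; rewrite inE/= in_itv/= => xT; rewrite cutE.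
    rewrite -RintegralB//.
    apply: eq_Rintegral => x _; rewrite derive1_plateau; ring.
  have c12 : \int[mu]_(x in `]0, T[) (kap n a x * k x) -
      \int[mu]_(x in `]0, T[) (kap n b x * k x) @[n --> \oo] --> k a - k b.
    exact: cvgB c1 c2.
  have c12' : \int[mu]_(x in `]0, T[) (kap n a x * k x) -
      \int[mu]_(x in `]0, T[) (kap n b x * k x) @[n --> \oo] -->
      - \int[mu]_s (if a < s <= b then tcut T f s else 0).
    apply: cvg_trans (cvgN c3); apply: near_eq_cvg; exists N => // n Nn.
    exact: (esym (e n Nn)).
  have E : k a - k b = - \int[mu]_s (if a < s <= b then tcut T f s else 0).
    exact: (cvg_unique (@Rhausdorff R) c12 c12').
  by rewrite -opprB E opprK.
move=> b /andP[b0 bT].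
(* Test functions are supported strictly inside (0, T), so the left end tends to 0 only now, by
   continuity of k at 0 and k 0 = 0. The denominator starts at 2 to keep a n < b. *)
pose a n : R := b / n.+2%:R.
have a0 n : 0 < a n by rewrite divr_gt0.
have ab n : a n < b by rewrite /a ltr_pdivrMr// ltr_pMr// ltr1n.
have acvg : a n @[n --> \oo] --> 0.
  rewrite -(mulr0 b); apply: cvgMr.
  have := @cvg_harmonic R; rewrite -(cvg_shiftn 1%N).
  by under eq_fun do rewrite /harmonic addn1.
have kc : k (a n) @[n --> \oo] --> (0 : R).
  move/(continuous_within_itvP _ T0) : ck => [_ h _].
  rewrite -k0; apply: ((cvg_at_rightP k 0 (k 0)).1 h a); split => //.
have c1 : k b - k (a n) @[n --> \oo] --> k b.
  by rewrite -[X in _ --> X]subr0; apply: cvgB => //; exact: cvg_cst.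
have c2 : k b - k (a n) @[n --> \oo] --> \int[mu]_s tcut b f s.
  have -> : (fun n => k b - k (a n)) =
      (fun n => \int[mu]_s (if a n < s <= b then tcut T f s else 0)).
    by apply/funext => n; exact: main.
  have mlim n : measurable_fun setT (fun s : measurableTypeR R => (if a n < s <= b then tcut T f s else 0)%:E).
    apply/measurable_EFinP; apply: measurable_fun_ifT => //.
    apply: measurable_and; first exact: measurable_fun_ltr.
    exact: measurable_fun_ler.
  (* The two integrands differ at s = b at most. *)
  have -> : \int[mu]_s tcut b f s = \int[mu]_s (if 0 < s <= b then tcut T f s else 0).
    congr fine; apply: integral_ae_congr; exists [set b]; split => //.
      exact: lebesgue_measure_set1.
    move=> s /= h; apply: contrapT => sb; apply: h => _; congr EFin.
    rewrite /tcut; have [s0|s0] := ltP 0 s => //=.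
    have [sb'|bs] := ltP s b.
      by rewrite (ltW sb') (lt_trans sb' bT).
    case: ifP => // sb'; exfalso; apply: sb; apply/eqP.
    by rewrite eq_le bs sb'.
  have mlim0 : measurable_fun setT (fun s : measurableTypeR R => (if 0 < s <= b then tcut T f s else 0)%:E).
    apply/measurable_EFinP; apply: measurable_fun_ifT => //.
    apply: measurable_and; first exact: measurable_fun_ltr.
    exact: measurable_fun_ler.
  have iab : mu.-integrable setT (fun t => (`|tcut T f t|)%:E).
    by have := integrable_norm itf; apply: eq_integrable.
  have [] := @dominated_convergence _ (measurableTypeR R) R mu setT measurableT
    (fun n s => (if a n < s <= b then tcut T f s else 0)%:E)
    (fun s => (if 0 < s <= b then tcut T f s else 0)%:E)
    (fun t => (`|tcut T f t|)%:E) mlim mlim0 _ iab _.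
  - apply: aeW => t _; apply: cvg_EFin; first exact: nearW.
    rewrite /=; apply: cvg_near_cst; have [t0|t0] := ltP 0 t; last first.
      by apply: nearW => n /=; rewrite ltNge (le_trans t0 (ltW (a0 n))).
    have /cvgrPdist_lt/(_ _ t0)[N _ hN] := acvg.
    exists N => // n /hN; rewrite /= sub0r normrN gtr0_norm// => ->.
    by [].
  - apply: aeW => t n _ /=; rewrite lee_fin; case: ifP => // _.
    by rewrite normr0.
  move=> ilim _ H; rewrite /Rintegral; apply: fine_cvg.
  by rewrite fineK// integrable_fin_num.
exact: (cvg_unique (@Rhausdorff R) c1 c2).
Qed.

End du_bois_reymond.

(** * The chain rule in terms of the subgradient inequality *)

Lemma mulr_le_sqrD (R : realType) (a b : R) : a * b <= a ^+ 2 + b ^+ 2.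
Proof.
have := sqr_ge0 (a - b); have := sqr_ge0 a; have := sqr_ge0 b.
by rewrite !expr2 => h1 h2 h3; nra.
Qed.

Section dual_pairing.
Context {R : realType} (V : normedModType R).
Local Notation mu := (@lebesgue_measure R).
Local Notation L1 a := (mu.-integrable setT (EFin \o a)).
Local Notation mT a := (measurable_fun [set: R] a).
Local Notation RR := (measurableTypeR R * measurableTypeR R)%type.

Lemma dual_le (f : dual V) v : `|f v| <= `|f| * `|v|.
Proof. exact: dual_norm_ge. Qed.

Lemma dualB (f : dual V) v w : f (v - w) = f v - f w.
Proof.
by rewrite [v - w]addrC -[- w]scaleN1r dual_linear scaleN1r addrC.
Qed.

Lemma dual_lin (f : dual V) (a : R) v w : f (a *: v + w) = a * f v + f w.
Proof. exact: dual_linear. Qed.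

Lemma dual_subE (f k : dual V) v : (f - k) v = f v - k v.
Proof. by []. Qed.

Lemma cvg_dual (f_ : nat -> dual V) (v_ : nat -> V) (f : dual V) (v : V) : f_ n @[n --> \oo] --> f ->
  v_ n @[n --> \oo] --> v -> (f_ n (v_ n) : R) @[n --> \oo] --> (f v : R).
Proof.
move=> fc vc; apply/cvgrPdist_le => e e0.
(* With both distances at most d, the error is at most d |f| + d |v| + d^2, and d <= 1 absorbs the
   square. *)
have d0 : 0 < Num.min 1 (e / (`|f| + `|v| + 1)).
  by rewrite lt_min ltr01 divr_gt0// ltr_wpDl// addr_ge0.
have /cvgrPdist_le/(_ _ d0)[N _ hN] := fc.
have /cvgrPdist_le/(_ _ d0)[M _ hM] := vc.
exists (maxn N M) => // n /=; rewrite geq_max => /andP[Nn Mn].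
have h1 := hN _ Nn; have h2 := hM _ Mn; rewrite /= in h1 h2.
set d := Num.min _ _ in d0 h1 h2.
have d1 : d <= 1 by rewrite /d ge_min lexx.
have de : d * (`|f| + `|v| + 1) <= e.
  by rewrite -ler_pdivlMr ?ltr_wpDl ?addr_ge0// /d ge_min lexx orbT.
have -> : f v - f_ n (v_ n) = f (v - v_ n) + ((f - f_ n) v - (f - f_ n) (v - v_ n)).
  by rewrite !dualB !dual_subE; ring.
apply: le_trans (ler_normD _ _) _.
apply: (@le_trans _ _ (`|f| * d + (d * `|v| + d * d))).
  apply: lerD; first by apply: le_trans (dual_le _ _) _; rewrite ler_wpM2l.
  apply: le_trans (ler_normB _ _) _; apply: lerD.
    by apply: le_trans (dual_le _ _) _; rewrite ler_wpM2r.
  by apply: le_trans (dual_le _ _) _; rewrite ler_pM.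
apply: le_trans de; rewrite [ `|f| * d]mulrC -!mulrDr ler_wpM2l ?(ltW d0)//.
by rewrite -addrA !lerD2l.
Qed.

Lemma measurable_dual2 (f : measurableTypeR R -> dual V) (z : measurableTypeR R -> V) :
  strongly_measurable setT f -> strongly_measurable setT z ->
  measurable_fun setT (fun p : RR => f p.1 (z p.2) : R).
Proof.
move=> sf sz; apply: (measurable_strong2 (Phi := fun (x : dual V) (y : V) => x y : R) sf sz).
exact: cvg_dual.
Qed.

Lemma measurable_dual1 (f : measurableTypeR R -> dual V) (x : V) :
  strongly_measurable setT f -> mT (fun t => f t x : R).
Proof.
move=> sf; have sx : strongly_measurable setT (cst x : measurableTypeR R -> V).
  by apply: strong_simple; exact: simple_cst.
apply: (measurable_strong (Phi := fun (x : dual V) (y : V) => x y : R) sf sx).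
exact: cvg_dual.
Qed.

Lemma measurable_dual (f : measurableTypeR R -> dual V) (z : measurableTypeR R -> V) :
  strongly_measurable setT f -> strongly_measurable setT z ->
  mT (fun t => f t (z t) : R).
Proof.
move=> sf sz.
apply: (measurable_strong (Phi := fun (x : dual V) (y : V) => x y : R) sf sz).
exact: cvg_dual.
Qed.

Definition L2fun (X : normedModType R) (f : measurableTypeR R -> X) :=
  strongly_measurable setT f /\ (\int[mu]_t (`|f t| ^+ 2)%:E < +oo)%E.

Lemma L2fun_sqr (X : normedModType R) (f : measurableTypeR R -> X) : L2fun f ->
  L1 (fun t => `|f t| ^+ 2).
Proof.
move=> [sf f2]; apply/integrableP; split.
  by apply/measurable_EFinP; apply: measurable_funX; exact: measurable_norm_strong.
by under eq_integral do rewrite /= ger0_norm ?sqr_ge0//.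
Qed.

Lemma L1_dual (f : measurableTypeR R -> dual V) (z : measurableTypeR R -> V) :
  L2fun f -> L2fun z -> L1 (fun t => f t (z t) : R).
Proof.
move=> Lf Lz; have [sf _] := Lf; have [sz _] := Lz.
have iD := integrableD measurableT (L2fun_sqr Lf) (L2fun_sqr Lz).
apply: le_integrable iD => //.
  by apply/measurable_EFinP; exact: measurable_dual.
move=> t _; rewrite /= lee_fin [X in _ <= X]ger0_norm ?addr_ge0 ?sqr_ge0//.
by apply: le_trans (dual_le _ _) _; exact: mulr_le_sqrD.
Qed.

Lemma L1_norm_L2 (X : normedModType R) (f : measurableTypeR R -> X) (T : R) : L2fun f ->
  (forall t, ~~ (0 < t < T) -> f t = 0) -> L1 (fun t => `|f t|).
Proof.
move=> Lf fT; have [sf _] := Lf.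
have iD := integrableD measurableT (L1_one T) (L2fun_sqr Lf).
apply: le_integrable iD => //.
  by apply/measurable_EFinP; exact: measurable_norm_strong.
move=> t _; rewrite /= lee_fin normr_id [X in _ <= X]ger0_norm; last first.
  by rewrite addr_ge0 ?sqr_ge0// /one /tcut; case: ifP.
have [tT|tT] := boolP (0 < t < T); last first.
  by rewrite fT// normr0 addr_ge0 ?sqr_ge0// /one /tcut; case: ifP.
rewrite /one cutE//.
by have := mulr_le_sqrD 1 `|f t|; rewrite mul1r expr1n.
Qed.

Lemma L1_dual1 (f : measurableTypeR R -> dual V) (x : V) (T : R) : L2fun f ->
  (forall t, ~~ (0 < t < T) -> f t = 0) -> L1 (fun t => f t x : R).
Proof.
move=> Lf fT; have [sf _] := Lf.
have := integrableZl measurableT `|x| (L1_norm_L2 Lf fT).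
apply: le_integrable => //; first by apply/measurable_EFinP; exact: measurable_dual1.
move=> t _; rewrite /= lee_fin normrM normr_id mulrC normr_id.
exact: dual_le.
Qed.

Lemma finite_translation (f : measurableTypeR R -> dual V) (T e : R) (xs : seq V) :
  0 < T -> L2fun f -> (forall t, ~~ (0 < t < T) -> f t = 0) -> 0 < e ->
  exists2 d : R, 0 < d & forall r, 0 < r < d ->
    (\sum_(x <- xs) \int[mu]_t `|f (t - r) x - f t x|%:E <= e%:E)%E.
Proof.
move=> T0 Lf fT; elim: xs e => [|x xs IH] e e0.
  by exists 1 => // r _; rewrite big_nil lee_fin ltW.
have e2 : 0 < e / 2 by rewrite divr_gt0.
have [d d0 hd] := IH _ e2.
have fx0 t : ~~ (0 < t < T) -> f t x = 0 :> R by move=> /fT ->.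
have [d' d'0 hd'] := translation_L1 T0 (L1_dual1 x Lf fT) fx0 e2.
exists (Num.min d d'); first by rewrite lt_min d0.
move=> r /andP[r0]; rewrite lt_min => /andP[rd rd'].
rewrite big_cons (splitr e) EFinD; apply: leeD; first by apply: hd'; rewrite r0.
by apply: hd; rewrite r0.
Qed.

(** It supplies the bound B of [mollification_error], uniform in r by translation invariance of the
    L^2 norm of f. *)
Lemma pairing_modulus_bound (f : measurableTypeR R -> dual V) (z : measurableTypeR R -> V) (r : R) :
  L2fun f -> L2fun z ->
  (shift_modulus (fun p : RR => f p.1 (z p.2) : R) r <=
   2%:E * \int[mu]_t (`|f t| ^+ 2)%:E + 2%:E * \int[mu]_t (`|z t| ^+ 2)%:E)%E.
Proof.
move=> Lf Lz; have [sf _] := Lf; have [sz _] := Lz.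
have mf2 : measurable_fun setT (fun t : measurableTypeR R => (`|f t| ^+ 2)%:E).
  by apply/measurable_EFinP; apply: measurable_funX; exact: measurable_norm_strong.
have mz2 : measurable_fun setT (fun t : measurableTypeR R => (`|z t| ^+ 2)%:E).
  by apply/measurable_EFinP; apply: measurable_funX; exact: measurable_norm_strong.
have mfr2 : measurable_fun setT (fun t : measurableTypeR R => (`|f (t - r)| ^+ 2)%:E).
  by apply: (measurableT_comp mf2); exact: measurable_funB.
rewrite /shift_modulus /=.
apply: (@le_trans _ _ (\int[mu]_t ((`|f (t - r)%R| ^+ 2)%:E + ((`|f t| ^+ 2)%:E + 2%:E * (`|z t| ^+ 2)%:E)))%E).
  apply: ge0_le_integral => //.
  - apply/measurable_EFinP; apply: measurableT_comp => //; apply: measurable_funB.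
      have := measurable_skew (measurable_dual2 sf sz) => h.
      have mm : measurable_fun setT (fun t : measurableTypeR R => (t, r) : RR).
        by apply: measurable_fun_pair.
      exact: (measurableT_comp h mm).
    exact: measurable_dual.
  - apply: emeasurable_funD => //; apply: emeasurable_funD => //.
    exact: emeasurable_funM.
  - move=> t _; rewrite -EFinM -!EFinD lee_fin.
    apply: le_trans (ler_normB _ _) _.
    have h1 := le_trans (dual_le (f (t - r)) (z t)) (mulr_le_sqrD _ _).
    have h2 := le_trans (dual_le (f t) (z t)) (mulr_le_sqrD _ _).
    apply: le_trans (lerD h1 h2) _; rewrite -addrA lerD2l addrCA lerD2l.
    by rewrite mulr_natl mulr2n.
rewrite ge0_integralD//; last 2 first.
- by move=> t _; rewrite adde_ge0 ?mule_ge0 ?lee_fin ?sqr_ge0.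
- by apply: emeasurable_funD => //; exact: emeasurable_funM.
rewrite ge0_integralD//; last exact: emeasurable_funM.
rewrite ge0_integralZl//.
rewrite (integral_shift r mf2) addeA leeD2r//.
by rewrite -[2%:E]/((1 + 1)%:E) EFinD ge0_muleDl// !mul1e.
Qed.

End dual_pairing.

Section dual_pairing_modulus.
Context {R : realType} (V : normedModType R).
Local Notation mu := (@lebesgue_measure R).
Local Notation L1 a := (mu.-integrable setT (EFin \o a)).
Local Notation mT a := (measurable_fun [set: R] a).
Local Notation RR := (measurableTypeR R * measurableTypeR R)%type.

Lemma mulr_le_sqr_weighted (a b d : R) : 0 < d -> a * b <= d * a ^+ 2 + (4 * d)^-1 * b ^+ 2.
Proof.
move=> d0; rewrite -(ler_pM2l (_ : 0 < 4 * d)) ?mulr_gt0// mulrDr.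
rewrite [X in _ <= _ + X]mulrA divff ?mul1r; last by rewrite gt_eqF// mulr_gt0.
by rewrite -subr_ge0 (_ : _ - _ = (2 * d * a - b) ^+ 2) ?sqr_ge0//; ring.
Qed.

(* [z] is replaced by a simple function, which reduces the claim to finitely
   many scalar functions [t |-> f t x]. *)
Lemma pairing_modulus_small (f : measurableTypeR R -> dual V) (z : measurableTypeR R -> V)
    (T e : R) :
  0 < T -> L2fun f -> (forall t, ~~ (0 < t < T) -> f t = 0) -> L2fun z -> 0 < e ->
  exists2 d : R, 0 < d & forall r : R, 0 < r < d ->
    (shift_modulus (fun p : RR => f p.1 (z p.2) : R) r <= e%:E)%E.
Proof.
move=> T0 Lf fT Lz e0; have [sf f2] := Lf; have [sz z2] := Lz.
have mf2 : measurable_fun setT (fun t : measurableTypeR R => (`|f t| ^+ 2)%:E).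
  by apply/measurable_EFinP; apply: measurable_funX; exact: measurable_norm_strong.
pose F2 := fine (\int[mu]_t (`|f t| ^+ 2)%:E)%E.
have F2E : (\int[mu]_t (`|f t| ^+ 2)%:E = F2%:E)%E.
  rewrite /F2 fineK// ge0_fin_numE//; apply: integral_ge0 => t _.
  by rewrite lee_fin sqr_ge0.
have F20 : 0 <= F2.
  by rewrite -lee_fin -F2E; apply: integral_ge0 => t _; rewrite lee_fin sqr_ge0.
(* The weight in Young's inequality: the terms in f t and f (t - r) cost at most e / 8 each. The
   accuracy d * (e / 2) asked of s in the squared L^2 norm then costs (2 d)^-1 * d * (e / 2) = e /
   4, and e / 2 is left for the scalar translations. *)
pose d := e / (8 * (F2 + 1)).
have d0 : 0 < d by rewrite divr_gt0// mulr_gt0// ltr_wpDl.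
have eta0 : 0 < d * (e / 2) by rewrite mulr_gt0// divr_gt0.
have [s ss sz2] := strong_L2_approx sz z2 eta0.
have [fs ms] := ss.
pose xs : seq V := finmap.enum_fset (fset_set (range s)).
have xsP t : s t \in xs.
  have : s t \in fset_set (range s) by rewrite in_fset_set//; apply/mem_set; exists t.
  exact.
have e2 : 0 < e / 2 by rewrite divr_gt0.
have [r0 r00 hr0] := finite_translation xs T0 Lf fT e2.
exists r0 => // r rr0.
have mfr2 : measurable_fun setT (fun t : measurableTypeR R => (`|f (t - r)| ^+ 2)%:E).
  by apply: (measurableT_comp mf2); exact: measurable_funB.
have mzs : measurable_fun setT (fun t : measurableTypeR R => (`|z t - s t| ^+ 2)%:E).
  apply/measurable_EFinP; apply: measurable_funX.
  by apply: measurable_dist_strong => //; exact: strong_simple.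
have mfx x : measurable_fun setT (fun t : measurableTypeR R => `|f (t - r) x - f t x|%:E).
  have m1 := measurable_dual1 x sf.
  apply/measurable_EFinP; apply: measurableT_comp => //; apply: measurable_funB => //.
  by apply: (measurableT_comp m1); exact: measurable_funB.
have mS : measurable_fun setT (fun t : measurableTypeR R => \sum_(x <- xs) `|f (t - r) x - f t x|%:E)%E.
  by apply: emeasurable_sum => x; exact: mfx.
have mD : measurable_fun setT (fun t : measurableTypeR R => d%:E * (`|f t| ^+ 2)%:E)%E by exact: emeasurable_funM.
have mDr : measurable_fun setT (fun t : measurableTypeR R => d%:E * (`|f (t - r)%R| ^+ 2)%:E)%E by exact: emeasurable_funM.
have mZ : measurable_fun setT (fun t : measurableTypeR R => ((2 * d)^-1)%:E * (`|z t - s t| ^+ 2)%:E)%E by exact: emeasurable_funM.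
have d2 : 0 <= (2 * d)^-1 by rewrite invr_ge0 mulr_ge0 ?(ltW d0).
have p1 t : (0 <= d%:E * (`|f t| ^+ 2)%:E)%E by rewrite mule_ge0 ?lee_fin ?sqr_ge0 ?(ltW d0).
have p2 t : (0 <= ((2 * d)^-1)%:E * (`|z t - s t| ^+ 2)%:E)%E by rewrite mule_ge0 ?lee_fin ?sqr_ge0.
have p3 t : (0 <= \sum_(x <- xs) `|f (t - r)%R x - f t x|%:E)%E.
  by apply: sume_ge0 => x _; rewrite lee_fin.
rewrite /shift_modulus /=.
apply: (@le_trans _ _ (\int[mu]_t (d%:E * (`|f (t - r)%R| ^+ 2)%:E + (d%:E * (`|f t| ^+ 2)%:E +
   (((2 * d)^-1)%:E * (`|z t - s t| ^+ 2)%:E + \sum_(x <- xs) `|f (t - r)%R x - f t x|%:E))))%E).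
  apply: ge0_le_integral => //.
  - apply/measurable_EFinP; apply: measurableT_comp => //; apply: measurable_funB.
      have := measurable_skew (measurable_dual2 sf sz) => h.
      have mm : measurable_fun setT (fun t : measurableTypeR R => (t, r) : RR).
        by apply: measurable_fun_pair.
      exact: (measurableT_comp h mm).
    exact: measurable_dual.
  - by apply: emeasurable_funD => //; apply: emeasurable_funD => //; exact: emeasurable_funD.
  - move=> t _; rewrite sumEFin -!EFinM -!EFinD lee_fin.
    have -> : f (t - r) (z t) - f t (z t) = (f (t - r) (z t - s t) - f t (z t - s t)) +
        (f (t - r) (s t) - f t (s t)) by rewrite !dualB; ring.
    apply: le_trans (ler_normD _ _) _; rewrite !addrA; apply: lerD; last first.
      by rewrite (bigD1_seq (s t)) ?finmap.fset_uniq//= lerDl sumr_ge0.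
    apply: le_trans (ler_normB _ _) _.
    have h1 := le_trans (dual_le (f (t - r)) (z t - s t)) (mulr_le_sqr_weighted _ _ d0).
    have h2 := le_trans (dual_le (f t) (z t - s t)) (mulr_le_sqr_weighted _ _ d0).
    apply: le_trans (lerD h1 h2) _; rewrite addrACA lerD2l -mulrDl.
    rewrite ler_wpM2r ?sqr_ge0// (_ : (4 * d)^-1 + (4 * d)^-1 = (2 * d)^-1)//.
    by field; rewrite gt_eqF.
rewrite ge0_integralD//; last 2 first.
- by move=> t _; rewrite !adde_ge0.
- by apply: emeasurable_funD => //; exact: emeasurable_funD.
rewrite ge0_integralD//; last 2 first.
- by move=> t _; rewrite !adde_ge0.
- exact: emeasurable_funD.
rewrite ge0_integralD//.
have pf t : (0 <= (`|f t| ^+ 2)%:E)%E by rewrite lee_fin sqr_ge0.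
have pz t : (0 <= (`|z t - s t| ^+ 2)%:E)%E by rewrite lee_fin sqr_ge0.
have d0' : (0 <= d%:E)%E by rewrite lee_fin ltW.
rewrite (ge0_integralZl _ measurableT mfr2 (fun t _ => pf (t - r)) d0').
rewrite (ge0_integralZl _ measurableT mf2 (fun t _ => pf t) d0').
rewrite (ge0_integralZl _ measurableT mzs (fun t _ => pz t)) ?lee_fin//.
rewrite (integral_shift r mf2) F2E.
rewrite ge0_integral_sum//.
have dF : d * F2 <= e / 8.
  rewrite /d mulrAC ler_pdivrMr ?mulr_gt0 ?ltr_wpDl// mulrA divfK//.
  by rewrite ler_pM2l// lerDl.
have -> : (e%:E = (e / 8)%:E + ((e / 8)%:E + ((e / 4)%:E + (e / 2)%:E)))%E.
  by rewrite -!EFinD; congr EFin; field.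
rewrite -EFinM leeD ?lee_fin// leeD ?lee_fin// leeD//; last by apply: hr0.
apply: (@le_trans _ _ (((2 * d)^-1)%:E * (d * (e / 2))%:E)%E).
  by rewrite lee_wpmul2l ?lee_fin.
have E (x : R) : x != 0 -> (2 * x)^-1 * (x * (e / 2)) = e / 4 by move=> x0; field.
by rewrite -EFinM lee_fin E// gt_eqF.
Qed.

End dual_pairing_modulus.

(** * Fractional integrals and Marchaud differences *)

Section fractional_identities.
Context {R : realType}.
Local Notation mu := (@lebesgue_measure R).
Local Notation L1 a := (mu.-integrable setT (EFin \o a)).
Local Notation mT a := (measurable_fun [set: R] a).
Variables (alpha T : R).
Hypothesis alpha01 : 0 < alpha < 1.
Hypothesis T0 : 0 < T.

Let alpha'01 : 0 < 1 - alpha < 1.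
Proof. by move/andP: alpha01 => [? ?]; apply/andP; split; lra. Qed.

Local Notation g := (gk T alpha).
Local Notation gg := (gk T (1 - alpha)).
Local Notation one := (one T).
Local Notation c e := (gker (1 - alpha) e).
Local Notation mk := (mk alpha T).
Local Notation hk := (hk alpha T).

Let mg : mT g. Proof. exact: measurable_gk. Qed.
Let ig : L1 g. Proof. exact: L1_gk. Qed.
Let mgg : mT gg. Proof. exact: measurable_gk. Qed.
Let igg : L1 gg. Proof. exact: L1_gk. Qed.
Let iT : L1 one. Proof. exact: L1_one. Qed.
Let mo : mT one. Proof. exact: measurable_one. Qed.
Let cg : causal g. Proof. exact: causal_cut. Qed.
Let cgg : causal gg. Proof. exact: causal_cut. Qed.
Let co : causal one. Proof. exact: causal_cut. Qed.
Let o1 x : `|one x| <= 1. Proof. exact: one_le1. Qed.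

Let Mg : R := fine (\int[mu]_s `|g s|%:E)%E.
Let acv_one_g x : (acv one g x <= Mg%:E)%E.
Proof.
apply: le_trans (acv_lty_bounded x mo ig o1) _.
rewrite mul1e /Mg fineK//; apply/fin_real/andP; split; last exact: (L1_abs ig).
by apply: (@lt_le_trans _ _ 0%E) => //; exact: integral_ge0.
Qed.

Let acv_g_one x : (acv g one x <= Mg%:E)%E.
Proof. by rewrite (acvC _ mg mo). Qed.

Let acv_gg_g x : (acv gg g x <= 1%:E)%E.
Proof. exact: (acv_gk_le1 T alpha01 x). Qed.

Let acv_g_gg x : (acv g gg x <= 1%:E)%E.
Proof. by rewrite (acvC _ mg mgg); exact: acv_gg_g. Qed.

Lemma acv3_gk p t : L1 p -> (acv3 gg g p t < +oo)%E.
Proof.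
by move=> ip; exact: (acv3_lty t mgg mg ip acv_gg_g).
Qed.

Lemma cv_gk_gk p t : L1 p -> causal p -> 0 < t <= T ->
  cv gg (cv g p) t = \int[mu]_s tcut t p s.
Proof.
move=> ip cp tT; have mp := L1_mT ip.
rewrite (cvA mgg mg mp (acv3_gk t ip)) -(@cv_one _ T)//.
apply: (@eq_cv_lt _ _ _ _ _ T) => //.
- by apply: causal_cv.
- by move=> s sT; rewrite cv_gk ?/one ?cutE//; case/andP: sT => -> /ltW ->.
- by case/andP: tT.
Qed.

(** Abel inversion: convolving the hypothesis with g_alpha gives one * v = one * (g_alpha * F) on
    (0, T), and integrable functions with equal primitives agree almost everywhere. *)
Lemma fractional_integral_of (v F : R -> R) : L1 v -> causal v -> L1 F -> causal F ->
  {ae mu, forall t, 0 < t < T -> cv gg v t = \int[mu]_s tcut t F s} ->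
  {ae mu, forall t, 0 < t < T -> v t = cv g F t}.
Proof.
move=> iv cv_ iF cF A; have mv := L1_mT iv; have mF := L1_mT iF.
have igF : L1 (cv g F) by exact: L1_cv.
have cgF : causal (cv g F) by exact: causal_cv.
have A' : {ae mu, forall t, 0 < t < T -> cv gg v t = cv one F t}.
  apply: (aeS _ A) => t h tT; rewrite h// (@cv_one _ T)//.
  by case/andP: tT => -> /ltW ->.
have E t : 0 < t < T -> cv one v t = cv one (cv g F) t.
  move=> /andP[t0 tT].
  transitivity (cv (cv g gg) v t).
    apply: (@eq_cv_lt _ _ _ _ _ T) => //; [exact: causal_cv| |exact: ltW].
    move=> s sT; rewrite (cvC _ mg mgg) cv_gk ?/one ?cutE//.
    by case/andP: sT => -> /ltW ->.
  rewrite -(cvA mg mgg mv); last first.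
    exact: (acv3_lty t mg mgg iv acv_g_gg).
  transitivity (cv g (cv one F) t).
    by apply: (cv_local cg _ _ A' (ltW tT)); exact: causal_cv.
  rewrite (cvA mg mo mF (acv3_lty t mg mo iF acv_g_one)).
  rewrite (cvA mo mg mF (acv3_lty t mo mg iF acv_one_g)).
  suff -> : cv g one = cv one g by [].
  by apply/funext => s; exact: (cvC s mg mo).
have iW : L1 (fun t => v t - cv g F t).
  by have := integrableB measurableT iv igF; apply: eq_integrable.
have : {ae mu, forall t, 0 < t < T -> v t - cv g F t = 0}.
  apply: (ae0_of_integral_itv iW) => t tT.
  have tT' : 0 < t <= T by case/andP: tT => -> /ltW ->.
  have h (a : R -> R) : L1 a -> causal a -> \int[mu]_(s in `]-oo, t]) a s = cv one a t.
    move=> ia ca; rewrite (@cv_one _ T)//; congr fine; rewrite integral_mkcond.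
    apply: integral_ae_congr; exists [set t]; split => //; first exact: lebesgue_measure_set1.
    move=> s /= hs; apply: contrapT => st; apply: hs => _.
    rewrite patchE /tcut; have [s0|s0] := leP s 0.
      by rewrite ca//; case: ifP.
    have [ts|ts] := leP t s; last by rewrite mem_set//= in_itv/= ltW.
    rewrite memNset//= in_itv/= leNgt => /negP; apply.
    by rewrite lt_neqAle ts andbT eq_sym; apply/eqP.
  rewrite RintegralB//; [|exact: integrableS iv|exact: integrableS igF].
  by rewrite h// h// E// subrr.
by apply: aeS => t h tT; apply/eqP; rewrite -subr_eq0 h.
Qed.

Variable e : R.
Hypothesis e0 : 0 < e.

Let mmk : mT (mk e). Proof. exact: measurable_mk. Qed.
Let imk : L1 (mk e). Proof. exact: L1_mk. Qed.
Let cmk : causal (mk e). Proof. exact: causal_mk. Qed.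

Let hk_cv F : L1 F -> causal F ->
  {ae mu, forall t, 0 < t < T -> cv (hk e) F t = c e * cv g F t - cv (cv (mk e) g) F t}.
Proof.
move=> iF cF; have mF := L1_mT iF.
have img : L1 (cv (mk e) g) by exact: L1_cv.
have mmg := L1_mT img.
apply: (aeS2 _ (ae_acv iF ig) (ae_acv iF img)) => t h1 h2 /andP[t0 tT].
have cmg : causal (cv (mk e) g) by exact: causal_cv.
rewrite (@eq_cv_lt _ (hk e) (fun t => c e * g t - cv (mk e) g t) F F T)//; last 4 first.
- exact: causal_cut.
- by move=> x x0; rewrite cg// cmg// mulr0 subrr.
- by move=> s sT; exact: hkE.
- exact: ltW.
have mlin : mT (fun s => c e * g s - cv (mk e) g s).
  apply: (measurable_funB _ mmg); apply: (measurable_funM _ mg).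
  exact: measurable_cst.
by rewrite (cvC _ mlin mF) (cvBZr (c e) mF mg mmg h1 h2) (cvC _ mF mg) (cvC _ mF mmg).
Qed.

(** Here k_e * F is the Marchaud difference of the fractional integral g_alpha * F; it is used with
    F the scalar function f paired with a vector. *)
Lemma hk_cv1 F : L1 F -> causal F ->
  {ae mu, forall t, 0 < t < T -> cv (hk e) F t = c e * cv g F t - cv (mk e) (cv g F) t}.
Proof.
move=> iF cF; apply: (aeS2 _ (hk_cv iF cF) (ae_cvA imk ig iF)) => t h h2 tT.
exact: (etrans (h tT) (congr1 (fun x => c e * cv g F t - x) (esym h2))).
Qed.

(** The other bracketing, with the Marchaud difference taken of F itself and g_alpha outside; it is
    used with F the energy h. *)
Lemma hk_cv2 F : L1 F -> causal F ->
  {ae mu, forall t, 0 < t < T -> cv (hk e) F t = cv g (fun s => c e * F s - cv (mk e) F s) t}.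
Proof.
move=> iF cF; have mF := L1_mT iF.
have imF : L1 (cv (mk e) F) by exact: L1_cv.
have mmF := L1_mT imF.
apply: (aeS3 _ (hk_cv iF cF) (ae_cvA ig imk iF)
  (aeS2 _ (ae_acv ig iF) (ae_acv ig imF))); last first.
  by move=> t h1 h2; exact: (conj h1 h2).
move=> t h1 h2 [h3 h4] tT; rewrite (h1 tT) (cvBZr (c e) mg mF mmF h3 h4) h2.
suff -> : cv g (mk e) = cv (mk e) g by [].
by apply/funext => s; exact: (cvC s mg mmk).
Qed.

End fractional_identities.

(** * Monotonicity and continuity of convolutions *)

Section convolution_order.
Context {R : realType}.
Local Notation mu := (@lebesgue_measure R).
Local Notation L1 a := (mu.-integrable setT (EFin \o a)).
Local Notation mT a := (measurable_fun [set: R] a).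
Implicit Types a b c : R -> R.

Lemma measurable_acvker a b t : mT a -> mT b ->
  measurable_fun [set: R] (fun s => `|a (t - s) * b s|%:E).
Proof.
move=> ma mb; apply/measurable_EFinP; apply: measurableT_comp => //.
by apply: measurable_funM => //; exact: measurable_refl.
Qed.

Lemma cv_le_ae (T : R) a b b' t : mT a -> mT b -> mT b' -> (forall s, 0 <= a s) ->
  causal a -> causal b -> causal b' -> (acv a b t < +oo)%E -> (acv a b' t < +oo)%E ->
  {ae mu, forall s, 0 < s < T -> b s <= b' s} -> t <= T -> cv a b t <= cv a b' t.
Proof.
move=> ma mb mb' a0 ca cb cb' h h' bb' tT.
rewrite -subr_ge0 -[X in X - _]mul1r -(cvBZr 1 ma mb' mb h' h).
rewrite (_ : cv _ _ _ = cv a (fun s => `|1 * b' s - b s|) t).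
  by apply: Rintegral_ge0 => s _; rewrite mulr_ge0.
apply: (cv_local ca _ _ _ tT).
- by move=> x x0; rewrite cb// cb'// mulr0 subrr.
- by move=> x x0; rewrite cb// cb'// mulr0 subrr normr0.
- by apply: (aeS _ bb') => s H sT; rewrite mul1r ger0_norm// subr_ge0 H.
Qed.

Lemma acv_le_ae (T : R) a b b' t : mT a -> mT b -> mT b' ->
  causal a -> causal b -> causal b' ->
  {ae mu, forall s, 0 < s < T -> `|b s| <= `|b' s|} -> t <= T ->
  (acv a b t <= acv a b' t)%E.
Proof.
move=> ma mb mb' ca cb cb' bb' tT.
apply: ae_ge0_le_integral => //; [exact: measurable_acvker|exact: measurable_acvker|].
apply: (aeS _ bb') => s H _; rewrite lee_fin !normrM.
have [s0|s0] := leP s 0; first by rewrite cb// cb'.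
have [ts|ts] := leP t s; first by rewrite ca ?subr_le0// normr0 !mul0r.
by rewrite ler_wpM2l// H// s0 (lt_le_trans ts).
Qed.

Lemma acvD_le a b b' t : mT a -> mT b -> mT b' ->
  (acv a (fun s => (b s + b' s)%R) t <= acv a b t + acv a b' t)%E.
Proof.
move=> ma mb mb'; have mbb : mT (fun s => b s + b' s) by exact: measurable_funD.
rewrite /acv -ge0_integralD//; [|exact: measurable_acvker|exact: measurable_acvker].
apply: ge0_le_integral => //; [exact: measurable_acvker| |].
  by apply: emeasurable_funD; exact: measurable_acvker.
by move=> s _; rewrite -EFinD lee_fin mulrDr ler_normD.
Qed.

Lemma acv_cv_le a b c t : mT a -> mT b -> mT c ->
  (acv a (cv b c) t <= acv3 a b c t)%E.
Proof.
move=> ma mb mc; rewrite /acv3.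
have E s : (\int[mu]_r `|a (t - s) * (b (s - r) * c r)|%:E = `|a (t - s)|%:E * acv b c s)%E.
  rewrite /acv -ge0_integralZl//; last first.
    exact: measurable_acvker.
  by apply: eq_integral => r _; rewrite normrM EFinM.
under eq_integral do rewrite E.
apply: ge0_le_integral => //.
- apply/measurable_EFinP; apply: measurableT_comp => //.
  by apply: measurable_funM; [exact: measurable_refl|exact: measurable_cv].
- apply: emeasurable_funM; last exact: measurable_acv.
  by apply/measurable_EFinP; apply: measurableT_comp => //; exact: measurable_refl.
- by move=> s _; rewrite normrM EFinM lee_wpmul2l//; exact: abs_cv_le.
Qed.

Lemma causal_of (T : R) a : (forall t, ~~ (0 < t < T) -> a t = 0) -> causal a.
Proof. by move=> aT t t0; apply: aT; rewrite ltNge t0. Qed.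

Variable V : normedModType R.

(** At a fixed t the convolution is Lipschitz in the vector, with constant [acv a |f| t]. This
    carries identities along a sequence of vectors to its limit. *)
Lemma cv_dual_cvg a (f : measurableTypeR R -> dual V) t (x_ : nat -> V) (x : V) : mT a ->
  strongly_measurable setT f -> (acv a (fun s => `|f s|%R) t < +oo)%E ->
  x_ n @[n --> \oo] --> x ->
  cv a (fun s => f s (x_ n)) t @[n --> \oo] --> cv a (fun s => f s x) t.
Proof.
move=> ma sf ft xx.
have mf y : mT (fun s => f s y) by exact: measurable_dual1.
have mn : mT (fun s => `|f s|) by exact: measurable_norm_strong.
have B y : (acv a (fun s => f s y) t <= `|y|%:E * acv a (fun s => `|f s|%R) t)%E.
  rewrite /acv -ge0_integralZl//; last first.
    exact: measurable_acvker.
  apply: ge0_le_integral => //.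
  - exact: measurable_acvker.
  - apply: emeasurable_funM => //; exact: measurable_acvker.
  - move=> s _; rewrite -EFinM lee_fin !normrM normr_id mulrCA ler_wpM2l//.
    by rewrite mulrC; exact: dual_le.
have fin y : (acv a (fun s => f s y) t < +oo)%E.
  by apply: le_lt_trans (B y) _; rewrite lte_mul_pinfty.
pose M := fine (acv a (fun s => `|f s|%R) t).
have ME : acv a (fun s => `|f s|%R) t = M%:E.
  rewrite fineK//; apply/fin_real/andP; split => //.
  by apply: (@lt_le_trans _ _ 0%E) => //; exact: acv_ge0.
have M0 : 0 <= M by rewrite -lee_fin -ME acv_ge0.
have dist y : `|cv a (fun s => f s x) t - cv a (fun s => f s y) t| <= `|x - y| * M.
  rewrite -[X in X - _]mul1r -(cvBZr 1 ma (mf x) (mf y) (fin x) (fin y)).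
  rewrite (_ : (fun s => _) = fun s => f s (x - y)); last first.
    by apply/funext => s; rewrite mul1r dualB.
  rewrite -lee_fin EFinM -ME; apply: le_trans (abs_cv_le t ma (mf _)) _.
  exact: B.
apply/cvgrPdist_le => e e0.
have d0 : 0 < e / (M + 1) by rewrite divr_gt0// ltr_wpDl.
have /cvgrPdist_le/(_ _ d0)[N _ hN] := xx.
exists N => // n Nn; apply: le_trans (dist _) _.
have := hN _ Nn; rewrite /= ler_pdivlMr ?ltr_wpDl// => H.
by apply: le_trans H; rewrite ler_wpM2l// lerDl.
Qed.

End convolution_order.

Section mollification_limit.
Context {R : realType}.
Local Notation mu := (@lebesgue_measure R).
Local Notation L1 a := (mu.-integrable setT (EFin \o a)).
Local Notation mT a := (measurable_fun [set: R] a).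
Local Notation RR := (measurableTypeR R * measurableTypeR R)%type.
Variables (alpha T : R).
Hypothesis alpha01 : 0 < alpha < 1.
Hypothesis T0 : 0 < T.
Local Notation hk := (hk alpha T).

Lemma mollification_limit (e_ : R^nat) (K : RR -> R) (A B e : R) :
  (forall n, 0 < e_ n) -> e_ n @[n --> \oo] --> 0 ->
  measurable_fun setT K -> 0 <= A -> 0 <= B ->
  (\int[mu]_t `|K (t, t)|%:E <= A%:E)%E ->
  (forall r : R, shift_modulus K r <= B%:E)%E ->
  (forall e' : R, 0 < e' -> exists2 d : R, 0 < d &
    forall r : R, 0 < r < d -> (shift_modulus K r <= e'%:E)%E) ->
  0 < e -> exists N, forall n, (N <= n)%N ->
  (\int[mu]_t `|(\int[mu]_s (hk (e_ n) (t - s) * K (s, t))) - K (t, t)|%:E <= e%:E)%E.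
Proof.
move=> e0_ ec mK A0 B0 KA KB Kd e0.
have e2 : 0 < e / 2 by rewrite divr_gt0.
have [d d0 hd] := Kd _ e2.
(* [integral_hk_cvg] gives the limit mass of (0, t) for t <= T only. *)
pose d' := Num.min d T.
have d'T : 0 < d' <= T by rewrite /d' lt_min d0 T0 ge_min lexx orbT.
have C0 : 0 < e / 2 / (A + B + 1) by rewrite divr_gt0// ltr_wpDl// addr_ge0.
have /cvgrPdist_le/(_ _ C0)[N _ hN] := integral_hk_cvg alpha01 T0 e0_ ec d'T.
exists N => n Nn; have := hN _ Nn; rewrite /= => H.
have hd' r : 0 < r < d' -> (shift_modulus K r <= (e / 2)%:E)%E.
  by move=> /andP[r0]; rewrite lt_min => /andP[rd _]; apply: hd; rewrite r0.
have M := (mollification_error mK (@L1_hk _ _ _ alpha01 T0 _ (e0_ n))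
  (@causal_hk _ alpha T (e_ n)) (@hk_ge0 _ _ T alpha01 _ (e0_ n)) (@integral_hk_le1 _ _ _ alpha01 T0 _ (e0_ n))
  A0 B0 (ltW e2) KA KB hd').
apply: le_trans M _.
rewrite lee_fin [X in _ <= X](splitr e) lerD2l.
apply: (@le_trans _ _ ((A + B) * (e / 2 / (A + B + 1)))).
  by rewrite ler_wpM2l ?addr_ge0//; exact: le_trans (ler_norm _) H.
rewrite mulrCA ler_piMr ?(ltW e2)// ler_pdivrMr ?mul1r ?lerDl//.
by rewrite ltr_wpDl// addr_ge0.
Qed.

End mollification_limit.

(** * The abstract fractional chain rule *)

Section fractional_chain_rule.
Context {R : realType} (V : normedModType R).
Local Notation mu := (@lebesgue_measure R).
Local Notation L1 a := (mu.-integrable setT (EFin \o a)).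
Local Notation mT a := (measurable_fun [set: R] a).
Local Notation RR := (measurableTypeR R * measurableTypeR R)%type.
(** In the application f is the fractional derivative, v = u - u0 and z = F'(u), all extended by
    zero, and h is the energy difference. Then [fv] is the Caputo relation paired with a vector,
    while [hv] and [hvv] are the subgradient inequalities at u t compared with u0 and with u s. *)
Variables (alpha T : R) (f v : measurableTypeR R -> dual V).
Variables (z : measurableTypeR R -> V) (h : R -> R).
Hypothesis alpha01 : 0 < alpha < 1.
Hypothesis T0 : 0 < T.
Hypotheses (Lf : L2fun f) (Lv : L2fun v) (Lz : L2fun z) (ih : L1 h).
Hypothesis fT : forall t, ~~ (0 < t < T) -> f t = 0.
Hypothesis vT : forall t, ~~ (0 < t < T) -> v t = 0.
Hypothesis hT : forall t, ~~ (0 < t < T) -> h t = 0.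

Local Notation g := (gk T alpha).
Local Notation gg := (gk T (1 - alpha)).
Local Notation c e := (gker (1 - alpha) e).
Local Notation mk := (mk alpha T).
Local Notation hk := (hk alpha T).
Local Notation one := (one T).

Hypothesis fv : forall phi : V, {ae mu, forall t, 0 < t < T ->
  cv gg (fun s => v s phi) t = \int[mu]_s tcut t (fun r => f r phi) s}.
Hypothesis hv : {ae mu, forall t, 0 < t < T -> h t <= v t (z t)}.
Hypothesis hvv : {ae mu, forall t, 0 < t < T ->
  {ae mu, forall s, 0 < s < T -> h t - h s <= (v t - v s) (z t)}}.

Let alpha'01 : 0 < 1 - alpha < 1.
Proof. by move/andP: alpha01 => [? ?]; apply/andP; split; lra. Qed.

Let sf : strongly_measurable setT f. Proof. by case: Lf. Qed.
Let sv : strongly_measurable setT v. Proof. by case: Lv. Qed.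
Let sz : strongly_measurable setT z. Proof. by case: Lz. Qed.
Let mg : mT g. Proof. exact: (measurable_gk T alpha). Qed.
Let ig : L1 g. Proof. exact: L1_gk. Qed.
Let mgg : mT gg. Proof. exact: (measurable_gk T _). Qed.
Let g0 x : 0 <= g x. Proof. exact: gk_ge0. Qed.
Let gg0 x : 0 <= gg x. Proof. exact: gk_ge0. Qed.
Let cg : causal g. Proof. exact: causal_cut. Qed.
Let cgg : causal gg. Proof. exact: causal_cut. Qed.
Let mh : mT h. Proof. exact: L1_mT. Qed.
Let ch : causal h. Proof. exact: (causal_of hT). Qed.
Let if_ phi : L1 (fun s => f s phi). Proof. exact: (L1_dual1 phi Lf fT). Qed.
Let iv phi : L1 (fun s => v s phi). Proof. exact: (L1_dual1 phi Lv vT). Qed.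
Let cf phi : causal (fun s => f s phi).
Proof. by apply: (@causal_of _ T) => t /fT ->. Qed.
Let cv_ phi : causal (fun s => v s phi).
Proof. by apply: (@causal_of _ T) => t /vT ->. Qed.

Let p t : R := f t (z t).
Let ip : L1 p. Proof. exact: (L1_dual Lf Lz). Qed.
Let mp : mT p. Proof. exact: L1_mT. Qed.
Let cp : causal p. Proof. by apply: (@causal_of _ T) => t tT; rewrite /p (fT tT). Qed.
Let K (q : RR) : R := f q.1 (z q.2).
Let mK : measurable_fun setT K. Proof. exact: (measurable_dual2 sf sz). Qed.

Let K_bound : exists A, 0 <= A /\ exists B, 0 <= B /\
  (\int[mu]_t `|K (t, t)|%:E <= A%:E)%E /\ forall r, (shift_modulus K r <= B%:E)%E.
Proof.
have f2 := Lf.2; have z2 := Lz.2.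
have F (x : \bar R) : (0 <= x -> x < +oo -> x = (fine x)%:E)%E.
  by move=> x0 xoo; rewrite fineK// ge0_fin_numE.
have If0 : (0 <= \int[mu]_t (`|f t| ^+ 2)%:E)%E.
  by apply: integral_ge0 => t _; rewrite lee_fin sqr_ge0.
have Iz0 : (0 <= \int[mu]_t (`|z t| ^+ 2)%:E)%E.
  by apply: integral_ge0 => t _; rewrite lee_fin sqr_ge0.
have Ip0 : (0 <= \int[mu]_t `|p t|%:E)%E by apply: integral_ge0.
pose B := 2 * fine (\int[mu]_t (`|f t| ^+ 2)%:E)%E + 2 * fine (\int[mu]_t (`|z t| ^+ 2)%:E)%E.
have B0 : 0 <= B by rewrite addr_ge0// mulr_ge0// fine_ge0.
have KB r : (shift_modulus K r <= B%:E)%E.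
  apply: le_trans (pairing_modulus_bound r Lf Lz) _.
  by rewrite (F _ If0 f2) (F _ Iz0 z2) -!EFinM -EFinD.
have KA : (\int[mu]_t `|K (t, t)|%:E <= (fine (\int[mu]_t `|p t|%:E)%E)%:E)%E.
  by rewrite -(F _ Ip0)//; exact: L1_abs.
exists (fine (\int[mu]_t `|p t|%:E)%E); split; first exact: fine_ge0.
by exists B.
Qed.

Lemma measurable_pairing_cv k : mT k -> mT (fun t => cv k (fun s => f s (z t)) t).
Proof.
move=> mk.
suff m2 : measurable_fun setT (fun q : RR => k (q.1 - q.2) * f q.2 (z q.1)).
  exact: (measurable_param_Rintegral mu m2).
apply: measurable_funM.
  by apply: measurableT_comp => //; exact: measurable_funB.
have := measurableT_comp mK (@measurable_swap _ _ (measurableTypeR R) (measurableTypeR R)).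
by [].
Qed.

Section fixed_e.
Variable e : R.
Hypothesis e0 : 0 < e.

Let mmk : mT (mk e). Proof. exact: (measurable_mk alpha T e). Qed.
Let imk : L1 (mk e). Proof. exact: L1_mk. Qed.
Let cmk : causal (mk e). Proof. exact: causal_mk. Qed.
Let mk0 x : 0 <= mk e x. Proof. exact: mk_ge0. Qed.
Let mhk : mT (hk e). Proof. exact: measurable_hk. Qed.
Let ihk : L1 (hk e). Proof. exact: L1_hk. Qed.
Let chk : causal (hk e). Proof. exact: causal_hk. Qed.

Let P t : R := cv (hk e) (fun s => f s (z t)) t.

Let PE_cst phi : {ae mu, forall t, 0 < t < T ->
  c e * v t phi - cv (mk e) (fun s => v s phi) t = cv (hk e) (fun s => f s phi) t}.
Proof.
have vf := fractional_integral_of alpha01 T0 (iv phi) (@cv_ phi) (if_ phi) (@cf phi) (fv phi).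
apply: (aeS2 _ vf (hk_cv1 alpha01 T0 e0 (if_ phi) (@cf phi))) => t vt hk1 tT.
rewrite (hk1 tT) (vt tT); congr (_ - _).
apply: (cv_local cmk (@cv_ phi) _ vf); first exact: (causal_cv cg (@cf phi)).
by case/andP: tT => _ /ltW.
Qed.

(** The null set in [PE_cst] depends on phi, so z t cannot be substituted directly. For almost every
    t the identity holds along a sequence of vectors tending to z t, and both sides are continuous
    in the vector. *)
Let PE : {ae mu, forall t, 0 < t < T ->
  c e * v t (z t) - cv (mk e) (fun s => v s (z t)) t = P t}.
Proof.
apply: (aeS3 _ (strong_dense_ae sz PE_cst) (ae_acv ihk (L1_norm_L2 Lf fT))
  (ae_acv imk (L1_norm_L2 Lv vT))) => t [s Ps sc] h1 h2 tT.
have l1 := cv_dual_cvg mmk sv h2 sc.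
have l2 := cv_dual_cvg mhk sf h1 sc.
have l3 : (v t (s n) : R) @[n --> \oo] --> (v t (z t) : R).
  by apply: (cvg_dual (f_ := fun=> v t)) => //; exact: cvg_cst.
have l4 : c e * v t (s n) - cv (mk e) (fun r => v r (s n)) t @[n --> \oo] -->
    c e * v t (z t) - cv (mk e) (fun r => v r (z t)) t.
  by apply: cvgB => //; apply: cvgM => //; exact: cvg_cst.
apply: (cvg_unique _ l4); first exact: Rhausdorff.
by apply: cvg_trans l2; apply: near_eq_cvg; near=> n; rewrite /= Ps.
Unshelve. all: by end_near. Qed.

Let mP : mT P. Proof. exact: measurable_pairing_cv. Qed.

Let P_close : (\int[mu]_t `|P t - p t|%:E < +oo)%E.
Proof.
have [A [A0 [B [B0 [KA KB]]]]] := K_bound.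
(* A crude use with e = B: only finiteness is wanted here, to conclude that P is integrable. *)
have := @mollification_error _ (hk e) K _ B T B mK ihk chk
  (@hk_ge0 _ _ T alpha01 _ e0) (@integral_hk_le1 _ _ _ alpha01 T0 _ e0) A0 B0 B0 KA KB
  (fun r _ => KB r).
by move=> H; apply: le_lt_trans H _; rewrite ltry.
Qed.

Let iPp : L1 (fun t => P t - p t).
Proof.
apply/integrableP; split; last exact: P_close.
by apply/measurable_EFinP; exact: measurable_funB.
Qed.

Let iP : L1 P.
Proof.
have := integrableD measurableT iPp ip; apply: eq_integrable => // t _.
by rewrite /= -EFinD subrK.
Qed.

Let cP : causal P.
Proof.
move=> t t0; rewrite /P; apply: (causal_cv chk _ t0); exact: cf.
Qed.

Let imkh : L1 (cv (mk e) h). Proof. exact: L1_cv. Qed.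
Let iq : L1 (fun t => c e * h t - cv (mk e) h t).
Proof.
have := integrableB measurableT (integrableZl measurableT (c e) ih) imkh.
by apply: eq_integrable => // t _; rewrite /= EFinB EFinM.
Qed.
Let cq : causal (fun t => c e * h t - cv (mk e) h t).
Proof. by move=> t t0; rewrite ch// (causal_cv cmk ch)// mulr0 subrr. Qed.

(* The Marchaud difference of [s |-> v s (z t)] at t dominates that of h: the
   gap between them at s = t is D >= 0, multiplied by [c e - cv (mk e) one t >= 0]. *)
Let P_ge : {ae mu, forall t, 0 < t < T -> c e * h t - cv (mk e) h t <= P t}.
Proof.
apply: (aeS3 _ (aeS2 _ PE (ae_acv imk (L1_norm_L2 Lv vT))) (aeS2 _ hv hvv)
  (ae_acv imk ih)); last 2 first.
- by move=> t H1 H2; exact: (conj H1 H2).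
- by move=> t H1 H2; exact: (conj H1 H2).
move=> t [PEt mkv] [hvt hvvt] mkh tT.
have tT' : t <= T by case/andP: tT => _ /ltW.
rewrite -(PEt tT); set D := v t (z t) - h t.
have D0 : 0 <= D by rewrite subr_ge0 hvt.
have mo : mT one by exact: measurable_one.
have co : causal one by exact: causal_cut.
have mv : mT (fun s => v s (z t)) by exact: L1_mT (iv _).
have mko : (acv (mk e) one t < +oo)%E.
  by rewrite (acvC _ mmk mo); apply: (acv_bounded_lty t mo imk (one_le1 T)).
have mkvz : (acv (mk e) (fun s => v s (z t)) t < +oo)%E.
  apply: le_lt_trans (_ : _ <= acv (mk e) (fun s => (`|z t| * `|v s|)%R) t)%E _.
    apply: acv_le => //; first by apply: measurable_funM => //; exact: measurable_norm_strong.
    by move=> s; rewrite [X in _ <= X]ger0_norm ?mulr_ge0// mulrC; exact: dual_le.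
  rewrite (_ : acv _ _ _ = (`|z t|%:E * acv (mk e) (fun s => `|v s|%R) t)%E).
    by rewrite lte_mul_pinfty.
  rewrite /acv -ge0_integralZl//.
    by apply: eq_integral => s _; rewrite -EFinM !normrM !normr_id mulrCA.
  by apply: measurable_acvker => //; exact: measurable_norm_strong.
(* The sum D + h s on (0, T), written with a double sign to fit [cvBZr]. *)
have mD : mT (fun s => D * one s - (- h s)).
  by apply: measurable_funB; [exact: measurable_funM|exact: measurable_funN].
have mNh : mT (fun s => - h s) by exact: measurable_funN.
have aNh : (acv (mk e) (fun s => (- h s)%R) t < +oo)%E.
  by apply: le_lt_trans mkh; apply: acv_le => // s; rewrite normrN.
(* The subgradient inequality at t reads v s (z t) <= D + h s, and the weight [mk e] is
   nonnegative. *)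
have le1 : cv (mk e) (fun s => v s (z t)) t <= cv (mk e) (fun s => D * one s - (- h s)) t.
  apply: (cv_le_ae (T := T)) => //.
  - by move=> x x0; rewrite co// ch// mulr0 oppr0 subrr.
  - apply: le_lt_trans (_ : _ <= acv (mk e) (fun s => (D * one s)%R) t + acv (mk e) h t)%E _.
      rewrite (_ : (fun s => D * one s - (- h s)) = (fun s => D * one s + h s)).
        by apply: acvD_le => //; exact: measurable_funM.
      by apply/funext => s; rewrite opprK.
    rewrite lte_add_pinfty// (acvC _ mmk); last exact: measurable_funM.
    apply: (@acv_bounded_lty _ _ _ _ D) => //; first exact: measurable_funM.
    by move=> x; rewrite normrM (ger0_norm D0) ler_piMr// one_le1.
  - apply: (aeS _ (hvvt tT)) => s H sT; have := H sT; rewrite dual_subE /D /one (cutE _ sT) /= mulr1.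
    set a := v s _; set b := v t _ => H1; have : (h t - h s <= b - a :> R) by []; lra.
rewrite (cvBZr D mmk mo mNh mko aNh) in le1.
have NE : cv (mk e) (fun s => - h s) t = - cv (mk e) h t.
  have := cvBZr 0 mmk mo mh mko mkh; rewrite mul0r sub0r => <-.
  by congr (cv _ _ _); apply/funext => s; rewrite mul0r sub0r.
(* This difference is [gke e t], the kernel frozen at e. *)
have ce : 0 <= c e - cv (mk e) one t.
  have := @gke_ge0 _ _ T alpha01 _ e0 t; rewrite /gke cutE//.
  by rewrite (cvC _ mo mmk).
rewrite NE in le1.
have : 0 <= D * (c e - cv (mk e) one t) by exact: mulr_ge0.
have -> : v t (z t) = D + h t by rewrite /D subrK.
by lra.
Qed.

Let cv_P_ge : {ae mu, forall t, 0 < t < T -> cv (hk e) h t <= cv g P t}.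
Proof.
apply: (aeS3 _ (hk_cv2 alpha01 T0 e0 ih ch) (ae_acv ig iq) (ae_acv ig iP)) => t E h1 h2 tT.
rewrite (E tT); apply: (cv_le_ae mg (L1_mT iq) mP g0 cg cq cP h1 h2 P_ge).
by case/andP: tT => _ /ltW.
Qed.

(** The failure of the chain rule at level e is bounded by two mollification errors, both small in
    L^1 as e -> 0. *)
Lemma chain_rule_defect : {ae mu, forall t, 0 < t < T ->
  ((h t - cv g p t)%:E <= `|cv (hk e) h t - h t|%:E +
     acv g (fun s => (cv (hk e) (fun r => f r (z s)) s - p s)%R) t)%E}.
Proof.
apply: (aeS3 _ cv_P_ge (ae_acv ig iP) (ae_acv ig ip)) => t le1 h1 h2 tT.
have := abs_cv_le t mg (L1_mT iPp).
rewrite (_ : cv g _ t = cv g P t - cv g p t); last first.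
  rewrite -[X in X - _]mul1r -(cvBZr 1 mg mP mp h1 h2).
  by congr (cv _ _ _); apply/funext => s; rewrite mul1r.
move=> H; apply: le_trans (leeD2l _ H); rewrite -EFinD lee_fin.
have := le1 tT; have := ler_norm (cv g P t - cv g p t).
have := ler_norm (h t - cv (hk e) h t); rewrite distrC; lra.
Qed.

End fixed_e.


(** Mollification converges in L^1, with no pointwise limit at hand. The positive part D of the
    defect is independent of e, so the L^1 bounds force its integral to be 0. *)
Lemma fractional_chain_rule_ae : {ae mu, forall t, 0 < t < T -> h t <= cv g p t}.
Proof.
pose e_ (n : nat) : R := n.+1%:R^-1.
have e0_ n : 0 < e_ n by rewrite invr_gt0.
have ec : e_ n @[n --> \oo] --> 0 by exact: cvg_harmonic.
pose G := fine (\int[mu]_s `|g s|%:E)%E.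
have GE : (\int[mu]_s `|g s|%:E)%E = G%:E.
  rewrite /G fineK//; apply/fin_real/andP; split; last exact: (L1_abs ig).
  by apply: (@lt_le_trans _ _ 0%E) => //; exact: integral_ge0.
have G0 : 0 <= G by apply: fine_ge0; exact: integral_ge0.
pose Q (n : nat) t := cv (hk (e_ n)) (fun r => f r (z t)) t - p t.
have Q_small e : 0 < e -> exists N, forall n, (N <= n)%N ->
    (\int[mu]_t `|Q n t|%:E <= e%:E)%E.
  have [A [A0 [B [B0 [KA KB]]]]] := K_bound.
  exact: (mollification_limit alpha01 T0 e0_ ec mK A0 B0 KA KB
    (fun e e0 => pairing_modulus_small T0 Lf fT Lz e0)).
pose H := fine (\int[mu]_s `|h s|%:E)%E.
have HE : (\int[mu]_s `|h s|%:E)%E = H%:E.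
  rewrite /H fineK//; apply/fin_real/andP; split; last exact: (L1_abs ih).
  by apply: (@lt_le_trans _ _ 0%E) => //; exact: integral_ge0.
have H0 : 0 <= H by apply: fine_ge0; exact: integral_ge0.
have h_small e : 0 < e -> exists N, forall n, (N <= n)%N ->
    (\int[mu]_t `|cv (hk (e_ n)) h t - h t|%:E <= e%:E)%E.
  (* Mollifying h itself is the case of a kernel that is constant in its second variable. *)
  have mKh : measurable_fun setT (fun q : RR => h q.1) by exact: measurableT_comp.
  apply: (mollification_limit (B := H + H) alpha01 T0 e0_ ec mKh H0).
  - exact: addr_ge0.
  - by rewrite /= HE.
  - move=> r; rewrite /shift_modulus /=.
    have mah : measurable_fun [set: R] (fun t => `|h t|%:E).
      by apply/measurable_EFinP; exact: measurableT_comp.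
    have mhr : mT (fun t => h (t - r)).
      by apply: measurableT_comp => //; exact: measurable_funB.
    have mahr : measurable_fun [set: R] (fun t => `|h (t - r)|%:E).
      by apply/measurable_EFinP; exact: measurableT_comp.
    apply: (@le_trans _ _ (\int[mu]_t (`|h (t - r)|%:E + `|h t|%:E))%E).
      apply: ge0_le_integral => //.
      - by apply/measurable_EFinP; apply: measurableT_comp => //; exact: measurable_funB.
      - exact: emeasurable_funD.
      - by move=> t _; rewrite -EFinD lee_fin ler_normB.
    by rewrite ge0_integralD// (integral_shift r mah) HE.
  - by move=> e' e'0; exact: (translation_L1 T0 ih hT e'0).
pose D := tcut T (fun t => Num.max (h t - cv g p t) 0).
have igp : L1 (cv g p) by exact: L1_cv.
have mD : mT D.
  apply: measurable_cut; apply: measurable_funTS; apply: measurable_maxr => //.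
  by apply: measurable_funB => //; exact: L1_mT.
have D0 t : 0 <= D t by rewrite /D /tcut; case: ifP => // _; rewrite le_max lexx orbT.
have D_le n : (\int[mu]_t (D t)%:E <=
    \int[mu]_t `|cv (hk (e_ n)) h t - h t|%:E + G%:E * \int[mu]_t `|Q n t|%:E)%E.
  have ihk : L1 (hk (e_ n)) by exact: L1_hk.
  have mhkn : mT (hk (e_ n)) by exact: L1_mT.
  have mQ : mT (Q n) by apply: measurable_funB => //; exact: (measurable_pairing_cv mhkn).
  have mhh : mT (fun t => cv (hk (e_ n)) h t - h t).
    by apply: measurable_funB => //; exact: measurable_cv.
  have mahh : measurable_fun [set: R] (fun t => `|cv (hk (e_ n)) h t - h t|%:E).
    by apply/measurable_EFinP; exact: measurableT_comp.
  have mag : measurable_fun [set: R] (acv g (Q n)) by exact: measurable_acv.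
  rewrite -GE -(integral_acv mg mQ) -ge0_integralD//; last first.
    by move=> t _; exact: acv_ge0.
  apply: ae_ge0_le_integral => //.
  - by move=> t _; rewrite lee_fin.
  - exact/measurable_EFinP.
  - by move=> t _; apply: adde_ge0 => //; exact: acv_ge0.
  - exact: emeasurable_funD.
  - apply: (aeS _ (chain_rule_defect (e0_ n))) => t Ht _.
    rewrite /D /tcut; case: (boolP (0 < t < T)) => tT; last first.
      by apply: adde_ge0 => //; exact: acv_ge0.
    rewrite EFin_max ge_max Ht//=.
    by apply: adde_ge0 => //; exact: acv_ge0.
have ID0 : (\int[mu]_t (D t)%:E = 0)%E.
  apply/eqP; rewrite eq_le integral_ge0 ?andbT; last by move=> t _; rewrite lee_fin.
  apply/lee_addgt0Pr => e e0; rewrite add0e.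
  have e2 : 0 < e / 2 by rewrite divr_gt0.
  have eG : 0 < e / 2 / (G + 1) by rewrite divr_gt0// ltr_wpDl.
  have [N1 hN1] := h_small _ e2; have [N2 hN2] := Q_small _ eG.
  have h1 := hN1 _ (leq_maxl N1 N2); have h2 := hN2 _ (leq_maxr N1 N2).
  apply: le_trans (D_le _) _; rewrite [leRHS](_ : _ = (e / 2)%:E + (e / 2)%:E)%E; last first.
    by rewrite -EFinD -splitr.
  apply: leeD h1 _; apply: (@le_trans _ _ (G%:E * (e / 2 / (G + 1))%:E)%E).
    by rewrite lee_wpmul2l ?lee_fin.
  rewrite -EFinM lee_fin mulrCA ler_piMr ?(ltW e2)// ler_pdivrMr ?mul1r ?lerDl//.
  by rewrite ltr_wpDl.
have aD : (\int[mu]_t `|(D t)%:E| = 0)%E.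
  by rewrite -[RHS]ID0; apply: eq_integral => t _; rewrite /= ger0_norm.
have mED : measurable_fun [set: R] (EFin \o D) by exact/measurable_EFinP.
have [+ _] := ae_eq_integral_abs mu measurableT mED.
move=> /(_ aD) H1; apply: (aeS _ H1) => t /(_ I)/= DE tT.
have : D t = 0 by case: DE.
by rewrite /D cutE// => Dt; rewrite -subr_le0 -Dt le_max lexx.
Qed.

Variable C : R.
Hypothesis hC : {ae mu, forall t, 0 < t < T -> - C <= h t}.

(** The integrated estimate is claimed at every t, hence finiteness at every t. Almost everywhere h
    lies between - C and g_alpha * p, and g_(1 - alpha) * (g_alpha * p) converges absolutely
    everywhere because the kernels have a bounded convolution. *)
Lemma acv_fractional_lty t : t <= T -> (acv gg h t < +oo)%E.
Proof.
move=> tT; have igp : L1 (cv g p) by exact: L1_cv.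
have mgp := L1_mT igp.
have cgp : causal (cv g p) by exact: causal_cv.
have mo : mT one by exact: measurable_one.
have co : causal one by exact: causal_cut.
have mCo : mT (fun s => `|C| * one s) by exact: measurable_funM.
have man : mT (fun s => `|cv g p s|) by exact: measurableT_comp.
apply: le_lt_trans (_ : _ <= acv gg (fun s => (`|C| * one s + `|cv g p s|)%R) t)%E _.
  apply: (acv_le_ae mgg mh _ cgg ch _ _ tT).
  - exact: measurable_funD.
  - by move=> x x0; rewrite co// cgp// normr0 mulr0 addr0.
  - apply: (aeS2 _ hC fractional_chain_rule_ae) => s h1 h2 sT.
    rewrite /one (cutE _ sT) /= mulr1 [leRHS]ger0_norm ?addr_ge0//.
    have := h1 sT; have := h2 sT; have := ler_norm (cv g p s); have := ler_norm C.
    have := normr_ge0 C; have := normr_ge0 (cv g p s).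
    by rewrite ler_norml => *; apply/andP; split; lra.
have HD := acvD_le t mgg mCo man.
apply: (le_lt_trans HD); apply: lte_add_pinfty.
  rewrite (acvC _ mgg mCo).
  have Co x : `| `|C| * one x| <= `|C| by rewrite normrM normr_id ler_piMr// one_le1.
  by apply: (acv_bounded_lty t mCo (L1_gk T0 alpha'01) Co).
have h3 : (acv3 gg g p t < +oo)%E by apply: acv3_gk.
apply: (@le_lt_trans _ _ _ _ _ _ h3); have h4 := acv_cv_le t mgg mg mp.
apply: (@le_trans _ _ _ _ _ _ h4).
by apply: acv_le => // s; rewrite normr_id.
Qed.

Lemma fractional_chain_rule t : 0 < t < T ->
  cv gg h t <= \int[mu]_s tcut t p s.
Proof.
move=> /andP[t0 tT]; have igp : L1 (cv g p) by exact: L1_cv.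
have tT' : 0 < t <= T by rewrite t0 ltW.
rewrite -(cv_gk_gk alpha01 ip cp tT').
apply: (cv_le_ae mgg mh (L1_mT igp) gg0 cgg ch _ _ _ fractional_chain_rule_ae (ltW tT)).
- exact: causal_cv.
- exact: acv_fractional_lty (ltW tT).
- have h3 : (acv3 gg g p t < +oo)%E by apply: acv3_gk.
  by apply: (@le_lt_trans _ _ _ _ _ _ h3); exact: acv_cv_le.
Qed.

End fractional_chain_rule.

(** * Convex energies on a Gelfand triple *)

Section shifted_convex.
Context {R : realType}.

(** Convexity bounds the difference quotients at b along the segment towards a by f a - f b; the
    step then tends to 0 from the right. *)
Lemma convex_gradient_le (f : R -> R) (a b D : R) :
  (forall a b t : R, 0 <= t <= 1 -> f (t * a + (1 - t) * b) <= t * f a + (1 - t) * f b) ->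
  is_derive b (1 : R) f D -> f b - f a <= D * (b - a).
Proof.
move=> cf df.
have df' : is_derive (0 * (a - b) + b) (1 : R) f D by rewrite mul0r add0r.
have da : is_derive (0 : R) (1 : R) (fun y : R => y * (a - b) + b) (a - b).
  have := is_derive_affine (a - b) b 0.
  rewrite (_ : (fun y : R => y * (a - b) + b) = (fun y : R => (a - b) * y + b))//.
  by apply/funext => y; rewrite mulrC.
have dc := @is_derive1_comp _ f (fun y : R => y * (a - b) + b) (0 : R) _ _ df' da.
have dd : derivable (f \o (fun y : R => y * (a - b) + b)) 0 1 by exact: ex_derive.
have cd : h^-1 *: ((f \o (fun y : R => y * (a - b) + b)) (h *: 1 + 0)
    - (f \o (fun y : R => y * (a - b) + b)) 0) @[h --> (0 : R)^'] --> D * (a - b).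
  have := derive_val (is_derive := dc); rewrite /derive => <-.
  exact: dd.
have cd' := cvg_dnbhs_at_right cd.
rewrite -lerN2 opprB -mulrN opprB.
apply: (cvgr_to_le cd').
near=> h.
have h0 : 0 < h by near: h; exact: nbhs_right_gt.
have h1 : h < 1 by near: h; exact: nbhs_right_lt.
rewrite /GRing.scale/= mulr1 addr0 mul0r add0r ler_pdivrMl//.
have h01 : 0 <= h <= 1 by rewrite !ltW.
have := cf a b h h01.
rewrite (_ : h * a + (1 - h) * b = h * (a - b) + b); last by ring.
by lra.
Unshelve. all: by end_near. Qed.

Variables (E : R -> R^o) (l : R).
Hypothesis C1E : C1 E.
Hypothesis convE : lambda_convex l E.

Definition cshift (x : R) : R := E x - l / 2 * x ^+ 2.

Lemma cshift_conv (a b t : R) : 0 <= t <= 1 ->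
  cshift (t * a + (1 - t) * b) <= t * cshift a + (1 - t) * cshift b.
Proof.
move=> /andP[t0 t1].
pose tt : {i01 R} := Itv01 t0 t1.
have ina : a \in [set: convex_lmodType R^o] by rewrite inE.
have inb : b \in [set: convex_lmodType R^o] by rewrite inE.
by have := convE tt ina inb; rewrite /cshift !real_normK ?num_real.
Qed.

Lemma is_derive_cshift (x : R) :
  is_derive x (1 : R) cshift (derive1 E x - l * x).
Proof.
have dE : is_derive x (1 : R) (E : R -> R) (derive1 E x).
  by apply: DeriveDef; [exact: C1E.1|rewrite derive1E].
have dX : is_derive x (1 : R) (fun y : R => l / 2 * y ^+ 2) (l * x).
  have h : is_derive x (1 : R) (fun y : R => y * (l / 2 * y)) (l * x).
    have h1 := is_derive_id x (1 : R).
    have h2 : is_derive x (1 : R) (fun y : R => l / 2 * y) (l / 2).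
      by have := is_derive_affine (l / 2) 0 x; under eq_fun do rewrite addr0.
    have h3 := is_deriveM h1 h2; apply: (is_derive_eq h3).
    by rewrite /GRing.scale/=; field.
  by have -> : (fun y : R => l / 2 * y ^+ 2) = (fun y : R => y * (l / 2 * y))
    by apply/funext => y; ring.
exact: is_deriveB.
Qed.

Lemma cshift_gradient_le (a b : R) :
  cshift b - cshift a <= (derive1 E b - l * b) * (b - a).
Proof.
apply: convex_gradient_le; last exact: is_derive_cshift.
by move=> x y t; exact: cshift_conv.
Qed.

Lemma continuous_cshift : continuous cshift.
Proof.
move=> x; apply: differentiable_continuous; apply/derivable1_diffP.
exact: (ex_derive (is_derive := is_derive_cshift x)).
Qed.

End shifted_convex.

(** * Integrals of functions with an integrable upper bound *)

Section almost_everywhere_integrals.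
Context d (O : measurableType d) (R : realType) (m : {measure set O -> \bar R}).
Local Notation L1m f := (m.-integrable setT (EFin \o f)).
Implicit Types f k : O -> R.

(** The upper bound makes the positive part integrable, so it is the negative part that has infinite
    integral. *)
Lemma integral_ninfty f k : measurable_fun setT f -> L1m k ->
  {ae m, forall x, f x <= k x} -> ~ L1m f -> (\int[m]_x (f x)%:E = -oo)%E.
Proof.
move=> mf ik fk nf.
have mEf : measurable_fun setT (EFin \o f) by exact/measurable_EFinP.
have mk : measurable_fun setT (EFin \o k) by exact: measurable_int ik.
have fp : (\int[m]_x (EFin \o f)^\+ x < +oo)%E.
  have /integrableP[_ kfin] := ik.
  apply: le_lt_trans kfin; apply: ae_ge0_le_integral => //.
  - exact: measurable_funepos.
  - exact: measurableT_comp.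
  - apply: (aeS _ fk) => x h _; rewrite funeposE ge_max /= !lee_fin.
    by rewrite normr_ge0 andbT (le_trans h)// ler_norm.
rewrite integralE [X in (_ - X)%E](_ : _ = +oo%E).
  have : (0 <= \int[m]_x (EFin \o f)^\+ x)%E by exact: integral_ge0.
  by case: (\int[m]_x _)%E fp.
apply/eqP; rewrite eq_le leey/= leNgt; apply/negP => fn; apply: nf.
apply/integrableP; split => //.
have -> : (\int[m]_x `|(EFin \o f) x| = \int[m]_x ((EFin \o f)^\+ x + (EFin \o f)^\- x))%E.
  by have := fune_abse (EFin \o f) => H; apply: eq_integral => x _; rewrite -[LHS]/((abse \o (EFin \o f)) x) H.
rewrite ge0_integralD//; [exact: lte_add_pinfty|exact: measurable_funepos|exact: measurable_funeneg].
Qed.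

Lemma ae_le_Rintegral f k : L1m f -> L1m k -> {ae m, forall x, f x <= k x} ->
  \int[m]_x f x <= \int[m]_x k x.
Proof.
move=> jf jk fk; rewrite -subr_ge0 -RintegralB//.
rewrite (_ : (\int[m]_x _) = \int[m]_x `|k x - f x|).
  by apply: Rintegral_ge0.
congr fine; apply: integral_ae_congr; apply: (aeS _ fk) => x h _.
by congr EFin; rewrite ger0_norm// subr_ge0.
Qed.

End almost_everywhere_integrals.

(** * Energy differences and the L^2 pairing *)

Section energy.
Context d (O : measurableType d) (R : realType) (m : {measure set O -> \bar R}).
Local Notation L1m f := (m.-integrable setT (EFin \o f)).
Variables (V : normedModType R) (i : gelfand_triple m V).
Implicit Types (h : LspaceType2 m) (v z : V).

Lemma measurable_L2 h : measurable_fun setT (h : O -> R).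
Proof.
exact: (@measurable_funPT _ _ _ _ (repr (h : {mfun_ m, O >-> measurableTypeR R}))).
Qed.

Lemma integrable_L2M h h' : L1m (fun x => h x * h' x).
Proof.
have LE (f : LspaceType2 m) : (f : O -> R) \in Lfun m 2%:E.
  have mf := measurable_L2 f.
  by rewrite inE; apply/andP; split; rewrite inE//=; exact: Lebesgue_finite.
by apply/Lfun1_integrable; exact: Lfun2_mul_Lfun1.
Qed.

Lemma L2norm_sqr h : L2norm m h ^+ 2 = \int[m]_x (h x ^+ 2).
Proof.
have h0 : (0 <= \int[m]_x (h x ^+ 2)%:E)%E.
  by apply: integral_ge0 => x _; rewrite lee_fin sqr_ge0.
rewrite /L2norm unlock /Lnorm /Rintegral.
have -> : (\int[m]_x (`|(EFin \o h) x| `^ 2%:R)%E = \int[m]_x (h x ^+ 2)%:E)%E.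
  apply: eq_integral => x _; rewrite /= powR_mulrn//.
  by rewrite real_normK ?num_real.
have fin : (\int[m]_x (h x ^+ 2)%:E)%E \is a fin_num.
  exact: (integrable_fin_num measurableT (integrable_L2M h h)).
rewrite -(fineK fin) /=; set a := fine _.
have a0 : 0 <= a by exact: fine_ge0.
by rewrite -powR_mulrn ?powR_ge0// -powRrM mulVf// powRr1.
Qed.

Lemma L2_dualE h v : L2_dual i h v = \int[m]_x (h x * i v x).
Proof. by []. Qed.

Lemma L2_dualC v z : L2_dual i (i v) z = L2_dual i (i z) v.
Proof. by rewrite !L2_dualE; apply: eq_Rintegral => x _; rewrite mulrC. Qed.

Variables (f df : R -> R).
Hypothesis mf : measurable_fun setT f.
Hypothesis f_df : forall a b, f b - f a <= df b * (b - a).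

Let mfB h h' : measurable_fun setT (fun x => f (h x) - f (h' x)).
Proof.
by apply: measurable_funB; apply: measurableT_comp => //; exact: measurable_L2.
Qed.

Lemma integrable_pairing h h' z : L1m (fun x => i z x * (h x - h' x)).
Proof.
have := integrableB measurableT (integrable_L2M (i z) h) (integrable_L2M (i z) h').
by apply: eq_integrable => // x _; rewrite /= -EFinB mulrBr.
Qed.

Let pairE h h' z : \int[m]_x (i z x * (h x - h' x)) = L2_dual i h z - L2_dual i h' z.
Proof.
rewrite !L2_dualE -RintegralB//; try exact: integrable_L2M.
by apply: eq_Rintegral => x _; ring.
Qed.

Lemma energy_ae_le h h' z : i z = df \o h %[ae m] ->
  {ae m, forall x, f (h x) - f (h' x) <= i z x * (h x - h' x)}.
Proof. by apply: filterS => x /(_ I) ->; exact: f_df. Qed.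

Lemma energy_le h h' z : i z = df \o h %[ae m] ->
  L1m (fun x => f (h x) - f (h' x)) ->
  \int[m]_x (f (h x) - f (h' x)) <= L2_dual i h z - L2_dual i h' z.
Proof.
move=> zh ih; rewrite -pairE; apply: ae_le_Rintegral => //.
  exact: integrable_pairing.
exact: energy_ae_le.
Qed.

(** The subgradient inequality at h bounds the difference from above and the one at h' from below,
    in both cases by a product of L^2 functions. At u0 no gradient in V is given, so the comparison
    with u0 has an upper bound only. *)
Lemma energy_integrable h h' z z' : i z = df \o h %[ae m] ->
  i z' = df \o h' %[ae m] -> L1m (fun x => f (h x) - f (h' x)).
Proof.
move=> zh zh'.
have iD := integrableD measurableT (integrable_abse (integrable_pairing h h' z))
  (integrable_abse (integrable_pairing h' h z')).
pose k x := `|i z x * (h x - h' x)| + `|i z' x * (h' x - h x)|.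
have ik : L1m k by apply: eq_integrable iD.
apply/integrableP; split; first by apply/measurable_EFinP.
have /integrableP[_] := ik; apply: le_lt_trans; apply: ae_ge0_le_integral => //.
- by apply/measurable_EFinP; exact: measurableT_comp.
- by apply: measurableT_comp => //; exact: measurable_int ik.
- apply: (aeS2 _ (energy_ae_le h' zh) (energy_ae_le h zh')) => x h1 h2 _.
  rewrite /= lee_fin [leRHS]ger0_norm ?addr_ge0//.
  move: h1 h2; rewrite -[f (h' x) - _]opprB.
  set a := f (h x) - f (h' x); set b := i z x * _; set c := i z' x * _ => ab ac.
  rewrite -[k x]/(`|b| + `|c|) ler_norml lerNl; apply/andP; split.
    by rewrite (le_trans ac)// (le_trans (ler_norm c))// lerDr.
  by rewrite (le_trans ab)// (le_trans (ler_norm b))// lerDl.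
Qed.

End energy.

Section zero_extension.
Context {R : realType} (X : normedModType R).

Lemma zext_in (T : R) (f : measurableTypeR R -> X) t : 0 < t < T -> zext `]0, T[ f t = f t.
Proof. by move=> tT; rewrite zextE//= in_itv. Qed.

Lemma zext_out (T : R) (f : measurableTypeR R -> X) t : ~~ (0 < t < T) ->
  zext `]0, T[ f t = 0.
Proof. by move=> tT; rewrite zextN//= in_itv/=; exact/negP. Qed.

End zero_extension.

Section L2_functions.
Context {R : realType} (X : normedModType R).
Local Notation mu := (@lebesgue_measure R).
Implicit Types f z : measurableTypeR R -> X.

Lemma L2fun_zext (T : R) f : bochner_Lp 2%:E T f -> L2fun (zext `]0, T[ f).
Proof.
move=> /bochner_L2[sf f2]; split; first exact: strong_zext.
apply: le_lt_trans f2; rewrite [leRHS]integral_mkcond le_eqVlt; apply/orP; left.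
apply/eqP; apply: eq_integral => t _; rewrite patchE; case: ifPn => [/set_mem tT|tT].
  by rewrite zextE.
by rewrite zextN ?normr0 ?expr0n//= => tT'; move/negP: tT; apply; exact: mem_set.
Qed.

Lemma L2fun_sub (a : R) f z : L2fun f -> L2fun z -> L2fun (fun t => f t - a *: z t).
Proof.
move=> Lf Lz; have [sf _] := Lf; have [sz _] := Lz.
have sfz := strong_lin a sf sz; split => //.
have jf := integrableZl measurableT 2 (L2fun_sqr Lf).
have jz := integrableZl measurableT (2 * a ^+ 2) (L2fun_sqr Lz).
have /integrableP[_] := integrableD measurableT jf jz; apply: le_lt_trans.
apply: ge0_le_integral => //.
- by apply/measurable_EFinP; apply: measurable_funX; exact: measurable_norm_strong.
- by apply: measurableT_comp => //; exact: measurable_int (integrableD measurableT jf jz).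
- move=> t _; rewrite /= lee_fin [leRHS]ger0_norm; last first.
    by apply: addr_ge0; [apply: mulr_ge0 => //; exact: sqr_ge0|apply: mulr_ge0; [apply: mulr_ge0 => //|]; exact: sqr_ge0].
  apply: (@le_trans _ _ ((`|f t| + `|a| * `|z t|) ^+ 2)).
    rewrite ler_pXn2r ?nnegrE ?addr_ge0 ?mulr_ge0//.
    by rewrite -normrZ ler_normB.
  rewrite -(real_normK (num_real a)).
  have := sqr_ge0 (`|f t| - `|a| * `|z t|); rewrite !expr2 => ?; nra.
Qed.

Lemma L2fun_bounded (T M : R) f : 0 < T -> strongly_measurable `]0, T[ f ->
  {ae mu, forall t, 0 < t < T -> `|f t| <= M} -> L2fun (zext `]0, T[ f).
Proof.
move=> T0 sf fM; have szf := strong_zext (measurable_itv `]0, T[) sf; split => //.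
have /integrableP[_] := integrableZl measurableT (M ^+ 2) (L1_one T).
apply: le_lt_trans; apply: ae_ge0_le_integral => //.
- by apply/measurable_EFinP; apply: measurable_funX; exact: measurable_norm_strong.
- apply: measurableT_comp => //.
  exact: measurable_int (integrableZl measurableT (M ^+ 2) (L1_one T)).
- apply: (aeS _ fM) => t H _; have [tT|tT] := boolP (0 < t < T); last first.
    by rewrite zext_out// normr0 expr0n; exact: abse_ge0.
  have M0 : 0 <= M by exact: le_trans (H tT).
  rewrite zext_in//=.
  by rewrite /one cutE//= mulr1 lee_fin [leRHS]ger0_norm ?sqr_ge0// ler_pXn2r ?nnegrE ?H.
Qed.

End L2_functions.

(** * The Caputo derivative paired with a vector *)

Section caputo_pairing.
Context {R : realType} (V : normedModType R).
Local Notation mu := (@lebesgue_measure R).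
Variables (alpha T : R) (U D : measurableTypeR R -> dual V) (U0 : dual V).
Hypothesis T0 : 0 < T.
Hypothesis LD : bochner_Lp 2%:E T D.
Hypothesis cap : caputo_derivative alpha T U U0 D.

Let fin (t : R) : (mu `]0%R, t[%classic < +oo)%E.
Proof. by rewrite lebesgue_measure_itv/=; case: ifP => _; rewrite ?ltry. Qed.

Let ev_bound (phi : V) (x : dual V) : `|x phi : R| <= `|phi| * `|x|.
Proof. by rewrite mulrC; exact: dual_le. Qed.

Let ev_lin (phi : V) (a : R) (x y : dual V) : (a *: x + y) phi = a * x phi + y phi :> R.
Proof. by []. Qed.

Let ev_cont (phi : V) (x : dual V) : (fun y : dual V => y phi : R) @ x --> (x phi : R).
Proof.
have FF : Filter (nbhs x) by exact: nbhs_filter.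
apply/(@cvgrPdist_le _ _ _ (nbhs x) FF) => e e0.
have d0 : 0 < e / (`|phi| + 1) by rewrite divr_gt0// ltr_wpDl.
have N : nbhs x [set y | `|x - y| <= e / (`|phi| + 1)].
  apply/(@nbhs_normP _ (dual V)); exists (e / (`|phi| + 1)) => //= y /ltW.
  exact.
apply: (@filterS _ _ FF _ _ _ N) => y /= H.
apply: (@le_trans _ _ (`|phi| * `|x - y|)); first exact: (ev_bound phi (x - y)).
move: H; rewrite ler_pdivlMr ?ltr_wpDl// => H; apply: le_trans H.
by rewrite mulrC ler_wpM2l// lerDl.
Qed.

(** Evaluation at phi makes the weak derivative scalar, so [weak_primitive] identifies the
    continuous representative k, which equals the convolution for almost every t. *)
Lemma caputo_pairing (phi : V) : {ae mu, forall t, 0 < t < T ->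
  cv (gk T (1 - alpha)) (fun s => zext `]0, T[ (fun r => U r - U0) s phi) t =
  \int[mu]_s tcut t (fun r => zext `]0, T[ D r phi) s}.
Proof.
have [k [kb kc k0 kw]] := cap.
have BF := @bochner_functional _ (measurableTypeR R) R (dual V) mu
  (fun y : dual V => y phi : R) `|phi| (@ev_lin phi) (normr_ge0 phi) (@ev_bound phi).
have kphi : forall b, 0 < b < T ->
    (k b phi : R) = \int[mu]_s tcut b (fun r => zext `]0, T[ D r phi) s.
  apply: (@weak_primitive _ T (fun t => k t phi) (fun r => zext `]0, T[ D r phi)) => //.
  - move=> x; exact: (cvg_comp _ _ (kc x) (@ev_cont phi (k x))).
  - by rewrite k0.
  - apply: L1_cut; apply: integrableS (L1_dual1 phi (L2fun_zext LD) (zext_out D)) => //.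
  - move=> q tq; have [I [h1 h2]] := kw q tq.
    have [_ E1] := BF _ _ _ (measurable_itv _) (fin T) h1.
    have [_ E2] := BF _ _ _ (measurable_itv _) (fin T) h2.
    rewrite (_ : (- I) phi = - I phi) // in E2.
    rewrite -[X in X = _]/(\int[mu]_(t in `]0, T[) ((derive1 q t *: k t) phi)) E1.
    rewrite -[LHS]opprK -E2; congr (- _); apply: eq_Rintegral => t /set_mem/=.
    by rewrite in_itv => tT; rewrite zext_in.
apply: (aeS _ kb) => t hb tT.
rewrite -(kphi t tT).
have tT' : t \in `]0, T[ by rewrite in_itv.
have [_ <-] := BF _ _ _ (measurable_itv _) (fin t) (hb tT').
rewrite -Rintegral_cut; apply: eq_Rintegral => s _; rewrite /tcut.
move/andP: tT => [t0 tT].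
have [s0|s0] /= := leP s 0.
  by rewrite zext_out ?mulr0// ltNge s0.
have [ts|ts] /= := leP t s.
  by rewrite /gk causal_cut ?mul0r// subr_le0.
rewrite zext_in ?s0 ?(lt_trans ts)//.
by rewrite /gk cutE// subr_gt0 ts ltrBlDr ltr_wpDr// ltW.
Qed.

End caputo_pairing.

(** * Measurability of the energy *)

Section subgradient_measurability.
Context {R : realType} (V : normedModType R).
Local Notation mT a := (measurable_fun [set: R] a).

(** Separability of the range, as a countable family indexed by the approximation n and the rank j
    of one of its finitely many values. *)
Lemma simple_values (X : normedModType R) (f : measurableTypeR R -> X) :
  strongly_measurable setT f -> exists x : nat -> nat -> X,
    forall t (e : R), 0 < e -> exists n, exists j, `|f t - x n j| < e.
Proof.
move=> [s ss sf].
exists (fun n j => nth 0 (fset_set (range (s n))) j) => t e e0.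
have /cvgrPdist_lt/(_ _ e0)[N _ hN] := sf t Logic.I.
have := hN N (leqnn N) => /= H.
exists N; exists (index (s N t) (fset_set (range (s N)))); rewrite nth_index//.
by rewrite in_fset_set; [apply: mem_set; exists t|case: (ss N)].
Qed.

(* On D, h is the infimum of [h s + (U t - U s) (Z t)] over s in a countable
   subset that is dense for [s |-> (U s, Z s)]. *)
Lemma measurable_subgradient (U : measurableTypeR R -> dual V)
    (Z : measurableTypeR R -> V) (h : R -> R) (D : set R) :
  measurable D -> strongly_measurable setT U -> strongly_measurable setT Z ->
  (forall t s, D t -> D s -> h t - h s <= (U t - U s) (Z t)) ->
  (forall t, ~ D t -> h t = 0) -> mT h.
Proof.
move=> mD sU sZ hUZ h0.
have [[t0 Dt0]|D0] := pselect (D !=set0); last first.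
  rewrite (_ : h = cst 0) //; apply/funext => t; apply: h0 => Dt; apply: D0.
  by exists t.
have [x xU] := simple_values sU; have [y yZ] := simple_values sZ.
pose Q (q : (nat * nat) * (nat * nat) * nat) (s : R) :=
  [/\ D s, `|U s - x q.1.1.1 q.1.1.2| < q.2.+1%:R^-1 &
      `|Z s - y q.1.2.1 q.1.2.2| < q.2.+1%:R^-1].
(* The approximating vectors need not be values of U and Z, so each index receives a time in D at
   which U and Z are close to them; t0 is a default in D. *)
pose pick q : R := if pselect (exists s, Q q s) is left e then projT1 (cid e) else t0.
have Dpick q : D (pick q).
  by rewrite /pick; case: pselect => // e; case: (cid e) => s [].
have near_pick t (e : R) : D t -> 0 < e -> exists q,
    `|U (pick q) - U t| <= e /\ `|Z (pick q) - Z t| <= e.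
  move=> Dt e0; have e2 : 0 < e / 2 by rewrite divr_gt0.
  have [k _ Hk] := near_infty_natSinv_lt (PosNum e2).
  have ke : k.+1%:R^-1 < e / 2 by exact: (Hk k (leqnn k)).
  have k0 : 0 < k.+1%:R^-1 :> R by rewrite invr_gt0.
  have [n1 [j1 H1]] := xU t _ k0; have [n2 [j2 H2]] := yZ t _ k0.
  exists ((n1, j1), (n2, j2), k).
  rewrite /pick; case: pselect => [ex|]; last by case; exists t.
  case: (cid ex) => s [/= _ H3 H4]; split.
    rewrite -(subrKA (x n1 j1)) (splitr e); apply: le_trans (ler_normD _ _) _.
    apply: lerD; first exact: (ltW (lt_trans H3 ke)).
    by rewrite distrC; exact: (ltW (lt_trans H1 ke)).
  rewrite -(subrKA (y n2 j2)) (splitr e); apply: le_trans (ler_normD _ _) _.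
  apply: lerD; first exact: (ltW (lt_trans H4 ke)).
  by rewrite distrC; exact: (ltW (lt_trans H2 ke)).
pose G q t := h (pick q) + (U t - U (pick q)) (Z t).
have mG q : mT (G q).
  apply: measurable_funD => //; rewrite (_ : (fun t => _) = fun t => U t (Z t) - U (pick q) (Z t))//.
  apply: measurable_funB; first exact: measurable_dual.
  by apply: (measurable_dual (f := fun=> U (pick q))) => //; apply: strong_simple; exact: simple_cst.
have DE r : D `&` [set t | h t < r] = \bigcup_q (D `&` [set t | G q t < r]).
  apply/seteqP; split => [t [Dt /= htr]|t [q _ [Dt /= Gr]]].
    pose e := Num.min 1 ((r - h t) / 2).
    have e0 : 0 < e by rewrite lt_min ltr01 divr_gt0// subr_gt0.
    have [q [q1 q2]] := near_pick t e Dt e0; exists q => //; split => //=.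
    rewrite /G; set s := pick q.
    (* With the roles of s and t exchanged, the inequality gives G q t <= h t + (U s - U t) (Z s - Z
       t), and the last term is at most e * 1 < r - h t. *)
    have h1 := hUZ s t (Dpick q) Dt.
    have h2 := dual_le (U s - U t) (Z s - Z t).
    have h3 : `|U s - U t| * `|Z s - Z t| <= e * 1.
      by rewrite ler_pM// (le_trans q2)// ge_min lexx.
    have h4 : e <= (r - h t) / 2 by rewrite ge_min lexx orbT.
    have h5 := ler_norm ((U s - U t) (Z s - Z t)).
    move: h1 h2 h5; rewrite !dualB !dual_subE.
    move: (U s (Z s)) (U s (Z t)) (U t (Z s)) (U t (Z t)) => a b c d h1 h2 h5.
    have : h s - h t <= a - c :> R by [].
    have : a - c - (b - d) <= e :> R.
      by apply: le_trans h5 (le_trans h2 _); rewrite -[leRHS]mulr1.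
    by move: htr h4; clear; lra.
  split => //=; apply: le_lt_trans Gr; rewrite /G -lerBlDl; exact: hUZ.
have mDr r : measurable (D `&` [set t | h t < r]).
  rewrite DE; apply: countable_bigcupT_measurable => // q.
  apply: measurableI => //; rewrite -[X in measurable X]setTI.
  by apply: measurable_fun_ltr => //; exact: measurable_cst.
have ME : @measurable _ (measurableTypeR R) = <<s @RGenInftyO.G R >> := RGenInftyO.measurableE R.
apply: (@measurability _ _ (measurableTypeR R) (measurableTypeR R) setT h (@RGenInftyO.G R) ME).
move=> _ [_ [r ->] <-]; rewrite setTI.
rewrite (_ : h @^-1` _ = (D `&` [set t | h t < r]) `|` (~` D `&` [set t : R | 0 < r])).
  apply: measurableU; first exact: mDr.
  apply: measurableI; first exact: measurableC.
  have [r0|r0] := ltP 0 r.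
    by rewrite (_ : [set _ | _] = setT)//; apply/seteqP; split.
  by rewrite (_ : [set _ | _] = set0)//; apply/seteqP; split.
apply/seteqP; split => t /=; rewrite in_itv/=.
  by move=> htr; have [Dt|nDt] := pselect (D t); [left|right; split => //; rewrite -(h0 t nDt)].
by case=> [[]//|[nDt r0]]; rewrite h0.
Qed.

End subgradient_measurability.

(** * Extended-real convolution in time *)

Section time_convolution.
Context {R : realType}.
Local Notation mu := (@lebesgue_measure R).
Local Notation L1 a := (mu.-integrable setT (EFin \o a)).
Local Notation mT a := (measurable_fun [set: R] a).
Implicit Types a b c : R -> R.

Lemma cvDZr a b b' t (k : R) : mT a -> mT b -> mT b' ->
  (acv a b t < +oo)%E -> (acv a b' t < +oo)%E ->
  cv a (fun s => b s + k * b' s) t = cv a b t + k * cv a b' t.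
Proof.
move=> ma mb mb' h h'; rewrite /cv -RintegralZl//; last exact: integrable_cvker.
rewrite -RintegralD//; last 2 first.
- exact: integrable_cvker.
- have := integrableZl measurableT k (integrable_cvker ma mb' h').
  by apply: eq_integrable => // s _; rewrite /= EFinM.
by apply: eq_Rintegral => s _; ring.
Qed.

Variables (T t : R).
Hypothesis tT : 0 < t <= T.

Lemma time_conv_cv (be : R) a (phi : R -> \bar R) : mT a -> causal a ->
  (acv (gk T be) a t < +oo)%E ->
  {ae mu, forall s, 0 < s < T -> phi s = (a s)%:E} ->
  time_conv (gker be) phi t = (cv (gk T be) a t)%:E.
Proof.
move=> ma ca fin pa; have mg := measurable_gk T be.
have /andP[t0 tT'] := tT.
rewrite /cv /Rintegral fineK; last exact: integrable_fin_num (integrable_cvker mg ma fin).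
rewrite /time_conv.
transitivity (\int[mu]_(s in `]0%R, t[) (gk T be (t - s) * a s)%:E)%E.
  apply: integral_ae_congr; apply: (aeS _ pa) => s H; rewrite /= in_itv/= => /andP[s0 st].
  rewrite H ?s0 ?(lt_le_trans st)// -EFinM /gk cutE// subr_gt0 st.
  by rewrite ltrBlDr (le_lt_trans tT')// ltrDl.
rewrite [LHS]integral_mkcond; apply: eq_integral => s _; rewrite patchE.
case: ifPn => // /negP; rewrite -topredE/= => H.
have [s0|s0] := leP s 0; first by rewrite ca// mulr0.
have [ts|ts] := leP t s; first by rewrite /gk causal_cut ?mul0r// subr_le0.
by exfalso; apply: H; apply: mem_set; rewrite /= in_itv/= s0.
Qed.

Lemma time_conv_ninfty (be : R) (phi : R -> \bar R) : 0 < be < 1 ->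
  {ae mu, forall s, 0 < s < T -> phi s = -oo%E} ->
  time_conv (gker be) phi t = -oo%E.
Proof.
move=> be01 pa; have /andP[t0 tT'] := tT; rewrite /time_conv.
transitivity (\int[mu]_(s in `]0%R, t[) (cst -oo s))%E.
  apply: integral_ae_congr; apply: (aeS _ pa) => s H; rewrite /= in_itv/= => /andP[s0 st].
  by rewrite H ?s0 ?(lt_le_trans st)//= gt0_muleNy// lte_fin gker_gt0// subr_gt0.
have E : mu `]0%R, t[%classic = t%:E.
  by rewrite lebesgue_measure_itv/= lte_fin t0 oppr0 adde0.
rewrite integral_cst//; rewrite [X in (_ * X)%E](_ : _ = t%:E)//.
by rewrite gt0_mulNye// lte_fin.
Qed.

End time_convolution.

(** * Both estimates on a Gelfand triple *)

Section gelfand_chain_rule.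
Context d (O : measurableType d) (R : realType) (m : {measure set O -> \bar R}).
Local Notation mu := (@lebesgue_measure R).
Local Notation L1 a := (mu.-integrable setT (EFin \o a)).
Local Notation mT a := (measurable_fun [set: R] a).
Variables (alpha T lambda : R) (V : normedModType R) (i : gelfand_triple m V).
Variables (u w : measurableTypeR R -> V) (u0 : LspaceType2 m).
Variables (Du : measurableTypeR R -> dual V) (E : R -> R^o).
Hypothesis alpha01 : 0 < alpha < 1.
Hypothesis T0 : 0 < T.
Hypothesis Hu : H_frac alpha T (fun t => L2_dual i (i (u t))) (L2_dual i u0) Du.
Hypothesis uoo : bochner_Lp +oo%E T u.
Hypothesis C1E : C1 E.
Hypothesis convE : lambda_convex lambda E.
Hypothesis w2 : bochner_Lp 2%:E T w.
Hypothesis wE : {ae mu, forall t, t \in `]0, T[ ->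
  i (w t) = (derive1 E \o i (u t)) %[ae m]}.

Let U t := L2_dual i (i (u t)).
Let U0 := L2_dual i u0.
Let f := zext `]0, T[ Du.
Let v := zext `]0, T[ (fun t : measurableTypeR R => U t - U0).
Let z (t : measurableTypeR R) := zext `]0, T[ w t - lambda *: zext `]0, T[ u t.
Let F := cshift E lambda.
Let dF x : R := derive1 E x - lambda * x.

Let Uh : bochner_Lp 2%:E T (U : measurableTypeR R -> dual V). Proof. by case: Hu. Qed.
Let Duh : bochner_Lp 2%:E T Du. Proof. by case: Hu. Qed.
Let Lf : L2fun f. Proof. exact: L2fun_zext. Qed.
Let Lw : L2fun (zext `]0, T[ w). Proof. exact: L2fun_zext. Qed.
Let LU : L2fun (zext `]0, T[ (U : measurableTypeR R -> dual V)).
Proof. exact: L2fun_zext. Qed.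

Let Lu : L2fun (zext `]0, T[ u).
Proof. by have [su [M _ uM]] := bochner_Loo T0 uoo; exact: (L2fun_bounded T0 su uM). Qed.

Let Lv : L2fun v.
Proof.
have Lc : L2fun (zext `]0, T[ (fun _ : measurableTypeR R => U0)).
  apply: (@L2fun_bounded _ _ T `|U0|) => //; last exact: aeW.
  exists (fun _ _ => U0) => [_|t _]; [exact: simple_cst|exact: cvg_cst].
rewrite (_ : v = fun t => zext `]0, T[ (U : measurableTypeR R -> dual V) t -
    1 *: zext `]0, T[ (fun _ : measurableTypeR R => U0) t); last first.
  apply/funext => t; rewrite scale1r /v; have [tT|tT] := boolP (0 < t < T).
    by rewrite !zext_in.
  by rewrite !zext_out// subr0.
exact: L2fun_sub.
Qed.

Let Lz : L2fun z. Proof. exact: L2fun_sub. Qed.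

Let fT t : ~~ (0 < t < T) -> f t = 0. Proof. exact: zext_out. Qed.
Let vT t : ~~ (0 < t < T) -> v t = 0. Proof. exact: zext_out. Qed.

Let fv (phi : V) : {ae mu, forall t, 0 < t < T ->
  cv (gk T (1 - alpha)) (fun s => v s phi) t = \int[mu]_s tcut t (fun r => f r phi) s}.
Proof. by case: Hu => _ _ cap; exact: (caputo_pairing T0 Duh cap). Qed.

Let mF : measurable_fun setT F.
Proof. apply: continuous_measurable_fun; exact: continuous_cshift. Qed.

Let F_dF a b : F b - F a <= dF b * (b - a).
Proof. exact: cshift_gradient_le. Qed.

Let good t := i (z t) = dF \o i (u t) %[ae m].

Let good_ae : {ae mu, forall t, 0 < t < T -> good t}.
Proof.
apply: (aeS _ wE) => t H tT; rewrite /good /z !zext_in//.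
have tT' : t \in `]0, T[ by rewrite in_itv.
have := embed_linear i (- lambda) (u t) (w t); rewrite scaleNr [- _ + _]addrC.
apply: filterS2 (H tT') => x h1 h2 _.
by rewrite (h2 Logic.I) (h1 Logic.I) /dF /= mulNr addrC.
Qed.

Let dE t : \bar R := (\int[m]_x (E (i (u t) x) - E (u0 x))%:E)%E.
Let dN t : R := L2norm m (i (u t)) ^+ 2 - L2norm m u0 ^+ 2.

Let EF a b : E a - E b = F a - F b + lambda / 2 * (a ^+ 2 - b ^+ 2).
Proof. by rewrite /F /cshift; ring. Qed.

Let mE : measurable_fun setT (E : R -> R).
Proof.
rewrite (_ : E = (fun x => F x + lambda / 2 * x ^+ 2) :> (R -> R)).
  by apply: measurable_funD => //; apply: measurable_funM => //; exact: measurable_funX.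
by apply/funext => x; rewrite /F /cshift subrK.
Qed.

Let i2 h h' : m.-integrable setT (fun x => (lambda / 2 * ((h : LspaceType2 m) x ^+ 2
  - (h' : LspaceType2 m) x ^+ 2))%:E).
Proof.
have := integrableB measurableT (integrable_L2M h h) (integrable_L2M h' h').
by move=> /(integrableZl measurableT (lambda / 2)); apply: eq_integrable.
Qed.

Let dN_int t : \int[m]_x (lambda / 2 * (i (u t) x ^+ 2 - u0 x ^+ 2)) = lambda / 2 * dN t.
Proof.
rewrite /dN !L2norm_sqr -RintegralB//; try exact: integrable_L2M.
rewrite RintegralZl//.
have := integrableB measurableT (integrable_L2M (i (u t)) (i (u t))) (integrable_L2M u0 u0).
by apply: eq_integrable => // x _; rewrite /= EFinB !expr2.
Qed.

Let dE_fin t : m.-integrable setT (fun x => (F (i (u t) x) - F (u0 x))%:E) ->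
  dE t = (\int[m]_x (F (i (u t) x) - F (u0 x)) + lambda / 2 * dN t)%:E.
Proof.
move=> iF.
have iE : m.-integrable setT (fun x => (E (i (u t) x) - E (u0 x))%:E).
  have := integrableD measurableT iF (i2 (i (u t)) u0).
  by apply: eq_integrable => // x _; rewrite /= -EFinD EF.
rewrite /dE -(fineK (integrable_fin_num measurableT iE)); congr EFin.
rewrite -dN_int -RintegralD//; last exact: i2.
by apply: eq_Rintegral => x _; rewrite EF.
Qed.

Let dE_ninfty t : good t ->
  ~ m.-integrable setT (fun x => (F (i (u t) x) - F (u0 x))%:E) -> dE t = -oo%E.
Proof.
move=> gt nF.
have ip := integrableD measurableT (integrable_pairing i (i (u t)) u0 (z t)) (i2 (i (u t)) u0).
apply: (@integral_ninfty _ _ _ m (fun x => E (i (u t) x) - E (u0 x))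
  (fun x => i (z t) x * (i (u t) x - u0 x) + lambda / 2 * (i (u t) x ^+ 2 - u0 x ^+ 2))).
- by apply: measurable_funB; apply: (measurableT_comp mE); exact: measurable_L2.
- exact: eq_integrable ip.
- apply: (aeS _ (energy_ae_le F_dF u0 gt)) => x.
  by rewrite EF lerD2r.
- move=> iE; apply: nF; have := integrableB measurableT iE (i2 (i (u t)) u0).
  by apply: eq_integrable => // x _; rewrite /= -EFinB EF addrK.
Qed.

Lemma gelfand_chain_rule :
  (forall t, t \in `]0, T[ ->
     (time_conv (gker (1 - alpha)) dE t
        - (lambda / 2)%:E * time_conv (gker (1 - alpha)) (EFin \o dN) t
      <= \int[mu]_(s in `]0%R, t[) (Du s (w s) - lambda * Du s (u s))%:E)%E)
  /\
  {ae mu, forall t, t \in `]0, T[ ->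
     (dE t - (lambda / 2 * dN t)%:E
      <= time_conv (gker alpha) (fun s => (Du s (w s))%:E) t
         - lambda%:E * time_conv (gker alpha) (fun s => (Du s (u s))%:E) t)%E}.
Proof.
have alpha'01 : 0 < 1 - alpha < 1 by move/andP: alpha01 => [? ?]; apply/andP; split; lra.
have [N [mN N0 NP]] := good_ae.
pose D : set R := `]0, T[%classic `\` N.
have mD : measurable D by exact: measurableD.
have DT t : D t -> 0 < t < T by case=> /=; rewrite in_itv.
have Dgood t : D t -> good t.
  by move=> Dt; apply: contrapT => ng; case: (Dt) => _; apply; apply: NP => /(_ (DT _ Dt)).
have aeD : {ae mu, forall t, 0 < t < T -> D t}.
  exists N; split => // t /= nD; apply: contrapT => nN; apply: nD => tT.
  by split => //=; rewrite in_itv.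
have [s0 Ds0] : D !=set0.
  apply: contrapT => D0.
  have TN : `]0, T[%classic `<=` N.
    by move=> t tT; apply: contrapT => nN; apply: D0; exists t.
  have TE : mu `]0, T[%classic = T%:E.
    by rewrite lebesgue_measure_itv/= lte_fin T0 oppr0 adde0.
  have := le_measure mu (mem_set (measurable_itv `]0, T[)) (mem_set mN) TN.
  rewrite [X in (X <= _)%E -> _]TE [X in (_ <= X)%E -> _]N0 lee_fin.
  by rewrite leNgt T0.
have iFF t s : D t -> D s ->
    m.-integrable setT (fun x => (F (i (u t) x) - F (i (u s) x))%:E).
  by move=> Dt Ds; exact: (energy_integrable mF F_dF (Dgood _ Dt) (Dgood _ Ds)).
(* The single time s0 decides for all of D, since energy differences between two times of D are
   integrable. *)
have [P|nP] := pselect (m.-integrable setT (fun x => (F (i (u s0) x) - F (u0 x))%:E)); last first.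
  have dEN t : D t -> dE t = -oo%E.
    move=> Dt; apply: dE_ninfty => [|iF]; first exact: Dgood.
    apply: nP; have := integrableB measurableT iF (iFF _ _ Dt Ds0).
    by apply: eq_integrable => // x _; rewrite /= -EFinB; congr EFin; ring.
  split => [t|].
    rewrite in_itv/= => /andP[t0 tT]; rewrite (@time_conv_ninfty _ T).
    - by rewrite addNye leNye.
    - by rewrite t0 ltW.
    - exact: alpha'01.
    - by apply: (aeS _ aeD) => s H sT; apply: dEN; exact: H.
  by apply: (aeS _ aeD) => t H; rewrite in_itv/= => tT; rewrite dEN ?addNye ?leNye//; exact: H.
have iF t : D t -> m.-integrable setT (fun x => (F (i (u t) x) - F (u0 x))%:E).
  move=> Dt; have := integrableD measurableT (iFF _ _ Dt Ds0) P.
  by apply: eq_integrable => // x _; rewrite /= -EFinD; congr EFin; ring.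
pose h t : R := if pselect (D t) then \int[m]_x (F (i (u t) x) - F (u0 x)) else 0.
have hE t : D t -> h t = \int[m]_x (F (i (u t) x) - F (u0 x)).
  by rewrite /h; case: pselect.
have h0 t : ~ D t -> h t = 0 by rewrite /h; case: pselect.
have hT t : ~~ (0 < t < T) -> h t = 0 by move=> tT; apply: h0 => /DT; exact/negP.
have hU t s : D t -> D s -> h t - h s <= (U t - U s) (z t).
  move=> Dt Ds; rewrite (hE _ Dt) (hE _ Ds) -(RintegralB measurableT (iF _ Dt) (iF _ Ds)).
  have le := energy_le F_dF (Dgood _ Dt) (iFF _ _ Dt Ds).
  apply: le_trans le; rewrite le_eqVlt; apply/orP; left; apply/eqP.
  by apply: eq_Rintegral => x _; ring.
have mh : mT h.
  apply: (measurable_subgradient (U := zext `]0, T[ U) mD LU.1 Lz.1 _ h0) => t s Dt Ds.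
  by rewrite !zext_in ?DT//; exact: hU.
have hv t : D t -> h t <= v t (z t).
  move=> Dt; rewrite (hE _ Dt) /v zext_in ?DT//.
  exact: (energy_le F_dF (Dgood _ Dt) (iF _ Dt)).
have ivz : L1 (fun t => v t (z t)) by exact: L1_dual.
have [su [M M0 uM]] := bochner_Loo T0 uoo.
(* The subgradient inequality at s0 reads h t >= h s0 - U s0 (z s0) + U t (z s0). By symmetry of the
   L^2 pairing, U t (z s0) is the functional of z s0 evaluated at u t, and M bounds |u t|. *)
pose C := `|h s0| + `|U s0 (z s0)| + `|L2_dual i (i (z s0))| * M.
have C0 : 0 <= C by rewrite !addr_ge0// mulr_ge0.
have hC : {ae mu, forall t, 0 < t < T -> - C <= h t}.
  apply: (aeS2 _ aeD uM) => t H1 H2 tT; have Dt := H1 tT; have ut := H2 tT.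
  have E1 : U t (z s0) = L2_dual i (i (z s0)) (u t) by exact: L2_dualC.
  have := hU _ _ Ds0 Dt; rewrite dual_subE E1 /C /U.
  have a1 := dual_le (L2_dual i (i (z s0))) (u t).
  have a2 : `|L2_dual i (i (z s0))| * `|u t| <= `|L2_dual i (i (z s0))| * M by rewrite ler_wpM2l.
  have a3 := ler_norm (- L2_dual i (i (z s0)) (u t)).
  have a4 := ler_norm (L2_dual i (i (u s0)) (z s0)).
  have a5 := ler_norm (- h s0).
  rewrite normrN in a3; rewrite normrN in a5.
  have := le_trans a3 (le_trans a1 a2).
  move: (`|L2_dual i (i (z s0))| * M) a4 a5 => c.
  move: (L2_dual i (i (u s0)) (z s0)) (L2_dual i (i (z s0)) (u t)) => a b a4 a5 a6 a7.
  have : h s0 - h t <= a - b :> R by [].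
  by lra.
have ih : L1 h.
  apply/integrableP; split; first exact/measurable_EFinP.
  have iD := integrableD measurableT (integrableZl measurableT C (L1_one T)) (integrable_abse ivz).
  have /integrableP[_] := iD; apply: le_lt_trans; apply: ae_ge0_le_integral => //.
  - by apply/measurable_EFinP; exact: measurableT_comp.
  - by apply: measurableT_comp => //; exact: measurable_int iD.
  - apply: (aeS2 _ aeD hC) => t H1 H2 _.
    have [tT|tT] := boolP (0 < t < T); last by rewrite /= lee_fin hT// normr0 normr_ge0.
    have h1 := hv _ (H1 tT); have h2 := H2 tT.
    rewrite /= lee_fin [leRHS]ger0_norm; last first.
      by rewrite addr_ge0// mulr_ge0// /one cutE.
    rewrite /one cutE//= mulr1; have := ler_norm (v t (z t)).
    have := normr_ge0 (v t (z t)); move: h1 h2 C0; set a := v t _; move: (`|a|) => b.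
    by rewrite ler_norml => *; apply/andP; split; lra.
have hv_ae : {ae mu, forall t, 0 < t < T -> h t <= v t (z t)}.
  by apply: (aeS _ aeD) => t H tT; apply: hv; exact: H.
have hvv : {ae mu, forall t, 0 < t < T ->
    {ae mu, forall s, 0 < s < T -> h t - h s <= (v t - v s) (z t)}}.
  apply: (aeS _ aeD) => t Ht tT; apply: (aeS _ aeD) => s Hs sT.
  rewrite /v !zext_in// opprB addrA subrK; exact: hU (Ht tT) (Hs sT).
have chain_ae := fractional_chain_rule_ae alpha01 T0 Lf Lv Lz ih fT vT hT fv hv_ae hvv.
have chain := fractional_chain_rule alpha01 T0 Lf Lv Lz ih fT vT hT fv hv_ae hvv hC.
have acvh := acv_fractional_lty alpha01 T0 Lf Lv Lz ih fT vT hT fv hv_ae hvv hC.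
pose pw s : R := f s (zext `]0, T[ w s).
pose pu s : R := f s (zext `]0, T[ u s).
have ipw : L1 pw by exact: L1_dual.
have ipu : L1 pu by exact: L1_dual.
have pE : (fun s => f s (z s)) = fun s => pw s + - lambda * pu s.
  apply/funext => s; rewrite /z addrC -scaleNr dual_lin addrC //.
(* The function dN extended by zero, with the squared norm written as the pairing of U s with u s,
   whose measurability is known. *)
pose n s : R := zext `]0, T[ (U : measurableTypeR R -> dual V) s (zext `]0, T[ u s)
  - L2norm m u0 ^+ 2 * one T s.
have mo : mT (one T) by exact: measurable_one.
have mn : mT n.
  apply: measurable_funB; first exact: (measurable_dual LU.1 Lu.1).
  exact: measurable_funM.
have nE s : 0 < s < T -> n s = dN s.
  move=> sT; rewrite /n !zext_in// /one cutE//= mulr1 /dN; congr (_ - _).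
  rewrite L2norm_sqr -[LHS]/(\int[m]_x (i (u s) x * i (u s) x)).
  by apply: eq_Rintegral => x _; rewrite expr2.
have nT s : ~~ (0 < s < T) -> n s = 0.
  by move=> sT; rewrite /n zext_out// /one /tcut (negbTE sT) mulr0 subr0.
have mgg : mT (gk T (1 - alpha)) := measurable_gk T (1 - alpha).
have igg : L1 (gk T (1 - alpha)) by exact: L1_gk.
have acvn k t : t <= T -> (acv (gk T (1 - alpha)) (fun s => (k * n s)%R) t < +oo)%E.
  move=> tT; have [K iK] := embed_bounded i.
  (* From the bound K |u s| <= |K| M on the L^2 norm of i (u s); absolute values because k and K
     have no sign. *)
  pose B := `|k| * ((`|K| * M) ^+ 2 + L2norm m u0 ^+ 2).
  have B0 : 0 <= B by rewrite mulr_ge0// addr_ge0// sqr_ge0.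
  have mkn : mT (fun s => k * n s) by exact: measurable_funM.
  have mBo : mT (fun s => B * one T s) by exact: measurable_funM.
  apply: (@le_lt_trans _ _ (acv (gk T (1 - alpha)) (fun s => (B * one T s)%R) t)).
    apply: (acv_le_ae mgg mkn mBo _ _ _ _ tT).
    - exact: causal_cut.
    - by move=> x x0; rewrite nT ?mulr0// ltNge x0.
    - by move=> x x0; rewrite /one causal_cut// mulr0.
    - apply: (aeS _ uM) => s H sT; rewrite nE// /one cutE//= mulr1 (ger0_norm B0).
      rewrite normrM ler_wpM2l//; apply: le_trans (ler_normB _ _) _.
      apply: lerD; last by rewrite ger0_norm ?sqr_ge0.
      rewrite ger0_norm ?sqr_ge0//.
      have L0 : 0 <= L2norm m (i (u s)) by rewrite fine_ge0// Lnorm_ge0.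
      rewrite ler_pXn2r ?nnegrE ?mulr_ge0//.
      apply: le_trans (iK _) _; apply: (@le_trans _ _ (`|K| * `|u s|)).
        by rewrite ler_wpM2r// ler_norm.
      by rewrite ler_wpM2l// H.
  rewrite acvC//; apply: (@acv_bounded_lty _ _ _ _ B) => // x.
  by rewrite normrM (ger0_norm B0) ler_piMr// one_le1.
have acvn1 t : t <= T -> (acv (gk T (1 - alpha)) n t < +oo)%E.
  move=> /(acvn 1); rewrite (_ : (fun s => 1 * n s) = n)//.
  by apply/funext => s; rewrite mul1r.
have dEh : {ae mu, forall s, 0 < s < T -> dE s = (h s + lambda / 2 * n s)%:E}.
  apply: (aeS _ aeD) => s H sT; have Ds := H sT.
  by rewrite (dE_fin (iF _ Ds)) (hE _ Ds) nE.
have ch : causal h by exact: (causal_of hT).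
have cn : causal n by exact: (causal_of nT).
split => [t|].
  rewrite in_itv/= => tT; have /andP[t0 /ltW tT'] := tT.
  have t0T : 0 < t <= T by rewrite t0.
  have mkn : mT (fun s => lambda / 2 * n s) by exact: measurable_funM.
  have acvhn : (acv (gk T (1 - alpha)) (fun s => (h s + lambda / 2 * n s)%R) t < +oo)%E.
    have H := acvD_le t mgg mh mkn.
    by apply: (le_lt_trans H); apply: lte_add_pinfty; [exact: acvh|exact: acvn].
  have mhn : mT (fun s => h s + lambda / 2 * n s) by exact: measurable_funD.
  have chn : causal (fun s => h s + lambda / 2 * n s).
    by move=> x x0; rewrite ch// cn// mulr0 addr0.
  rewrite (time_conv_cv t0T mhn chn acvhn dEh).
  rewrite (@time_conv_cv _ T t t0T _ n (EFin \o dN) mn cn (acvn1 _ tT')); last first.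
    by apply: aeW => s sT; rewrite /= nE.
  (* All convolutions being finite, the lambda / 2 terms cancel and g_(1 - alpha) * h remains. *)
  rewrite (cvDZr _ mgg mh mn (acvh _ tT') (acvn1 _ tT')) -EFinM -EFinB addrK.
  have -> : (\int[mu]_(s in `]0%R, t[) (Du s (w s) - lambda * Du s (u s))%:E =
      (\int[mu]_s tcut t (fun s => f s (z s)) s)%:E)%E.
    have ic : L1 (tcut t (fun s => f s (z s))).
      by apply: L1_cut; apply: integrableS (L1_dual Lf Lz).
    rewrite /Rintegral fineK; last exact: integrable_fin_num ic.
    rewrite integral_cut; apply: eq_integral => s /set_mem/=; rewrite in_itv/= => /andP[s0' st].
    have sT : 0 < s < T by rewrite s0' (lt_le_trans st).
    have -> : f s (z s) = pw s + - lambda * pu s by have := congr1 (fun k => k s) pE.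
    by rewrite /pw /pu /f !zext_in// mulNr.
  by rewrite lee_fin; exact: chain.
have mg : mT (gk T alpha) := measurable_gk T alpha.
have ig : L1 (gk T alpha) by exact: L1_gk.
apply: (aeS3 _ (aeS2 _ aeD chain_ae) (ae_acv ig ipw) (ae_acv ig ipu)); last first.
  by move=> t H1 H2; exact: (conj H1 H2).
move=> t [H1 H2] H3 H4; rewrite in_itv/= => tT; have /andP[t0 /ltW tT'] := tT.
have t0T : 0 < t <= T by rewrite t0.
have Dt := H1 tT.
have cpw : causal pw by apply: (@causal_of _ T) => s sT; rewrite /pw (fT sT).
have cpu : causal pu by apply: (@causal_of _ T) => s sT; rewrite /pu (fT sT).
rewrite (@time_conv_cv _ T t t0T _ pw _ (L1_mT ipw) cpw H3); last first.
  by apply: aeW => s sT; rewrite /pw /f !zext_in.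
rewrite (@time_conv_cv _ T t t0T _ pu _ (L1_mT ipu) cpu H4); last first.
  by apply: aeW => s sT; rewrite /pu /f !zext_in.
rewrite (dE_fin (iF _ Dt)) -(hE _ Dt) -EFinB addrK -EFinM -EFinB lee_fin.
have := H2 tT; rewrite pE (cvDZr _ mg (L1_mT ipw) (L1_mT ipu) H3 H4).
by rewrite mulNr.
Qed.

End gelfand_chain_rule.

Theorem proposition1 (R : realType) (alpha T lambda : R) (d : nat)
    (Omega : set 'rV[R]_d) (oOmega : open Omega)
    (V : completeNormedModType R)
    (i : gelfand_triple (lebesgue_on oOmega) V)
    (u : measurableTypeR R -> V) (u0 : LspaceType2 (lebesgue_on oOmega))
    (Du : measurableTypeR R -> dual V) (E : R -> R^o)
    (w : measurableTypeR R -> V) :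
  0 < alpha < 1 -> 0 < T ->
  Omega !=set0 -> connected Omega -> bounded_set Omega ->
  H_frac alpha T (fun t => L2_dual i (i (u t))) (L2_dual i u0) Du ->
  bochner_Lp +oo%E T u ->
  C1 E -> lambda_convex lambda E ->
  bochner_Lp 2%:E T w ->
  {ae lebesgue_measure, forall t, t \in `]0, T[ ->
     i (w t) = (derive1 E \o i (u t)) %[ae lebesgue_on oOmega]} ->
  let dE t : \bar R :=
    (\int[lebesgue_on oOmega]_x (E (i (u t) x) - E (u0 x))%:E)%E in
  let dN t : R :=
    L2norm (lebesgue_on oOmega) (i (u t)) ^+ 2
    - L2norm (lebesgue_on oOmega) u0 ^+ 2 in
  (forall t, t \in `]0, T[ ->
     (time_conv (gker (1 - alpha)) dE t
        - (lambda / 2)%:E * time_conv (gker (1 - alpha)) (EFin \o dN) t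
      <= \int[lebesgue_measure]_(s in `]0%R, t[)
           (Du s (w s) - lambda * Du s (u s))%:E)%E)
  /\
  {ae lebesgue_measure, forall t, t \in `]0, T[ ->
     (dE t - (lambda / 2 * dN t)%:E
      <= time_conv (gker alpha) (fun s => (Du s (w s))%:E) t
         - lambda%:E * time_conv (gker alpha) (fun s => (Du s (u s))%:E) t)%E}.
Proof.
move=> alpha01 T0 _ _ _ Hu uoo C1E convE w2 wE dE dN.
exact: (gelfand_chain_rule alpha01 T0 Hu uoo C1E convE w2 wE).
Qed.
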